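(* Let $d\ge 1$, let $\Lambda$ be the finitely generated abelian group $\mathbb{Z}^{m}\times(\mathbb{Z}/2\mathbb{Z})^{r_2}\times\mathbb{Z}/q_1\mathbb{Z}\times\cdots\times\mathbb{Z}/q_t\mathbb{Z}$, let $\Gamma=\mathbb{Z}^{*d}$ and $G=\Lambda\wr\Gamma$ with its natural symmetric generating set $S$. Let $\mu$ be the spectral measure (at $\delta_{e_G}$) of the Markov operator of the simple random walk on the Cayley graph of $G$ with generators $S$, and let $\mu_N$ be the empirical spectral distribution of the random $N\times N$ Hermitian matrix $$X_N=\frac{1}{2d+2m+2t+r_2}\left(\sum_{i=1}^{d}(V_i+V_i^{*})+\sum_{j=1}^{m}(D_j+D_j^* )+\sum_{j=1}^{t}(\Delta_{j}+\Delta_j^* )+\sum_{r=1}^{r_2}D'_r\right).$$ Then $\mu_N\to\mu$ weakly in probability as $N\to\infty$; that is, for every bounded continuous $f:\mathbb{R}\to\mathbb{R}$, $\int f\,d\mu_N\to\int f\,d\mu$ in probability.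
   Context: Parameters: $m,r_2,t\ge 0$ and $q_1,\dots,q_t\ge 3$ are fixed integers. $\Gamma=\mathbb{Z}^{*d}$ is the free group on $d$ generators. Wreath product: an element of $G=\Lambda\wr\Gamma=(\bigoplus_\Gamma\Lambda)\rtimes\Gamma$ is a pair $(f,g)$ with $f:\Gamma\to\Lambda$ of finite support and $g\in\Gamma$; the product is $(f,g)(f',g')=(f\cdot(f'\circ g^{-1}),gg')$, where $(f'\circ g^{-1})(\gamma)=f'(g^{-1}\gamma)$. $\Lambda$ embeds by $\lambda\mapsto\hat\lambda=(\mathbf{1}_\lambda,e_\Gamma)$, where $\mathbf{1}_\lambda(e_\Gamma)=\lambda$ and $\mathbf{1}_\lambda(\gamma)=e_\Lambda$ for $\gamma\ne e_\Gamma$; $\Gamma$ embeds by $\gamma\mapsto\hat\gamma=(e,\gamma)$ with $e$ the trivial function. Generators: $S_\Lambda$ is the set of canonical generators $(1,0,\dots,0),(0,1,0,\dots,0),\dots$ of $\Lambda$ together with their inverses; $S_\Gamma$ is the set of the $d$ free generators of $\Gamma$ and their inverses; $S=\hat S_\Gamma\sqcup\hat S_\Lambda\subset G$. Then $|S|=2d+2m+2t+r_2$. Markov operator: $M:\ell^2(G)\to\ell^2(G)$, $M\phi(h)=\frac1{|S|}\sum_{s\in S}\phi(sh)$, a bounded self-adjoint operator with spectral resolution $E$; $\mu(B)=\langle E(B)\delta_{e_G},\delta_{e_G}\rangle$ for Borel $B\subset[-1,1]$. Random matrices (all $N\times N$): $V_1,\dots,V_d$ are i.i.d. uniform random permutation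 matrices; $D_1,\dots,D_m$, $D'_1,\dots,D'_{r_2}$, $\Delta_1,\dots,\Delta_t$ are diagonal matrices whose diagonal entries are all independent and independent of the $V_i$; the diagonal entries of each $D_j$ are uniform on the unit circle, those of each $D'_j$ are uniform on $\{\pm1\}$, and those of $\Delta_j$ are uniform on $\{\exp(2ik\pi/q_j):1\le k\le q_j\}$. The empirical spectral distribution is the uniform probability measure on the $N$ eigenvalues counted with multiplicity. *)

(* Defs.v *)
From HB Require Import structures.
From mathcomp Require Import all_boot all_order all_algebra all_fingroup.
From mathcomp Require Import finmap complex spectral.
From mathcomp Require Import all_classical all_reals all_analysis.

Set Implicit Arguments.
Unset Strict Implicit.
Unset Printing Implicit Defensive.

Import Order.TTheory GRing.Theory Num.Theory.
Import numFieldNormedType.Exports.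

Local Open Scope classical_set_scope.
Local Open Scope ring_scope.
Local Open Scope complex_scope.
Local Open Scope sesquilinear_scope.

(* Free groups, as reduced words.  The letter (i, false) stands for the i-th  *)
(* generator and (i, true) for its inverse.                                   *)

Section FreeGroup.
Variable d : nat.

Definition letter : Type := 'I_d * bool.

Definition linv (a : letter) : letter := (a.1, ~~ a.2).

Definition reduced (w : seq letter) : bool :=
  sorted (fun a b => b != linv a) w.

Definition lpush (a : letter) (w : seq letter) : seq letter :=
  if w is b :: w' then if b == linv a then w' else a :: w else [:: a].

Lemma linvK : involutive linv.
Proof. by case=> i b; rewrite /linv /= negbK. Qed.

Lemma reduced_tl a w : reduced (a :: w) -> reduced w.
Proof. by case: w => //= b w /andP[]. Qed.

Lemma lpush_reduced a w : reduced w -> reduced (lpush a w).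
Proof.
case: w => //= b w rw; case: ifPn => [_|nb]; first exact: (@reduced_tl b).
by rewrite /= nb.
Qed.

Lemma foldr_lpush_reduced u v : reduced v -> reduced (foldr lpush v u).
Proof. by move=> rv; elim: u => //= a u; apply: lpush_reduced. Qed.

Lemma lpushK a w : reduced w -> lpush (linv a) (lpush a w) = w.
Proof.
case: w => [_|b w] /=; first by rewrite linvK eqxx.
case: ifPn => [/eqP -> |nb] rw; last by rewrite /= linvK eqxx.
by case: w rw => //= c w /andP[/negPf ->].
Qed.

Lemma lpush_reduced_cons a w : reduced (a :: w) -> lpush a w = a :: w.
Proof. by case: w => //= b w /andP[/negPf ->]. Qed.

Lemma foldr_lpush_nil w : reduced w -> foldr lpush [::] w = w.
Proof.
elim: w => //= a w IH rw; rewrite IH; last exact: (reduced_tl rw).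
exact: lpush_reduced_cons.
Qed.

Lemma foldr_lpush_lpush a v w : reduced v -> reduced w ->
  foldr lpush w (lpush a v) = lpush a (foldr lpush w v).
Proof.
case: v => //= b v rv rw; case: ifPn => [/eqP->|//].
by have /(lpushK (linv a)) := foldr_lpush_reduced v rw; rewrite linvK.
Qed.

Lemma foldr_lpushA u v w : reduced v -> reduced w ->
  foldr lpush w (foldr lpush v u) = foldr lpush (foldr lpush w v) u.
Proof.
move=> rv rw; elim: u => //= a u IH.
by rewrite foldr_lpush_lpush ?IH // foldr_lpush_reduced.
Qed.

Definition winv (w : seq letter) : seq letter := rev (map linv w).

Lemma winvK : involutive winv.
Proof.
move=> w; rewrite /winv map_rev revK -map_comp -[RHS]map_id.
by apply: eq_map => a /=; rewrite linvK.
Qed.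

Lemma winv_reduced w : reduced w -> reduced (winv w).
Proof.
rewrite /reduced /winv rev_sorted sorted_map; apply: sub_sorted => a b /=.
by apply: contra => /eqP; rewrite linvK => ->.
Qed.

Lemma foldr_lpush_winv w v : reduced v ->
  foldr lpush (foldr lpush v w) (winv w) = v.
Proof.
move=> rv; elim: w => //= a w IH.
by rewrite /winv /= rev_cons foldr_rcons lpushK // foldr_lpush_reduced.
Qed.

Definition free_group : Type := {w : seq letter | reduced w}.
HB.instance Definition _ := Choice.on free_group.

Definition fg_one : free_group := exist _ [::] isT.
Definition fg_inv (u : free_group) : free_group :=
  exist _ (winv (val u)) (winv_reduced (valP u)).
Definition fg_mul (u v : free_group) : free_group :=
  exist _ (foldr lpush (val v) (val u)) (foldr_lpush_reduced _ (valP v)).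

Lemma fg_mulA : associative fg_mul.
Proof.
move=> u v w; apply/val_inj; rewrite /= foldr_lpushA //; exact: valP.
Qed.

Lemma fg_mul1 : left_id fg_one fg_mul.
Proof. by move=> u; apply/val_inj. Qed.

Lemma fg_mulr1 : right_id fg_one fg_mul.
Proof. by move=> u; apply/val_inj => /=; rewrite foldr_lpush_nil ?(valP u). Qed.

Lemma fg_mulV : left_inverse fg_one fg_inv fg_mul.
Proof.
move=> u; apply/val_inj => /=.
by rewrite -[X in foldr _ X]foldr_lpush_nil ?(valP u) // foldr_lpush_winv.
Qed.

Lemma fg_mulrV : right_inverse fg_one fg_inv fg_mul.
Proof.
move=> u; rewrite -[X in fg_mul X _](_ : fg_inv (fg_inv u) = u) ?fg_mulV //.
by apply/val_inj; rewrite /= winvK.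
Qed.

HB.instance Definition _ := isGroup.Build free_group
  fg_mulA fg_mul1 fg_mulr1 fg_mulV fg_mulrV.

Definition fg_gen (i : 'I_d) : free_group := exist _ [:: (i, false)] isT.

Definition fg_gens : {fset free_group} :=
  ([fset fg_gen i | i in 'I_d] `|` [fset (fg_gen i)^-1%g | i in 'I_d])%fset.

End FreeGroup.

Section Lamps.
Variables (m r2 t : nat) (q : 'I_t -> nat).

Definition cyclic_prod : Type := {dffun forall j : 'I_t, 'Z_(q j)}.
HB.instance Definition _ := Choice.on cyclic_prod.

Definition cp_zero : cyclic_prod := [ffun j => 0].
Definition cp_opp (x : cyclic_prod) : cyclic_prod := [ffun j => - x j].
Definition cp_add (x y : cyclic_prod) : cyclic_prod := [ffun j => x j + y j].

Lemma cp_addA : associative cp_add.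
Proof. by move=> x y z; apply/ffunP => j; rewrite !ffunE addrA. Qed.
Lemma cp_addC : commutative cp_add.
Proof. by move=> x y; apply/ffunP => j; rewrite !ffunE addrC. Qed.
Lemma cp_add0 : left_id cp_zero cp_add.
Proof. by move=> x; apply/ffunP => j; rewrite !ffunE add0r. Qed.
Lemma cp_addN : left_inverse cp_zero cp_opp cp_add.
Proof. by move=> x; apply/ffunP => j; rewrite !ffunE addNr. Qed.

HB.instance Definition _ := GRing.isZmodule.Build cyclic_prod
  cp_addA cp_addC cp_add0 cp_addN.

Definition cp_gen (j : 'I_t) : cyclic_prod := [ffun k => (k == j)%:R].

Definition lamp : Type := 'rV[int]_m * 'rV['Z_2]_r2 * cyclic_prod.
HB.instance Definition _ := GRing.Zmodule.on lamp.

Definition lamp_gen : seq lamp :=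
  [seq (delta_mx 0 i, 0, 0) | i : 'I_m] ++
  [seq (0, delta_mx 0 r, 0) | r : 'I_r2] ++
  [seq (0, 0, cp_gen j) | j : 'I_t].

Definition lamp_gens : {fset lamp} :=
  ([fset x in lamp_gen] `|` [fset - x | x in lamp_gen])%fset.

End Lamps.

(* The lamp group is written additively.                                      *)

Section Wreath.
Variables (L : zmodType) (K : groupType).

Definition wreath : Type := {fsfun K -> L with 0} * K.
HB.instance Definition _ := Choice.on wreath.

Definition fsf_one : {fsfun K -> L with 0} := [fsfun].

Definition fsf_mul (f f' : {fsfun K -> L with 0}) (g : K) :
    {fsfun K -> L with 0} :=
  [fsfun x in (finsupp f `|` [fset (g * y)%g | y in finsupp f'])%fset
     => f x + f' (g^-1 * x)%g].

Definition fsf_inv (f : {fsfun K -> L with 0}) (g : K) :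
    {fsfun K -> L with 0} :=
  [fsfun x in [fset (g^-1 * y)%g | y in finsupp f]%fset => - f (g * x)%g].

Lemma fsf_oneE x : fsf_one x = 0. Proof. by rewrite /fsf_one fsfunE. Qed.

Lemma fsf_mulE f f' g x : fsf_mul f f' g x = f x + f' (g^-1 * x)%g.
Proof.
rewrite /fsf_mul fsfunE; case: ifPn => //.
rewrite inE negb_or => /andP[/fsfun_dflt -> nx].
rewrite add0r fsfun_dflt //; apply: contra nx => gx.
by apply/imfsetP; exists (g^-1 * x)%g => //; rewrite mulKVg.
Qed.

Lemma fsf_invE f g x : fsf_inv f g x = - f (g * x)%g.
Proof.
rewrite /fsf_inv fsfunE; case: ifPn => // nx.
rewrite fsfun_dflt ?oppr0 //; apply: contra nx => gx.
by apply/imfsetP; exists (g * x)%g => //; rewrite mulKg.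
Qed.

Definition wr_one : wreath := (fsf_one, 1%g).
Definition wr_mul (u v : wreath) : wreath :=
  (fsf_mul u.1 v.1 u.2, (u.2 * v.2)%g).
Definition wr_inv (u : wreath) : wreath := (fsf_inv u.1 u.2, u.2^-1%g).

Lemma wr_mulA : associative wr_mul.
Proof.
move=> u v w; congr pair => /=; last exact: mulgA.
by apply/fsfunP => x; rewrite !fsf_mulE invgM addrA mulgA.
Qed.
Lemma wr_mul1 : left_id wr_one wr_mul.
Proof.
case=> f g; congr pair => /=; last exact: mul1g.
by apply/fsfunP => x; rewrite fsf_mulE fsf_oneE invg1 mul1g add0r.
Qed.
Lemma wr_mulr1 : right_id wr_one wr_mul.
Proof.
case=> f g; congr pair => /=; last exact: mulg1.
by apply/fsfunP => x; rewrite fsf_mulE fsf_oneE addr0.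
Qed.
Lemma wr_mulV : left_inverse wr_one wr_inv wr_mul.
Proof.
case=> f g; congr pair => /=; last exact: mulVg.
by apply/fsfunP => x; rewrite fsf_mulE fsf_invE invgK addNr fsf_oneE.
Qed.
Lemma wr_mulrV : right_inverse wr_one wr_inv wr_mul.
Proof.
case=> f g; congr pair => /=; last exact: mulgV.
by apply/fsfunP => x; rewrite fsf_mulE fsf_invE mulKVg subrr fsf_oneE.
Qed.

HB.instance Definition _ := isGroup.Build wreath
  wr_mulA wr_mul1 wr_mulr1 wr_mulV wr_mulrV.

Definition wr_lamp (l : L) : wreath :=
  ([fsfun x in [fset 1%g]%fset => l], 1%g).
Definition wr_base (g : K) : wreath := (fsf_one, g).

Definition wr_gens (SK : {fset K}) (SL : {fset L}) : {fset wreath} :=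
  ([fset wr_base g | g in SK] `|` [fset wr_lamp l | l in SL])%fset.

End Wreath.

Section Hilbert.
Variables (R : realType) (T : choiceType).

Definition l2 : set (T -> R[i]) :=
  [set phi | (\esum_(x in [set: T]) (complex.Re (`|phi x| ^+ 2))%:E < +oo)%E].

(* Only meaningful for absolutely summable families.                          *)
Definition rsum (a : T -> R) : R :=
  fine (\esum_(x in [set: T]) (EFin \o a)^\+ x
        - \esum_(x in [set: T]) (EFin \o a)^\- x)%E.

Definition inner (phi psi : T -> R[i]) : R[i] :=
  rsum (fun x => complex.Re (phi x * (psi x)^*)) +i*
  rsum (fun x => complex.Im (phi x * (psi x)^*)).

Definition delta (x : T) : T -> R[i] := fun y => (y == x)%:R.

(* An operator on l2 is a map on all functions of which only the values on l2 *)
(* matter.                                                                    *)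
Definition operator : Type := (T -> R[i]) -> (T -> R[i]).

Record orthogonal_projection (A : operator) : Prop := {
  op_l2 : forall phi, l2 phi -> l2 (A phi) ;
  op_linear : forall (a : R[i]) phi psi, l2 phi -> l2 psi ->
    A (fun x => a * phi x + psi x) = (fun x => a * A phi x + A psi x) ;
  op_idem : forall phi, l2 phi -> A (A phi) = A phi ;
  op_selfadjoint : forall phi psi, l2 phi -> l2 psi ->
    inner (A phi) psi = inner phi (A psi) }.

Definition is_spectral_measure (E : set R -> operator) (phi : T -> R[i])
    (mu : {measure set R -> \bar R}) : Prop :=
  forall B : set R, measurable B ->
    mu B = (complex.Re (inner (E B phi) phi))%:E.

(* E is the spectral resolution of the operator A, whose spectrum is assumed  *)
(* to lie in [-1, 1]; E B stands for the spectral projection of B `&` [-1, 1].*)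
Record spectral_resolution (A : operator) (E : set R -> operator) : Prop := {
  sr_proj : forall B : set R, measurable B -> orthogonal_projection (E B) ;
  sr_setT : forall phi, l2 phi -> E setT phi = phi ;
  sr_supp : forall phi, l2 phi -> E `[-1, 1]%classic phi = phi ;
  sr_setI : forall (B C : set R) phi, measurable B -> measurable C -> l2 phi ->
    E (B `&` C) phi = E B (E C phi) ;
  sr_integral : forall phi, l2 phi ->
    exists2 mu : {measure set R -> \bar R}, is_spectral_measure E phi mu
      & inner (A phi) phi = (\int[mu]_x x)%:C }.

End Hilbert.

Definition markov_operator (R : realType) (K : groupType) (S : {fset K}) :
    operator R K :=
  fun phi h => (#|` S|%:R)^-1 * \sum_(s <- S) phi (s * h)%g.

Section Probability.
Variables (R : realType) (dO : measure_display) (Om : measurableType dO).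
Variable P : probability Om R.

Definition mutually_independent (I : finType) (F : I -> set (set Om)) : Prop :=
  forall (J : {set I}) (A : I -> set Om), (forall i, i \in J -> F i (A i)) ->
    P (\bigcap_(i in [set` J]) A i) = (\prod_(i in J) P (A i))%E.

Definition coords (z : R[i]) : R * R := (complex.Re z, complex.Im z).
Definition expi (x : R) : R[i] := cos x +i* sin x.

Lemma twopi_gt0 : 0 < 2 * pi :> R.
Proof. by rewrite mulr_gt0 // pi_gt0. Qed.

Definition uniform_permutation N (V : Om -> 'S_N) : Prop :=
  forall s : 'S_N, measurable (V @^-1` [set s]) /\
    P (V @^-1` [set s]) = ((N`!)%:R^-1)%:E.

Definition uniform_circle (Z : Om -> R[i]) : Prop :=
  measurable_fun setT (coords \o Z) /\
  forall B : set (R * R), measurable B ->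
    P ((coords \o Z) @^-1` B) =
    uniform_prob twopi_gt0 [set x | B (coords (expi x))].

Definition uniform_roots (n : nat) (Z : Om -> R[i]) : Prop :=
  measurable_fun setT (coords \o Z) /\
  forall k : nat, (1 <= k <= n)%N ->
    P (Z @^-1` [set expi (2 * k%:R * pi / n%:R)]) = (n%:R^-1)%:E.

Definition uniform_signs (X : Om -> R) : Prop :=
  measurable_fun setT X /\
  forall e : R, e = 1 \/ e = -1 -> P (X @^-1` [set e]) = (2^-1)%:E.

Definition sigma_perm N (V : Om -> 'S_N) : set (set Om) :=
  [set V @^-1` B | B in [set: set 'S_N]].
Definition sigma_cplx (Z : Om -> R[i]) : set (set Om) :=
  [set (coords \o Z) @^-1` B | B in [set B : set (R * R) | measurable B]].
Definition sigma_real (X : Om -> R) : set (set Om) :=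
  [set X @^-1` B | B in [set B : set R | measurable B]].

Variables (d m r2 t : nat) (q : 'I_t -> nat).

(* Below, Dm j a, Ds r a and Dt j a are the a-th diagonal entries of the      *)
(* matrices D_j, D'_r and Delta_j.                                            *)

Definition model_index (N : nat) : finType :=
  ('I_d + 'I_m * 'I_N + 'I_r2 * 'I_N + 'I_t * 'I_N)%type.

Definition model_sigma N (V : 'I_d -> Om -> 'S_N)
    (Dm : 'I_m -> 'I_N -> Om -> R[i]) (Ds : 'I_r2 -> 'I_N -> Om -> R)
    (Dt : 'I_t -> 'I_N -> Om -> R[i])
    (k : model_index N) : set (set Om) :=
  match k with
  | inl (inl (inl i)) => sigma_perm (V i)
  | inl (inl (inr (j, a))) => sigma_cplx (Dm j a)
  | inl (inr (r, a)) => sigma_real (Ds r a)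
  | inr (j, a) => sigma_cplx (Dt j a)
  end.

Record random_model (N : nat) := RandomModel {
  rm_V : 'I_d -> Om -> 'S_N ;
  rm_Dm : 'I_m -> 'I_N -> Om -> R[i] ;
  rm_Ds : 'I_r2 -> 'I_N -> Om -> R ;
  rm_Dt : 'I_t -> 'I_N -> Om -> R[i] ;
  rm_V_law : forall i, uniform_permutation (rm_V i) ;
  rm_Dm_law : forall j a, uniform_circle (rm_Dm j a) ;
  rm_Ds_law : forall r a, uniform_signs (rm_Ds r a) ;
  rm_Dt_law : forall j a, uniform_roots (q j) (rm_Dt j a) ;
  rm_indep : mutually_independent (model_sigma rm_V rm_Dm rm_Ds rm_Dt) }.

Definition random_matrix N (W : random_model N) (w : Om) : 'M[R[i]]_N :=
  let V i : 'M[R[i]]_N := perm_mx (rm_V W i w) in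
  let D j : 'M[R[i]]_N := diag_mx (\row_a rm_Dm W j a w) in
  let Delta j : 'M[R[i]]_N := diag_mx (\row_a rm_Dt W j a w) in
  let D' r : 'M[R[i]]_N := diag_mx (\row_a (rm_Ds W r a w)%:C) in
  ((2 * d + 2 * m + 2 * t + r2)%N%:R)^-1 *:
    (\sum_(i < d) (V i + (V i)^t*) + \sum_(j < m) (D j + (D j)^t*)
     + \sum_(j < t) (Delta j + (Delta j)^t*) + \sum_(r < r2) D' r).

End Probability.

Definition eigenvalues (R : realType) N (A : 'M[R[i]]_N) : seq R[i] :=
  sval (closed_field_poly_normal (char_poly A)).

(* The real part is only a cast when A is Hermitian.                          *)
Definition esd (R : realType) N (A : 'M[R[i]]_N) : {measure set R -> \bar R} :=
  mscale (N%:R^-1)%:nng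
    (msum (fun k => dirac (complex.Re (nth 0 (eigenvalues A) k))) N).

(* Main.v *)
Require Import Defs.
From HB Require Import structures.
From mathcomp Require Import all_boot all_order all_algebra all_fingroup.
From mathcomp Require Import finmap complex spectral sesquilinear.
From mathcomp Require Import all_classical all_reals all_analysis.
From mathcomp Require Import measurable_realfun.
From mathcomp Require Import zify ring lra.

(** Both measures live on [[-1, 1]], the random one almost surely, so the
    moments decide, and moments are counts of words.  Let [A] be the alphabet of the generators; it has [|S|]
    letters.

    On the group side, the [k]-th moment of the spectral measure is
    [<M^k delta, delta>] ([spectral_moment]), that is, the proportion of words
    of length [k] in [A] whose product is the unit of the wreath product
    ([markov_moment]).

    On the matrix side, every generator acts on the basis vectors by a monomial
    matrix: a free generator moves the point, a lamp generator multiplies by the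
    character value written at the current point.  So [tr X_N^k / N] is the
    average over words of normalised traces, and it is enough to treat one word
    [u].  If [u] is trivial in the wreath product, its matrix is the identity,
    because these monomial matrices form a representation of the group
    ([phase_wr_word], [word_trace_eq1]).  Otherwise let [(f, g)] be its value.

    If [g] is not the unit, the trace is at most the number of fixed points of
    the permutation of [g], and a nontrivial reduced word in independent uniform
    permutations has [O(1)] fixed points on average.  This is shown by
    switching: when the trajectory of a point closes up for the first time, the
    image of the last step can be rerouted to any of the [N - O(1)] points off
    the trajectory, and the original permutations can be recovered
    ([card_coincidence], [card_non_uniq_traj]).

    If [g] is the unit and [f] takes a value [f g0 <> 0], the trace is
    [sum_a Phi_a] with [Phi_a] the product over [h] of the character at [h.a]
    evaluated at [f h].  In the second moment
    [sum_(a, b) E (Phi_a conj Phi_b)] a pair contributes only if the point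
    [g0.a] is met again, as [h.a] or as [h.b]: otherwise rotating the character
    at [g0.a] multiplies the term by a constant other than [1]
    ([sum_config_char_generic]).  Such pairs number [O(N)] on average, again by
    the fixed point estimate ([card_clash]).

    All averages are taken over a finite uniform model.  The circle is cut into
    [M] arcs and a point is replaced by the start of its arc; this changes the
    trace of a word of length [l] by at most [N l O(1/M)], and the discrete data
    are uniform and independent ([good_event], [word_trace_concentration]).

    Finally, off a set of small probability the matrix has its spectrum in
    [[-1, 1]], so Weierstrass approximation passes from polynomials to
    continuous functions ([whp_esd_close]). *)

Set Implicit Arguments.
Unset Strict Implicit.
Unset Printing Implicit Defensive.

Import Order.TTheory GRing.Theory Num.Theory.
Import numFieldNormedType.Exports.

Local Open Scope classical_set_scope.
Local Open Scope ring_scope.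

(** * Coincidences along the trajectory of a reduced word *)

Section RandomPermutations.
Variables (d N : nat).
Implicit Types (V : 'I_d -> 'S_N) (l : letter d) (w : seq (letter d)).

(** The letters act on the right, so that a word read from left to right moves a
    point letter by letter. *)
Definition lperm V l : 'S_N := (if l.2 then (V l.1)^-1 else V l.1)%g.

Lemma lperm_linv V l : lperm V (linv l) = (lperm V l)^-1%g.
Proof. by case: l => i []; rewrite /lperm /= ?invgK. Qed.

Definition traj V x w := x :: scanl (fun y l => lperm V l y) x w.

Definition wact V w x := foldl (fun y l => lperm V l y) x w.

Lemma size_traj V x w : size (traj V x w) = (size w).+1.
Proof. by rewrite /= size_scanl. Qed.

Lemma last_traj V x w y : last y (traj V x w) = wact V w x.
Proof. by elim: w x y => //= l w IH x y; rewrite -(IH _ x). Qed.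

Lemma traj_rcons V x w l :
  traj V x (rcons w l) = rcons (traj V x w) (lperm V l (wact V w x)).
Proof. by rewrite /traj /wact; elim: w x => //= k w IH x; rewrite IH. Qed.

(** Composing with a transposition on the side that makes the letter [l] send to
    [z] the point that it used to send to [y]; [linv l] is changed accordingly. *)
Definition reroute V l (y z : 'I_N) : {ffun 'I_d -> 'S_N} :=
  [ffun i => if i == l.1 then
     (if l.2 then tperm y z * V i else V i * tperm y z)%g else V i].

Lemma reroute_inj l y z (V V' : {ffun 'I_d -> 'S_N}) :
  reroute V l y z = reroute V' l y z -> V = V'.
Proof.
move=> /ffunP e; apply/ffunP => i; have := e i; rewrite !ffunE.
by case: ifP => // _; case: ifP => _ ; [apply: mulgI|apply: mulIg].
Qed.

Lemma lperm_reroute V l y z : lperm (reroute V l y z) l = (lperm V l * tperm y z)%g.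
Proof.
by rewrite /lperm ffunE eqxx; case: (l.2); rewrite // invMg tpermV.
Qed.

Lemma lperm_reroute_neq V l l' y z : l' != l -> l' != linv l ->
  lperm (reroute V l y z) l' = lperm V l'.
Proof.
move=> n1 n2; rewrite /lperm ffunE; case: (l'.1 =P l.1) => // e.
case: l l' e n1 n2 => [i b] [i' b'] /= ->; rewrite /linv /= !xpair_eqE !eqxx /=.
by case: b; case: b'.
Qed.

(** The edge that is changed, the last one, is not used before.  The trajectory
    cannot have reached [y] by [l] from another point, since [l] acts injectively,
    and it cannot have left [y] by [linv l], since that would lead back to the
    last point of the trajectory, hence make [linv l] the letter just before [l],
    and the word is reduced.  Nor does it visit [z]. *)
Lemma traj_reroute V x w l y z :
  uniq (traj V x w) -> reduced (rcons w l) ->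
  y = lperm V l (wact V w x) -> z \notin traj V x w ->
  traj (reroute V l y z) x w = traj V x w.
Proof.
move=> uw rw ey nz.
suff H : forall w1 w2, w = w1 ++ w2 ->
    traj (reroute V l y z) x w1 = traj V x w1 by apply: (H w [::]); rewrite cats0.
elim/last_ind => [//|w1 k IH] w2 ew.
have ew' : w = w1 ++ k :: w2 by rewrite ew cat_rcons.
have {}IH := IH _ ew'.
rewrite !traj_rcons IH; congr rcons.
have -> : wact (reroute V l y z) w1 x = wact V w1 x by rewrite -!(last_traj _ _ _ x) IH.
set p := wact V w1 x.
have tw : traj V x w = traj V x (rcons w1 k) ++ scanl (fun y l => lperm V l y)
   (lperm V k p) w2.
  by rewrite ew /traj scanl_cat -cats1 /= foldl_cat /=.
have tw1 : traj V x (rcons w1 k) = rcons (traj V x w1) (lperm V k p) by rewrite traj_rcons.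
have pin : p \in traj V x w1.
  by rewrite /p -(last_traj _ _ _ x) /traj /= mem_last.
have pin2 : p \in traj V x w by rewrite tw tw1 mem_cat mem_rcons inE pin orbT.
have kin : lperm V k p \in traj V x w by rewrite tw tw1 mem_cat mem_rcons inE eqxx.
set e := wact V w x in ey.
have elast : e = last (lperm V k p) (scanl (fun y l => lperm V l y) (lperm V k p) w2).
  by rewrite /e -(last_traj _ _ _ x) tw last_cat tw1 last_rcons.
have pe : p != e.
  apply: contraTneq uw => pe.
  rewrite tw tw1 cat_rcons cat_uniq; apply/nandP; right; apply/nandP; left; rewrite negbK.
  by apply/hasP; exists e; [rewrite elast mem_last|rewrite -pe].
have [kl|nkl] := eqVneq k l.
  rewrite kl lperm_reroute permM tpermD //.
    by rewrite ey (inj_eq perm_inj) eq_sym.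
  by apply: contraNneq nz => ->; rewrite -kl.
have [kl|nkl'] := eqVneq k (linv l); last by rewrite lperm_reroute_neq.
rewrite kl !lperm_linv lperm_reroute invMg tpermV permM tpermD //; last first.
  by apply: contraNneq nz => ->.
apply/eqP => yp.
have ke : lperm V k p = e by rewrite kl -yp ey lperm_linv permK.
have w20 : w2 = [::].
  case: w2 => [//|b w2] in ew ew' tw elast rw uw *.
  move: uw; rewrite tw tw1 cat_rcons cat_uniq => /and3P[_ _] /=.
  suff : e \in scanl (fun y l => lperm V l y) (lperm V k p) (b :: w2) by rewrite ke => /= ->.
  by rewrite elast /= mem_last.
move: rw; rewrite ew w20 cats0 -!cats1 -catA /reduced /= kl.
by case: (w1) => [|b s] /=; rewrite ?cat_path /= linvK eqxx ?andbF.
Qed.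

(** Switching: send [V] and a point [z] off the trajectory to [V] with its last
    step rerouted to [z].  The new permutations have the same trajectory, which
    tells where the last step used to go (its entry [i]), and they send its end to
    [z]; so the map is injective, and [V] has [N - (size w).+1] images. *)
Lemma card_coincidence (x : 'I_N) w l (i : nat) : reduced (rcons w l) ->
  (#|[set V : {ffun 'I_d -> 'S_N} | uniq (traj V x w) &
      lperm V l (wact V w x) == nth x (traj V x w) i]%SET| * (N - (size w).+1) <=
   #|{ffun 'I_d -> 'S_N}|)%N.
Proof.
move=> rw; set A := [set V : {ffun _} | _ & _]%SET.
pose Y (V : {ffun 'I_d -> 'S_N}) := [set z : 'I_N | z \notin traj V x w]%SET.
pose D := [set p : {ffun 'I_d -> 'S_N} * 'I_N | (p.1 \in A) && (p.2 \in Y p.1)]%SET.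
pose h (p : {ffun 'I_d -> 'S_N} * 'I_N) :=
  reroute p.1 l (lperm p.1 l (wact p.1 w x)) p.2.
have -> : (#|A| * (N - (size w).+1))%N = #|D|.
  rewrite -[RHS]sum1_card (eq_bigl (fun p => (p.1 \in A) && (p.2 \in Y p.1))); last first.
    by move=> p; rewrite inE.
  rewrite -(pair_big_dep (mem A) (fun (V : {ffun 'I_d -> 'S_N}) z => z \in Y V) (fun _ _ => 1%N)) /=.
  rewrite -sum_nat_const; apply: eq_bigr => V; rewrite inE => /andP[uV _].
  rewrite sum1_card -(size_traj V x w) -(card_uniqP uV).
  rewrite -[X in (X - _)%N](card_ord N) -(cardC (mem (traj V x w))) addKn.
  by apply: eq_card => z; rewrite !inE.
rewrite -(card_in_imset (f := h)); first exact: max_card.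
move=> [V z] [V' z']; rewrite !inE /= /h /=.
set y := lperm V l _; set y' := lperm V' l _.
move=> /andP[/andP[u /eqP eV] nz] /andP[/andP[u' /eqP eV'] nz'] e.
have t := @traj_reroute V x w l y z u rw erefl nz.
have t' := @traj_reroute V' x w l y' z' u' rw erefl nz'.
have tt : traj V x w = traj V' x w by rewrite -t -t' e.
have yy : y = y' by rewrite eV eV' tt.
have ww : wact V w x = wact V' w x by rewrite -!(last_traj _ _ _ x) tt.
have zz : z = z'.
  have := congr1 (fun U : {ffun 'I_d -> 'S_N} => lperm U l (wact V w x)) e.
  by rewrite !lperm_reroute !permM -/y ww -/y' !tpermL.
by move: e; rewrite -yy -zz => /reroute_inj ->.
Qed.

(** Union bound over the first step that meets the trajectory again and over the
    entry that it meets. *)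
Lemma card_non_uniq_traj (x : 'I_N) w : reduced w ->
  (#|[set V : {ffun 'I_d -> 'S_N} | ~~ uniq (traj V x w)]%SET| * (N - size w) <=
   size w ^ 2 * #|{ffun 'I_d -> 'S_N}|)%N.
Proof.
elim/last_ind: w => [_|w l IH rw].
  by rewrite eq_card0 // => V; rewrite !inE.
have rw' : reduced w.
  by move: rw; rewrite /reduced -cats1; case: (w) => //= a s; rewrite cat_path => /andP[].
have {}IH := IH rw'.
set T := #|{ffun _ -> _}| in IH *.
set B := [set V : {ffun 'I_d -> 'S_N} | ~~ uniq (traj V x w)]%SET in IH *.
pose A i := [set V : {ffun 'I_d -> 'S_N} | uniq (traj V x w) &
      lperm V l (wact V w x) == nth x (traj V x w) i]%SET.
set B' := [set V : {ffun 'I_d -> 'S_N} | _]%SET.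
have sub : B' \subset (B :|: \bigcup_(i < (size w).+1) A i)%SET.
  apply/fintype.subsetP => V; rewrite !inE traj_rcons rcons_uniq negb_and negbK.
  case: (boolP (uniq _)) => // uV; rewrite [~~ true]/= orbF => xin; apply/finset.bigcupP.
  have := xin; rewrite -index_mem size_traj => ii.
  exists (Ordinal ii) => //; rewrite inE; apply/andP; split=> //.
  by apply/eqP; symmetry; apply: nth_index.
have le1 : (#|B'| <= #|B| + \sum_(i < (size w).+1) #|A i|)%N.
  apply: leq_trans (subset_leq_card sub) _.
  apply: leq_trans (leq_card_setU _ _) _; rewrite leq_add2l.
  elim/big_ind2: _ => [|a1 b1 a2 b2 h1 h2|//]; first by rewrite cards0.
  exact: leq_trans (leq_card_setU _ _) (leq_add h1 h2).
have le2 : ((\sum_(i < (size w).+1) #|A i|) * (N - (size w).+1) <= (size w).+1 * T)%N.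
  rewrite big_distrl /=.
  have -> : ((size w).+1 * T = \sum_(i < (size w).+1) T)%N by rewrite sum_nat_const card_ord.
  by apply: leq_sum => i _; apply: card_coincidence.
rewrite size_rcons.
apply: leq_trans (leq_mul le1 (leqnn _)) _.
rewrite mulnDl.
have le3 : (#|B| * (N - (size w).+1) <= size w ^ 2 * T)%N.
  by apply: leq_trans _ IH; rewrite leq_mul2l leq_sub2l ?orbT.
apply: leq_trans (leq_add le3 le2) _.
rewrite -mulnDl leq_mul2r; apply/orP; right.
by rewrite !expnS !expn0; lia.
Qed.

(** A fixed point closes the trajectory. *)
Lemma card_fixed_reduced (x : 'I_N) w : reduced w -> w != [::] ->
  (#|[set V : {ffun 'I_d -> 'S_N} | wact V w x == x]%SET| * (N - size w) <=
   size w ^ 2 * #|{ffun 'I_d -> 'S_N}|)%N.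
Proof.
move=> rw w0; apply: leq_trans _ (card_non_uniq_traj x rw).
rewrite leq_mul2r; apply/orP; right; apply: subset_leq_card.
apply/fintype.subsetP => V; rewrite !inE => /eqP fx.
rewrite /= -{1}fx -(last_traj _ _ _ x) /=.
case: w w0 {rw fx} => // l w _ /=; rewrite mem_last //.
Qed.

End RandomPermutations.

(** * Words in the wreath product and their monomial action *)

Section Words.
Variables (d N : nat) (L : zmodType) (B : finType) (lam : B -> L).
Variable C : comNzRingType.
Implicit Types (V : 'I_d -> 'S_N) (u : seq (letter d + B)).

Let G := wreath L (free_group d).

Definition fg_letter (l : letter d) : free_group d :=
  if l.2 then ((fg_gen l.1)^-1)%g else fg_gen l.1.

Definition wr_letter (a : letter d + B) : G :=
  match a with inl l => wr_base L (fg_letter l) | inr b => wr_lamp _ (lam b) end.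

Definition wr_word u : G := foldr (fun a g => (wr_letter a * g)%g) 1%g u.

Definition move V (x : 'I_N) (a : letter d + B) : 'I_N :=
  if a is inl l then lperm V l x else x.

Definition weight (z : 'I_N -> B -> C) (x : 'I_N) (a : letter d + B) : C :=
  if a is inr b then z x b else 1.

Fixpoint phase V (z : 'I_N -> B -> C) (x : 'I_N) u : C :=
  if u is a :: u' then weight z x a * phase V z (move V x a) u' else 1.

Definition endpoint V x u := foldl (move V) x u.

Definition fg_act V (g : free_group d) (x : 'I_N) := wact V (val g) x.

Lemma wact_lpush V l w x : wact V (lpush l w) x = wact V w (lperm V l x).
Proof.
case: w => //= b w; case: eqP => //= ->.
by rewrite lperm_linv permK.
Qed.

Lemma fg_actM V g h x : fg_act V (g * h)%g x = fg_act V h (fg_act V g x).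
Proof.
rewrite /fg_act; change (val (g * h)%g) with (foldr (@lpush d) (val h) (val g)).
by elim: (val g) x => //= l w IH x; rewrite wact_lpush IH.
Qed.

Lemma fg_act1 V x : fg_act V 1%g x = x. Proof. by []. Qed.

Lemma fg_actVK V g x : fg_act V g^-1%g (fg_act V g x) = x.
Proof. by rewrite -fg_actM mulgV. Qed.

Lemma fg_act_inj V g : injective (fg_act V g).
Proof. exact: can_inj (fg_actVK V g). Qed.

Lemma fg_act_letter V l x : fg_act V (fg_letter l) x = lperm V l x.
Proof. by case: l => i []. Qed.

Variables (V : 'I_d -> 'S_N) (chi : 'I_N -> L -> C).
Hypothesis chi0 : forall x, chi x 0 = 1.
Hypothesis chiD : forall x a b, chi x (a + b) = chi x a * chi x b.

Definition config_char (x : 'I_N) (f : {fsfun free_group d -> L with 0}) : C :=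
  \prod_(g <- finsupp f) chi (fg_act V g x) (f g).

(** Lets the product run over any finite set that contains the support. *)
Lemma config_charE x f (S : {fset free_group d}) : (finsupp f `<=` S)%fset ->
  config_char x f = \prod_(g <- S) chi (fg_act V g x) (f g).
Proof.
move=> sub; rewrite /config_char; apply: big_fset_incl => // g gS.
by move=> /fsfun_dflt ->; rewrite chi0.
Qed.

(** With [fg_actM], this says that the wreath product acts by monomial matrices:
    [u] sends the basis vector at [x] to [config_char x u.1] times the one at
    [fg_act V u.2 x]. *)
Lemma config_charM x (u v : G) :
  config_char x (u * v)%g.1 = config_char x u.1 * config_char (fg_act V u.2 x) v.1.
Proof.
case: u v => [f g] [f' g'] /=.
change (((f, g) : G) * (f', g'))%g.1 with (fsf_mul f f' g).
set T := [fset (g * y)%g | y in finsupp f']%fset.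
set S := (finsupp f `|` T)%fset.
rewrite (@config_charE _ (fsf_mul f f' g) S); last first.
  apply/fsubsetP => y; rewrite mem_finsupp fsf_mulE => nz.
  apply: contraNT nz; rewrite inE negb_or => /andP[/fsfun_dflt -> nT].
  rewrite add0r fsfun_dflt //; apply: contra nT => gx.
  by apply/imfsetP; exists (g^-1 * y)%g => //; rewrite mulKVg.
rewrite (@config_charE _ f S) ?fsubsetUl //.
under eq_bigr do rewrite fsf_mulE chiD.
rewrite big_split /=; congr (_ * _).
transitivity (\prod_(y <- T) chi (fg_act V y x) (f' (g^-1 * y)%g)).
  symmetry; apply: big_fset_incl; first exact: fsubsetUr.
  move=> y _ nT; rewrite fsfun_dflt ?chi0 //; apply: contra nT => gx.
  by apply/imfsetP; exists (g^-1 * y)%g => //; rewrite mulKVg.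
rewrite big_imfset /=; last by move=> y y' _ _ /mulgI.
by apply: eq_bigr => y _; rewrite mulKg fg_actM.
Qed.

Lemma config_char1 x : config_char x (1%g : G).1 = 1.
Proof.
rewrite (@config_charE _ _ fset0) ?big_seq_fset0 ?big_nil //.
by apply/fsubsetP => y; rewrite mem_finsupp fsf_oneE eqxx.
Qed.

Lemma config_char_lamp x (l : L) : config_char x (wr_lamp (free_group d) l).1 = chi x l.
Proof.
rewrite (@config_charE _ _ [fset 1%g]%fset) ?big_seq_fset1 ?fsfunE ?inE ?eqxx //.
apply/fsubsetP => y; rewrite mem_finsupp fsfunE; by case: ifP; rewrite ?eqxx.
Qed.

(** The product of the monomial matrices of the letters depends only on the value
    of the word in the wreath product. *)
Lemma phase_wr_word (z : 'I_N -> B -> C) (hz : forall x b, z x b = chi x (lam b)) u x :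
  phase V z x u = config_char x (wr_word u).1 /\
  endpoint V x u = fg_act V (wr_word u).2 x.
Proof.
elim: u x => [|a u IH] x; first by rewrite /= config_char1.
have [IH1 IH2] := IH (move V x a).
rewrite /= config_charM IH1 -/(endpoint V (move V x a) u) IH2.
change (wr_letter a * wr_word u)%g.2 with ((wr_letter a).2 * (wr_word u).2)%g.
rewrite fg_actM; case: a {IH IH1 IH2} => [l|b] /=.
  by rewrite fg_act_letter config_char1.
by rewrite config_char_lamp hz.
Qed.

End Words.

(** * Second moment of a sum of configuration characters *)

Lemma card_fixed_fg_act d N (g : free_group d) : g != 1%g ->
  ((\sum_(V : {ffun 'I_d -> 'S_N}) #|[set x | fg_act V g x == x]%SET|)
    * (N - size (val g)) <=
   N * size (val g) ^ 2 * #|{ffun 'I_d -> 'S_N}|)%N.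
Proof.
move=> g1.
have -> : (\sum_(V : {ffun 'I_d -> 'S_N}) #|[set x | fg_act V g x == x]%SET| =
  \sum_(x < N) #|[set V : {ffun 'I_d -> 'S_N} | fg_act V g x == x]%SET|)%N.
  under eq_bigr do rewrite -sum1dep_card big_mkcond /=.
  rewrite exchange_big /=; apply: eq_bigr => x _.
  by rewrite -big_mkcond /= sum1dep_card.
rewrite big_distrl /=.
have -> : (N * size (val g) ^ 2 * #|{ffun 'I_d -> 'S_N}| =
  \sum_(x < N) (size (val g) ^ 2 * #|{ffun 'I_d -> 'S_N}|))%N.
  by rewrite sum_nat_const card_ord mulnA.
apply: leq_sum => x _; apply: card_fixed_reduced; first exact: valP.
by apply: contra g1 => /eqP g1; apply/eqP/val_inj.
Qed.

(** Reindexing by [s] multiplies the sum by [w], so the sum vanishes. *)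
Lemma sum_eigenshift (K : finType) (C : fieldType) (F : K -> C) (s : K -> K) (w : C) :
  injective s -> w != 1 -> (forall k, F (s k) = w * F k) -> \sum_k F k = 0.
Proof.
move=> si w1 Fs.
have : (1 - w) * \sum_k F k = 0.
  rewrite mulrBl mul1r mulr_sumr; apply/eqP; rewrite subr_eq0; apply/eqP.
  rewrite (reindex_inj si) /=; exact: eq_bigr.
by move/eqP; rewrite mulf_eq0 subr_eq0 eq_sym (negPf w1) => /eqP.
Qed.

Section SecondMoment.
Variables (d N : nat) (L : zmodType) (C : numClosedFieldType) (K : finType).
Variable chi : K -> 'I_N -> L -> C.
Hypothesis chi1 : forall k x a, `|chi k x a| = 1.

Let P := {ffun 'I_d -> 'S_N}.
Variables (f : {fsfun free_group d -> L with 0}) (g0 : free_group d).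
Hypothesis g0f : g0 \in finsupp f.
Hypothesis twist : forall c0 : 'I_N, exists s : K -> K, exists2 w : C, w != 1 &
  [/\ injective s, forall k, chi (s k) c0 (f g0) = w * chi k c0 (f g0)
    & forall k c a, c != c0 -> chi (s k) c a = chi k c a].

Lemma norm_config_char (V : P) k x : `|config_char V (chi k) x f| = 1.
Proof. by rewrite normr_prod big1. Qed.

(** The point [g0.a], the location of the character to be averaged, occurs a
    second time in the product for the pair [(a, b)]. *)
Definition clash (V : P) (a b : 'I_N) : bool :=
  [exists g : finsupp f, ((val g != g0) && (fg_act V (val g) a == fg_act V g0 a))
                      || (fg_act V (val g) b == fg_act V g0 a)].

(** When there is no clash, only the factor at [g0.a] sees the twist, and it sees
    it through [f g0]. *)
Lemma sum_config_char_generic (V : P) a b : ~~ clash V a b ->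
  \sum_k config_char V (chi k) a f * (config_char V (chi k) b f)^* = 0.
Proof.
move=> nc; have [s [w w1 [si s0 sc]]] := twist (fg_act V g0 a).
have {}nc g : g \in finsupp f ->
   (g != g0 -> fg_act V g a != fg_act V g0 a) /\ fg_act V g b != fg_act V g0 a.
  move=> gf; move: nc => /existsPn/(_ [` gf]%fset) /=.
  by rewrite negb_or negb_and => /andP[h1 ->]; split=> // gg0; move: h1; rewrite gg0.
apply: (sum_eigenshift si w1) => k.
rewrite [in LHS]/config_char !(big_fsetD1 g0 g0f) /= s0 // [in RHS]/config_char
  (big_fsetD1 g0 g0f) /= -!mulrA; do 2 congr (_ * _).
congr (_ * _).
  apply: eq_big_seq => g; rewrite !inE => /andP[gg0 gf]; apply: sc.
  by case: (nc _ gf) => /(_ gg0).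
rewrite -(big_fsetD1 g0 g0f) /=; congr (_^*); apply: eq_big_seq => g gf; apply: sc.
by case: (nc _ gf).
Qed.

(** The words whose fixed points produce clashes have at most this length. *)
Definition overlap_length := (\max_(g : finsupp f) size (val (g0^-1 * val g)%g))%N.
Local Notation K0 := overlap_length.

(** [g.a = g0.a] says that [g0.a] is a fixed point of [g0^-1 g], which is rare, and
    costs [N] for the free choice of [b]; [g.b = g0.a] determines [a] from [b]. *)
Lemma card_clash :
  ((N - K0) * \sum_(V : P) #|[set p : 'I_N * 'I_N | clash V p.1 p.2]%SET| <=
   (#|`finsupp f| * (K0 ^ 2 + 1)) * N ^ 2 * #|{: P}|)%N.
Proof.
pose A (g : finsupp f) (V : P) :=
  [set p : 'I_N * 'I_N | (val g != g0) && (fg_act V (val g) p.1 == fg_act V g0 p.1)]%SET.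
pose B (g : finsupp f) (V : P) :=
  [set p : 'I_N * 'I_N | fg_act V (val g) p.2 == fg_act V g0 p.1]%SET.
have le1 (V : P) : (#|[set p : 'I_N * 'I_N | clash V p.1 p.2]%SET| <=
   \sum_(g : finsupp f) (#|A g V| + #|B g V|))%N.
  have sub : ([set p : 'I_N * 'I_N | clash V p.1 p.2] \subset
     \bigcup_(g : finsupp f) (A g V :|: B g V))%SET.
    apply/fintype.subsetP => p; rewrite inE => /existsP[g gp].
    by apply/finset.bigcupP; exists g => //; rewrite !inE.
  apply: leq_trans (subset_leq_card sub) _.
  elim/big_ind2: _ => [|a1 b1 a2 b2 h1 h2|g _]; first by rewrite cards0.
    exact: leq_trans (leq_card_setU _ _) (leq_add h1 h2).
  exact: leq_card_setU.
have cB g V : #|B g V| = N.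
  rewrite -[RHS]card_ord -(card_imset (f := fun b => (fg_act V g0^-1%g (fg_act V (val g) b), b))).
    apply: eq_card => -[a b]; rewrite !inE /=; apply/eqP/imsetP => [e|[b' _ [-> ->]]].
      by exists b => //; rewrite e fg_actVK.
    by rewrite -fg_actM mulVg.
  by move=> b b' [].
have cA g : ((N - K0) * \sum_(V : P) #|A g V| <= K0 ^ 2 * N ^ 2 * #|{: P}|)%N.
  have [gg0|gg0] := eqVneq (val g) g0.
    rewrite big1 ?muln0 // => V _; apply: eq_card0 => p; by rewrite !inE gg0 eqxx.
  have h1 : (g0^-1 * val g)%g != 1%g.
    by apply: contraNN gg0 => /eqP e; rewrite -(mulKVg g0 (val g)) e mulg1.
  set h := (g0^-1 * val g)%g in h1.
  have hK : (size (val h) <= K0)%N by apply: leq_bigmax.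
  have AE V : #|A g V| = (N * #|[set x | fg_act V h x == x]%SET|)%N.
    rewrite mulnC -[X in (_ * X)%N](card_ord N) -cardsT -cardsX.
    rewrite -[RHS](card_imset (f := fun p => (fg_act V g0^-1%g p.1, p.2))); last first.
      by move=> [a b] [a' b'] /= [/fg_act_inj -> ->].
    apply: eq_card => -[a b]; rewrite !inE /= gg0 /=; apply/eqP/imsetP => /= [e|].
      exists (fg_act V g0 a, b); rewrite /= ?fg_actVK // !inE /= andbT.
      by rewrite /h -fg_actM mulKVg e.
    case=> -[a' b'] /=; rewrite !inE andbT /= => /eqP e [-> _].
    by rewrite -!fg_actM -/h mulVg e.
  under eq_bigr do rewrite AE.
  rewrite -big_distrr /=.
  have := @card_fixed_fg_act d N _ h1; set T := (\sum_(V : _) _)%N => le.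
  apply: (@leq_trans (N * (N * size (val h) ^ 2 * #|{: P}|))).
    rewrite mulnCA leq_mul2l; apply/orP; right; apply: leq_trans _ le.
    by rewrite mulnC leq_mul2l leq_sub2l ?orbT.
  have : (size (val h) ^ 2 <= K0 ^ 2)%N by rewrite leq_sqr.
  move: (size (val h) ^ 2)%N (K0 ^ 2)%N (#|{: P}|) => s t p st.
  rewrite (_ : (N * (N * s * p))%N = (s * (N ^ 2 * p))%N); last by rewrite expnS expn1; ring.
  by rewrite -mulnA leq_mul2r st orbT.
apply: (@leq_trans ((N - K0) * \sum_(V : P) \sum_(g : finsupp f) (#|A g V| + #|B g V|))).
  by rewrite leq_mul2l leq_sum ?orbT.
rewrite exchange_big /= big_distrr /=.
apply: (@leq_trans (\sum_(g : finsupp f) (K0 ^ 2 + 1) * N ^ 2 * #|{: P}|)).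
  apply: leq_sum => g _; rewrite big_split /= mulnDr.
  apply: leq_trans (leq_add (cA g) (leqnn _)) _.
  under eq_bigr do rewrite cB.
  rewrite sum_nat_const.
  rewrite mulnDl mul1n mulnDl leq_add2l.
  rewrite (_ : (N ^ 2 * #|{: P}|)%N = (N * (#|{: P}| * N))%N); last by rewrite expnS expn1; ring.
  by rewrite leq_mul2r leq_subr orbT.
by rewrite sum_nat_const -cardfE !mulnA.
Qed.

Lemma second_moment_config_char :
  (N - K0)%:R * (\sum_(V : P) \sum_k `|\sum_x config_char V (chi k) x f| ^+ 2) <=
   ((#|`finsupp f| * (K0 ^ 2 + 1)) * N ^ 2 * (#|{: P}| * #|K|))%:R :> C.
Proof.
have le1 (V : P) : \sum_k `|\sum_x config_char V (chi k) x f| ^+ 2 <=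
   (#|[set p : 'I_N * 'I_N | clash V p.1 p.2]%SET| * #|K|)%:R :> C.
  have /ger0_norm <- : 0 <= \sum_k `|\sum_x config_char V (chi k) x f| ^+ 2.
    by apply: sumr_ge0 => k _; rewrite exprn_ge0.
  have -> : \sum_k `|\sum_x config_char V (chi k) x f| ^+ 2 =
      \sum_(p : 'I_N * 'I_N) \sum_k
          config_char V (chi k) p.1 f * (config_char V (chi k) p.2 f)^*.
    rewrite exchange_big /=; apply: eq_bigr => k _.
    rewrite normCK rmorph_sum /= mulr_suml.
    under [LHS]eq_bigr do rewrite mulr_sumr.
    by rewrite pair_bigA.
  rewrite (bigID (fun p => clash V p.1 p.2)) /= [X in _ + X]big1 ?addr0; last first.
    by move=> p; apply: sum_config_char_generic.
  apply: le_trans (ler_norm_sum _ _ _) _.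
  rewrite natrM -sum1dep_card natr_sum mulr_suml; apply: ler_sum => p _.
  rewrite mul1r; apply: le_trans (ler_norm_sum _ _ _) _.
  under eq_bigr do rewrite normrM norm_conjC !norm_config_char mulr1.
  by rewrite sumr_const.
apply: (@le_trans _ _ ((N - K0)%:R * \sum_(V : P)
   (#|[set p : 'I_N * 'I_N | clash V p.1 p.2]%SET| * #|K|)%:R)).
  by apply: ler_wpM2l; rewrite ?ler0n //; apply: ler_sum.
rewrite -natr_sum -natrM ler_nat -big_distrl /= mulnA [leqRHS]mulnA leq_mul2r.
by rewrite card_clash orbT.
Qed.

End SecondMoment.

(** * Roots of unity and characters of the lamp group *)

Section UnitCircle.
Local Open Scope complex_scope.
Local Open Scope ring_scope.
Variable R : realType.
Implicit Types x y : R.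

Lemma expi0 : expi 0 = 1 :> R[i].
Proof. by rewrite /expi cos0 sin0. Qed.

Lemma expiD x y : expi (x + y) = expi x * expi y.
Proof. by rewrite /expi cosD sinD; simpc; rewrite addrC [sin x * _ + _]addrC. Qed.

Lemma expiMn x n : expi (x * n%:R) = expi x ^+ n.
Proof.
elim: n => [|n IH]; first by rewrite mulr0 expi0.
by rewrite -natr1 mulrDr mulr1 expiD IH exprSr.
Qed.

Lemma conj_expi x : (expi x)^* = expi (- x).
Proof. by rewrite /expi cosN sinN. Qed.

Lemma norm_expi x : `|expi x| = 1.
Proof.
apply/eqP; rewrite -(@eqrXn2 _ 2) ?normr_ge0 // normCK conj_expi -expiD subrr.
by rewrite expi0 expr1n.
Qed.

Lemma expi2pi : expi (2 * pi) = 1 :> R[i].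
Proof. by rewrite /expi mulr_natl cos2pi sin2pi. Qed.

Lemma expi_neq1 x : 0 < x < 2 * pi -> expi x != 1.
Proof.
move=> /andP[x0 x2]; apply/eqP => -[c1 _].
have s0 : 0 < sin (x / 2).
  apply: sin_gt0_pi; apply/andP; split; first by rewrite divr_gt0.
  by rewrite ltr_pdivrMr // mulrC.
have : cos x = 1 - sin (x / 2) ^+ 2 *+ 2.
  rewrite {1}(_ : x = (x / 2) *+ 2); last by rewrite -[_ *+ 2]mulr_natr mulfVK.
  by rewrite cos_mulr2n cos2sin2 mulrnBl addrAC [1 *+ 2]mulr2n addrK.
by rewrite c1; have := exprn_gt0 2 s0; lra.
Qed.

(** A primitive [n]-th root of unity for [n > 0]. *)
Definition zeta (n : nat) : R[i] := expi (2 * pi / n%:R).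

Lemma zetaX n k : zeta n ^+ k = expi (2 * k%:R * pi / n%:R).
Proof. by rewrite -expiMn; congr expi; ring. Qed.

Lemma norm_zeta n : `|zeta n| = 1. Proof. exact: norm_expi. Qed.

Lemma zeta_neq0 n : zeta n != 0.
Proof. by rewrite -normr_eq0 norm_zeta oner_eq0. Qed.

Lemma zetaXn n : (0 < n)%N -> zeta n ^+ n = 1.
Proof. by move=> n0; rewrite -expiMn mulfVK ?expi2pi // pnatr_eq0 -lt0n. Qed.

Lemma zeta2 : zeta 2 = -1.
Proof.
rewrite /zeta [_ * pi]mulrC mulfK // /expi cospi sinpi.
by apply/eqP; rewrite eq_complex /= oppr0 !eqxx.
Qed.

Lemma zetaX_neq1 n k : (0 < k < n)%N -> zeta n ^+ k != 1.
Proof.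
move=> /andP[k0 kn]; rewrite -expiMn; apply: expi_neq1.
have n0 : (0 : R) < n%:R by rewrite ltr0n; apply: leq_ltn_trans kn.
apply/andP; split; first by rewrite mulr_gt0 ?ltr0n // divr_gt0 // twopi_gt0.
by rewrite mulrAC ltr_pdivrMr // ltr_pM2l ?twopi_gt0 // ltr_nat.
Qed.

Lemma zetaXz_neq1 n (e : int) : (0 < `|e| < n)%N -> zeta n ^ e != 1.
Proof.
case: e => [k|k] /= h; first exact: zetaX_neq1.
by rewrite NegzE -invr_expz -exprnP invr_eq1; exact: zetaX_neq1.
Qed.

End UnitCircle.
Arguments zeta : clear implicits.

Section LampCharacters.
Local Open Scope complex_scope.
Local Open Scope ring_scope.
Variables (R : realType) (m r2 t : nat) (q : 'I_t -> nat).
Hypothesis hq : forall j, (3 <= q j)%N.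
Let C := R[i].
Let L := lamp m r2 q.

Definition lamp_coord : finType := ('I_m + 'I_r2 + 'I_t)%type.

(** All coordinates of the lamp group are read as integers, so that a character is
    a single product of powers; the group law is respected because of the
    relations in [dual]. *)
Definition lamp_exp (a : L) (l : lamp_coord) : int :=
  match l with
  | inl (inl j) => a.1.1 0 j
  | inl (inr r) => (a.1.2 0 r : nat)%:Z
  | inr j => (a.2 j : nat)%:Z
  end.

Definition lamp_mod (M : nat) (l : lamp_coord) : nat :=
  match l with inl (inl j) => M | inl (inr r) => 2 | inr j => q j end.

(** The points of the Pontryagin dual of the lamp group, given by the values of the
    character on the canonical generators. *)
Record dual (Z : lamp_coord -> C) : Prop := {
  dual_norm : forall l, `|Z l| = 1;
  dual_sign : forall r, Z (inl (inr r)) ^+ 2 = 1;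
  dual_root : forall j, Z (inr j) ^+ q j = 1 }.

Definition lamp_char (Z : lamp_coord -> C) (a : L) : C :=
  \prod_l Z l ^ lamp_exp a l.

Lemma dual_neq0 Z l : dual Z -> Z l != 0.
Proof. by move=> [h _ _]; rewrite -normr_eq0 h oner_eq0. Qed.

Lemma lamp_char_norm Z a : dual Z -> `|lamp_char Z a| = 1.
Proof.
move=> dZ; rewrite normr_prod big1 // => l _.
case: (lamp_exp a l) => k; last rewrite NegzE -invr_expz normfV.
  by rewrite -exprnP normrX (dual_norm dZ) expr1n.
by rewrite -exprnP normrX (dual_norm dZ) expr1n invr1.
Qed.

Lemma lamp_exp0 l : lamp_exp 0 l = 0.
Proof. by case: l => [[j|r]|j] /=; rewrite ?mxE ?ffunE. Qed.

Lemma lamp_char0 Z : lamp_char Z 0 = 1.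
Proof. by rewrite /lamp_char big1 // => l _; rewrite lamp_exp0 expr0z. Qed.

Lemma Zq_cast j : (Zp_trunc (q j)).+2 = q j.
Proof. by apply: Zp_cast; apply: leq_trans (hq j). Qed.

Lemma lamp_charD Z a b : dual Z -> lamp_char Z (a + b) = lamp_char Z a * lamp_char Z b.
Proof.
move=> dZ; rewrite /lamp_char -big_split /=; apply: eq_bigr => l _.
rewrite -expfzDr ?(dual_neq0 _ dZ) //.
case: l => [[j|r]|j] /=.
- by rewrite mxE.
- by rewrite mxE /= -PoszD -!exprnP expr_mod // (dual_sign dZ).
- rewrite ffunE /= -PoszD -!exprnP expr_mod // Zq_cast; exact: (dual_root dZ).
Qed.

Lemma lamp_charN Z a : dual Z -> lamp_char Z (- a) = (lamp_char Z a)^*.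
Proof.
move=> dZ; have e : lamp_char Z a * lamp_char Z (- a) = 1.
  by rewrite -lamp_charD // subrr lamp_char0.
have n0 : lamp_char Z a != 0 by apply: contra_eq_neq e => ->; rewrite mul0r eq_sym oner_eq0.
by apply: (mulfI n0); rewrite e -normCK lamp_char_norm // expr1n.
Qed.

Definition lamp_letter : finType := ('I_m * bool + 'I_r2 + 'I_t * bool)%type.

Definition lamp_of_letter (b : lamp_letter) : L :=
  match b with
  | inl (inl (j, s)) => if s then - (delta_mx 0 j, 0, 0) else (delta_mx 0 j, 0, 0)
  | inl (inr r) => (0, delta_mx 0 r, 0)
  | inr (j, s) => if s then - (0, 0, cp_gen q j) else (0, 0, cp_gen q j)
  end.

(** Conjugates stand for the inverse generators, as in the adjoint matrices; on the
    dual they agree with the inverses ([lamp_char_letter]). *)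
Definition letter_value (Z : lamp_coord -> C) (b : lamp_letter) : C :=
  match b with
  | inl (inl (j, s)) => if s then (Z (inl (inl j)))^* else Z (inl (inl j))
  | inl (inr r) => Z (inl (inr r))
  | inr (j, s) => if s then (Z (inr j))^* else Z (inr j)
  end.

Lemma lamp_char_pred1 Z (a : L) l0 :
  (forall l, lamp_exp a l = (l == l0)%:R) -> lamp_char Z a = Z l0.
Proof.
move=> h; rewrite /lamp_char (bigD1 l0) //= h eqxx expr1z big1 ?mulr1 // => l nl.
by rewrite h (negPf nl) expr0z.
Qed.

Lemma lamp_char_letter Z b : dual Z ->
  lamp_char Z (lamp_of_letter b) = letter_value Z b.
Proof.
have h1 j : lamp_char Z ((delta_mx 0 j, 0, 0) : L) = Z (inl (inl j)).
  by apply: lamp_char_pred1 => -[[j'|r]|j'] //=; rewrite ?mxE ?ffunE ?eqxx.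
have h2 j : lamp_char Z ((0, 0, cp_gen q j) : L) = Z (inr j).
  apply: lamp_char_pred1 => -[[j'|r]|j'] //=; rewrite ?mxE ?ffunE ?eqxx //.
  rewrite (_ : (inr j' == inr j) = (j' == j)) //; case: eqP => //= _.
move=> dZ; case: b => [[[j s]|r]|[j s]] /=.
- by case: s; rewrite ?lamp_charN ?h1.
- apply: lamp_char_pred1 => -[[j'|r']|j'] //=; rewrite ?mxE ?ffunE ?eqxx //=.
  by rewrite (_ : (inl (inr r') == _) = (r' == r)) //; case: eqP.
- by case: s; rewrite ?lamp_charN ?h2.
Qed.

Lemma letter_value_norm Z b : dual Z -> `|letter_value Z b| = 1.
Proof. by move=> dZ; rewrite -lamp_char_letter // lamp_char_norm. Qed.

Variables (N M : nat).

(** The discrete model: an index of a root of unity for each site and each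
    generator of the lamp group.  The infinite cyclic factors are replaced by
    cyclic groups of order [M]. *)
Definition lamp_data := {dffun forall p : 'I_N * lamp_coord, 'I_(lamp_mod M p.2)}.

Definition data_value (k : lamp_data) (x : 'I_N) (l : lamp_coord) : C :=
  zeta R (lamp_mod M l) ^+ k (x, l).

Lemma data_value_dual k x : dual (data_value k x).
Proof.
split=> [l|r|j]; first by rewrite normrX norm_zeta expr1n.
  by rewrite -exprM mulnC exprM zetaXn // expr1n.
by rewrite -exprM mulnC exprM zetaXn ?expr1n //=; apply: leq_trans (hq j).
Qed.

Definition data_char k x := lamp_char (data_value k x).

Definition data_shift (p0 : 'I_N * lamp_coord) (k : lamp_data) : lamp_data :=
  [ffun p => if p == p0 then ordS (k p) else k p].

Lemma data_shift_inj p0 : injective (data_shift p0).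
Proof.
move=> k k' /ffunP e; apply/ffunP => p; have := e p; rewrite !ffunE.
by case: ifP => // _; apply: ordS_inj.
Qed.

Lemma data_value_shift x0 l0 k x l :
  data_value (data_shift (x0, l0) k) x l =
  data_value k x l * (if (x, l) == (x0, l0) then zeta R (lamp_mod M l0) else 1).
Proof.
rewrite /data_value /data_shift ffunE; case: eqP => [[_ ->]|]; last by rewrite mulr1.
rewrite /= expr_mod; first by rewrite exprSr.
rewrite zetaXn //; apply: leq_ltn_trans (leq0n _) (ltn_ord (k (x, l0))).
Qed.

(** Turning one coordinate on which [a] is not zero by one notch multiplies the
    character of [a] by a power of a root of unity that is not [1]; for the
    coordinates of infinite order this needs [M] to exceed the exponent. *)
Lemma data_char_twist (a : L) : a != 0 ->
  (forall j, (`|a.1.1 0%R j| < M)%N) ->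
  forall c0 : 'I_N, exists s : lamp_data -> lamp_data, exists2 w : C, w != 1 &
  [/\ injective s, forall k, data_char (s k) c0 a = w * data_char k c0 a
    & forall k c b, c != c0 -> data_char (s k) c b = data_char k c b].
Proof.
move=> a0 aM c0.
have [l0 hl0] : exists l0, lamp_exp a l0 != 0.
  apply/existsP; apply: contraR a0; rewrite negb_exists => /forallP h.
  case: a h {aM} => [[a1 a2] a3] h; apply/eqP; congr (_, _, _).
  - by apply/rowP => j; have := h (inl (inl j)); rewrite negbK /= mxE => /eqP.
  - apply/rowP => r; have := h (inl (inr r)); rewrite negbK /= mxE => /eqP [e].
    exact/val_inj.
  - apply/ffunP => j; have := h (inr j); rewrite negbK /= ffunE => /eqP [e].
    exact/val_inj.
have lM : (`|lamp_exp a l0| < lamp_mod M l0)%N.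
  case: (l0) => [[j|r]|j] /=; first exact: aM.
    exact: (ltn_ord (a.1.2 0 r)).
  by rewrite -[X in (_ < X)%N]Zq_cast; exact: (ltn_ord (a.2 j)).
exists (data_shift (c0, l0)); exists (zeta R (lamp_mod M l0) ^ lamp_exp a l0).
  by apply: zetaXz_neq1; rewrite absz_gt0 hl0.
split=> [||k c b cc0]; first exact: data_shift_inj.
  move=> k; rewrite /data_char /lamp_char (bigD1 l0) //= [in RHS](bigD1 l0) //=.
  rewrite data_value_shift eqxx expfzMl mulrAC [in LHS]mulrC; congr (_ * _).
  congr (_ * _); apply: eq_bigr => l nl.
  by rewrite data_value_shift xpair_eqE (negPf nl) andbF mulr1.
apply: eq_bigr => l _.
by rewrite data_value_shift xpair_eqE (negPf cc0) mulr1.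
Qed.

End LampCharacters.

(** * Traces of words *)

Section WordTrace.
Local Open Scope complex_scope.
Local Open Scope ring_scope.
Variables (R : realType) (d m r2 t : nat) (q : 'I_t -> nat).
Hypothesis hq : forall j, (3 <= q j)%N.
Let C := R[i].
Let L := lamp m r2 q.
Let A := (letter d + lamp_letter m r2 t)%type.
Let lam := @lamp_of_letter m r2 t q.

(** The trace of the product of the letter matrices along [u]. *)
Definition word_trace N (V : 'I_d -> 'S_N) (Z : 'I_N -> lamp_coord m r2 t -> C)
    (u : seq A) : C :=
  \sum_(x | endpoint V x u == x) phase V (fun x => letter_value (Z x)) x u.

Lemma phase_lamp N (V : 'I_d -> 'S_N) (Z : 'I_N -> lamp_coord m r2 t -> C) u x :
  (forall x, dual q (Z x)) ->
  phase V (fun x => letter_value (Z x)) x u =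
    config_char V (fun x => @lamp_char R m r2 t q (Z x)) x (wr_word lam u).1 /\
  endpoint V x u = fg_act V (wr_word lam u).2 x.
Proof.
move=> dZ; apply: phase_wr_word.
- by move=> y; apply: lamp_char0.
- by move=> y a b; apply: lamp_charD.
- by move=> y b; rewrite lamp_char_letter.
Qed.

Lemma word_trace_eq1 N (V : 'I_d -> 'S_N) (Z : 'I_N -> lamp_coord m r2 t -> C) u :
  (forall x, dual q (Z x)) -> wr_word lam u = 1%g -> word_trace V Z u = N%:R.
Proof.
move=> dZ u1; rewrite /word_trace.
under eq_bigl do rewrite (phase_lamp V u _ dZ).2 u1 fg_act1 eqxx.
rewrite (eq_bigr (fun=> 1)) ?sumr_const ?card_ord // => x _.
rewrite (phase_lamp V u _ dZ).1 u1 config_char1 // => y.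
exact: lamp_char0.
Qed.

Lemma norm_phase N (V : 'I_d -> 'S_N) (z : 'I_N -> lamp_letter m r2 t -> C) x u :
  (forall x b, `|z x b| = 1) -> `|phase V z x u| = 1.
Proof.
move=> z1; elim: u x => [|a u IH] x /=; first by rewrite normr1.
by rewrite normrM IH mulr1; case: a => [l|b] /=; rewrite ?normr1 ?z1.
Qed.

(** The constants depend on the word only; this makes the normalised second
    moment [O(1/N)]. *)
Lemma word_trace_second_moment (u : seq A) : wr_word lam u != 1%g ->
  exists K0 C0 M0, forall N M, (M0 <= M)%N ->
  (N - K0)%:R * (\sum_(V : {ffun 'I_d -> 'S_N}) \sum_(k : lamp_data m r2 q N M)
      `|word_trace V (data_value R k) u| ^+ 2) <=
  (C0 * N ^ 2 * (#|{ffun 'I_d -> 'S_N}| * #|{: lamp_data m r2 q N M}|))%:R :> C.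
Proof.
move=> u1; set f := (wr_word lam u).1; set g := (wr_word lam u).2.
have dd N M (k : lamp_data m r2 q N M) x : dual q (data_value R k x).
  exact: data_value_dual.
(* the word moves: its trace is at most the number of fixed points of [g] *)
have [g1|g1] := eqVneq g 1%g; last first.
  exists (size (val g)), (size (val g) ^ 2)%N, 0%N => N M _.
  have le1 (V : {ffun 'I_d -> 'S_N}) (k : lamp_data m r2 q N M) : `|word_trace V (data_value R k) u| ^+ 2 <=
      (N * #|[set x | fg_act V g x == x]%SET|)%:R :> C.
    have le0 : `|word_trace V (data_value R k) u| <= #|[set x | fg_act V g x == x]%SET|%:R.
      apply: le_trans (ler_norm_sum _ _ _) _.
      rewrite (eq_bigr (fun=> 1)); last first.
        move=> x _; rewrite norm_phase // => y b.
        by rewrite (letter_value_norm hq _ (dd _ _ k y)).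
      rewrite sumr_const ler_nat; apply: subset_leq_card; apply/fintype.subsetP => x.
      by rewrite !inE unfold_in /= (phase_lamp V u x (dd _ _ k)).2.
    have le00 : `|word_trace V (data_value R k) u| <= N%:R.
      by apply: le_trans le0 _; rewrite ler_nat -[X in (_ <= X)%N]card_ord max_card.
    by rewrite natrM expr2; apply: ler_pM.
  apply: (@le_trans _ _ ((N - size (val g))%:R *
     (\sum_(V : {ffun 'I_d -> 'S_N}) \sum_(k : lamp_data m r2 q N M)
      (N * #|[set x | fg_act V g x == x]%SET|)%:R))).
    apply: ler_wpM2l; rewrite ?ler0n //.
    by apply: ler_sum => V _; apply: ler_sum => k _.
  have -> : \sum_(V : {ffun 'I_d -> 'S_N}) \sum_(k : lamp_data m r2 q N M)
      (N * #|[set x | fg_act V g x == x]%SET|)%:R =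
    \sum_(V : {ffun 'I_d -> 'S_N})
      (N * #|[set x | fg_act V g x == x]%SET| * #|{: lamp_data m r2 q N M}|)%:R :> C.
    by apply: eq_bigr => V _; rewrite sumr_const -[LHS]mulrnA.
  rewrite -natr_sum -natrM ler_nat.
  rewrite -big_distrl /= -big_distrr /=.
  have := @card_fixed_fg_act d N _ g1; set s := (\sum_(V : _) _)%N.
  move: (#|{: lamp_data _ _ _ _ _}|) (size _ ^ 2)%N (N - size _)%N #|_| => k e n p le.
  rewrite (_ : (n * (N * s * k) = (s * n) * (N * k))%N); last by ring.
  rewrite (_ : (e * N ^ 2 * (p * k) = (N * e * p) * (N * k))%N); last first.
    by rewrite expnS expn1; ring.
  by rewrite leq_mul2r le orbT.
have [g0 g0f] : exists g0, g0 \in finsupp f.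
  apply/fset0Pn; apply: contraNneq u1 => f0; apply/eqP.
  rewrite [LHS]surjective_pairing -/f -/g g1; congr pair; apply/fsfunP => x.
  by rewrite fsf_oneE fsfun_dflt // f0.
(* from this order on, cyclic groups distinguish [f g0] from zero *)
pose M0 := (\max_(j < m) `|(f g0).1.1 0%R j|)%N.+1.
exists (overlap_length f g0), (#|`finsupp f| * (overlap_length f g0 ^ 2 + 1))%N, M0.
move=> N M MM0.
have tw : forall c0 : 'I_N, exists s : lamp_data m r2 q N M -> lamp_data m r2 q N M,
   exists2 w : C, w != 1 &
  [/\ injective s, forall k, data_char R (s k) c0 (f g0) = w * data_char R k c0 (f g0)
    & forall k c b, c != c0 -> data_char R (s k) c b = data_char R k c b].
  apply: data_char_twist => //; first by rewrite -mem_finsupp.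
  move=> j; apply: leq_trans MM0; rewrite /M0 ltnS.
  exact: (@leq_bigmax _ (fun j => `|(f g0).1.1 0%R j|%N)).
have n1 (k : lamp_data m r2 q N M) x a : `|data_char R k x a| = 1 :> C.
  by apply: lamp_char_norm; apply: dd.
have := second_moment_config_char n1 g0f tw.
congr (_ <= _); congr (_ * _); apply: eq_bigr => V _; apply: eq_bigr => k _.
congr (`|_| ^+ 2); apply: eq_big => x.
  by rewrite (phase_lamp V u x (dd _ _ k)).2 -/g g1 fg_act1 eqxx.
by rewrite (phase_lamp V u x (dd _ _ k)).1.
Qed.

End WordTrace.

(** * The real Hilbert space of square-summable functions *)

Section RealSums.
Variables (R : realType) (T : choiceType).
Implicit Types (a b : T -> R).

Definition rsummable a := summable [set: T] (EFin \o a).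

Lemma rsummable_le a b : (forall x, `|a x| <= b x) ->
  (\esum_(x in [set: T]) (b x)%:E < +oo)%E -> rsummable a.
Proof.
by move=> ab fb; apply: le_lt_trans fb; apply: le_esum => x _ /=; rewrite lee_fin.
Qed.

Lemma rsummable_ge0 a : (forall x, 0 <= a x) ->
  rsummable a <-> (\esum_(x in [set: T]) (a x)%:E < +oo)%E.
Proof.
move=> a0; rewrite /rsummable /summable; under eq_esum do rewrite /= ger0_norm //.
by [].
Qed.

Lemma rsummableD a b : rsummable a -> rsummable b -> rsummable (fun x => a x + b x).
Proof. exact: summableD. Qed.

Lemma esum_fin_num a : (forall x, 0 <= a x) -> rsummable a ->
  (\esum_(x in [set: T]) (a x)%:E)%E \is a fin_num.
Proof.
move=> a0 /(rsummable_ge0 a0) sa; rewrite fin_numElt sa andbT.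
by apply: lt_le_trans (ltNyr 0) _; apply: esum_ge0 => x _; rewrite lee_fin.
Qed.

(** Any decomposition into nonnegative summable parts computes [rsum]; additivity
    follows without a discussion of signs. *)
Lemma rsum_sub p n : (forall x, 0 <= p x) -> (forall x, 0 <= n x) ->
  rsummable p -> rsummable n ->
  rsum (fun x => p x - n x) =
  fine (\esum_(x in [set: T]) (p x)%:E) - fine (\esum_(x in [set: T]) (n x)%:E).
Proof.
move=> p0 n0 sp sn; rewrite /rsum.
have p0' i : [set: T] i -> (0 <= (EFin \o p) i)%E by move=> _; rewrite lee_fin.
have n0' i : [set: T] i -> (0 <= (EFin \o n) i)%E by move=> _; rewrite lee_fin.
have := esumB sp sn p0' n0'.
rewrite [X in X = _ -> _](_ : _ = (\esum_(x in [set: T]) (EFin \o (fun x => (p x - n x)%R))^\+ x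
   - \esum_(x in [set: T]) (EFin \o (fun x => (p x - n x)%R))^\- x)%E) //.
by move=> ->; rewrite fineB //; apply: esum_fin_num.
Qed.

Lemma rsum_split p n p' n' : (forall x, 0 <= p x) -> (forall x, 0 <= n x) ->
  (forall x, 0 <= p' x) -> (forall x, 0 <= n' x) ->
  rsummable p -> rsummable n -> rsummable p' -> rsummable n' ->
  rsum (fun x => (p x - n x) + (p' x - n' x)) =
  rsum (fun x => p x - n x) + rsum (fun x => p' x - n' x).
Proof.
move=> p0 n0 p0' n0' sp sn sp' sn'.
rewrite [LHS](_ : _ = rsum (fun x => (p x + p' x) - (n x + n' x))); last first.
  by congr rsum; apply/funext => x; ring.
rewrite !rsum_sub //; do ?[by move=> x; rewrite addr_ge0|exact: rsummableD].
under eq_esum do rewrite EFinD.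
under [X in _ - fine X = _]eq_esum do rewrite EFinD.
rewrite !esumD; do ?[by move=> x _; rewrite lee_fin].
rewrite !fineD ?esum_fin_num //; ring.
Qed.

Definition rpos a x := Num.max (a x) 0.
Definition rneg a x := Num.max (- a x) 0.

Lemma rposneg a : a = (fun x => rpos a x - rneg a x).
Proof.
apply/funext => x; rewrite /rpos /rneg.
by rewrite -[X in _ - Num.max _ X]oppr0 -oppr_min opprK maxC minC; case: (leP 0 (a x)); rewrite ?addr0 ?add0r.
Qed.

Lemma rpos_ge0 a x : 0 <= rpos a x. Proof. by rewrite le_max lexx orbT. Qed.
Lemma rneg_ge0 a x : 0 <= rneg a x. Proof. by rewrite le_max lexx orbT. Qed.

Lemma rsummable_pos a : rsummable a -> rsummable (rpos a).
Proof.
move=> sa; apply: (@rsummable_le _ (fun x => `|a x|)) => [x|]; last exact: sa.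
rewrite ger0_norm ?rpos_ge0 // /rpos ge_max normr_ge0 andbT.
exact: ler_norm.
Qed.

Lemma rsummable_neg a : rsummable a -> rsummable (rneg a).
Proof.
move=> sa; apply: (@rsummable_le _ (fun x => `|a x|)) => [x|]; last exact: sa.
rewrite ger0_norm ?rneg_ge0 // /rneg ge_max normr_ge0 andbT.
by rewrite -normrN; exact: ler_norm.
Qed.

Lemma rsumD a b : rsummable a -> rsummable b ->
  rsum (fun x => a x + b x) = rsum a + rsum b.
Proof.
move=> sa sb; rewrite {2}(rposneg a) {2}(rposneg b) -rsum_split; first last.
- exact: rsummable_neg.
- exact: rsummable_pos.
- exact: rsummable_neg.
- exact: rsummable_pos.
- exact: rneg_ge0.
- exact: rpos_ge0.
- exact: rneg_ge0.
- exact: rpos_ge0.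
by congr rsum; apply/funext => x; rewrite {1}(rposneg a) {1}(rposneg b).
Qed.

Lemma esumZ (c : R) (f : T -> \bar R) : 0 <= c -> (forall x, 0 <= f x)%E ->
  (\esum_(x in [set: T]) (c%:E * f x) = c%:E * \esum_(x in [set: T]) f x)%E.
Proof.
have le1 (c' : R) (g : T -> \bar R) : 0 <= c' -> (forall x, 0 <= g x)%E ->
    (\esum_(x in [set: T]) (c'%:E * g x) <= c'%:E * \esum_(x in [set: T]) g x)%E.
  move=> c0 g0; apply: ub_ereal_sup => _ [X [fX _] <-].
  rewrite -ge0_mule_fsumr //; apply: lee_wpmul2l; rewrite ?lee_fin //.
  by apply: ereal_sup_ubound; exists X.
move=> c0 f0; apply/eqP; rewrite eq_le le1 //=.
have [->|cn0] := eqVneq c 0.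
  by rewrite mul0e; apply: esum_ge0 => x _; rewrite mul0e.
have cp : 0 < c by rewrite lt_def cn0.
rewrite -lee_pdivlMl //; apply: le_trans (le1 _ _ _ _); rewrite ?invr_ge0 //; last first.
  by move=> x; rewrite mule_ge0 ?lee_fin.
apply: le_esum => x _; rewrite muleA -EFinM mulVf // mul1e //.
Qed.

Lemma rsummableZ c a : rsummable a -> rsummable (fun x => c * a x).
Proof.
rewrite /rsummable /summable => sa.
under eq_esum do rewrite /= normrM EFinM.
rewrite esumZ ?normr_ge0 //; exact: lte_mul_pinfty.
Qed.

Lemma rsumN a : rsummable a -> rsum (fun x => - a x) = - rsum a.
Proof.
move=> sa; have sN : rsummable (fun x => - a x).
  by have := rsummableZ (-1) sa; under eq_fun do rewrite mulN1r.
apply/eqP; rewrite -addr_eq0 addrC -rsumD //; apply/eqP.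
under eq_fun do rewrite subrr.
rewrite /rsum esum1 ?esum1 ?sube0 //.
- by move=> x _; rewrite funenegE /= oppr0 maxxx.
- by move=> x _; rewrite funeposE /= maxxx.
Qed.

Lemma rsum_ge0E a : (forall x, 0 <= a x) -> rsummable a ->
  rsum a = fine (\esum_(x in [set: T]) (a x)%:E).
Proof.
move=> a0 sa.
have s0 : rsummable (fun=> 0 : R).
  by have := rsummableZ 0 sa; under eq_fun do rewrite mul0r.
have := rsum_sub a0 (fun=> lexx _) sa s0; under eq_fun do rewrite subr0.
by move=> ->; rewrite [X in _ - fine X]esum1 ?subr0.
Qed.

Lemma rsumZ c a : rsummable a -> rsum (fun x => c * a x) = c * rsum a.
Proof.
move=> sa.
have pos k b : 0 <= k -> (forall x, 0 <= b x) -> rsummable b ->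
    rsum (fun x => k * b x) = k * rsum b.
  move=> k0 b0 sb; rewrite !rsum_ge0E //; last 2 first.
  - by move=> x; rewrite mulr_ge0.
  - exact: rsummableZ.
  under eq_esum do rewrite EFinM.
  by rewrite esumZ // fineM // esum_fin_num.
have pos2 k b : 0 <= k -> rsummable b -> rsum (fun x => k * b x) = k * rsum b.
  move=> k0 sb; have sp := rsummable_pos sb; have sn := rsummable_neg sb.
  have -> : (fun x => k * b x) = (fun x => k * rpos b x + - (k * rneg b x)).
    by apply/funext => x; rewrite {1}(rposneg b); ring.
  have sn' := rsummableZ k sn.
  have sN : rsummable (fun x => - (k * rneg b x)).
    by have := rsummableZ (-1) sn'; under eq_fun do rewrite mulN1r.
  rewrite rsumD ?rsumN ?pos //; try exact: rsummableZ; try exact: rpos_ge0;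
    try exact: rneg_ge0.
  rewrite -mulrBr; congr (_ * _).
  rewrite [in RHS](rposneg b) rsumD ?rsumN //.
  by have := rsummableZ (-1) sn; under eq_fun do rewrite mulN1r.
have [c0|c0] := leP 0 c; first exact: pos2.
have -> : (fun x => c * a x) = (fun x => - ((- c) * a x)).
  by apply/funext => x; ring.
rewrite rsumN ?pos2 ?mulNr ?opprK //; last exact: rsummableZ.
by rewrite oppr_ge0 ltW.
Qed.

Lemma rsum_ge0 a : (forall x, 0 <= a x) -> rsummable a -> 0 <= rsum a.
Proof.
move=> a0 sa; rewrite rsum_ge0E //; apply: fine_ge0.
by apply: esum_ge0 => x _; rewrite lee_fin.
Qed.

Lemma esum_reindex (h h' : T -> T) (f : T -> \bar R) : cancel h h' -> cancel h' h ->
  (forall x, 0 <= f x)%E ->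
  (\esum_(x in [set: T]) f (h x) = \esum_(x in [set: T]) f x)%E.
Proof.
move=> hK h'K f0; symmetry; apply: reindex_esum => //.
split=> //; first by move=> x y _ _ /(can_inj hK).
by move=> y _; exists (h' y).
Qed.

Lemma rsummable_reindex (h h' : T -> T) a : cancel h h' -> cancel h' h ->
  rsummable a -> rsummable (fun x => a (h x)).
Proof.
move=> hK h'K; rewrite /rsummable /summable.
by rewrite (esum_reindex (f := fun x => `|(EFin \o a) x|%E) hK h'K).
Qed.

Lemma rsum_reindex (h h' : T -> T) a : cancel h h' -> cancel h' h ->
  rsum (fun x => a (h x)) = rsum a.
Proof.
move=> hK h'K; rewrite /rsum.
have e (f : T -> \bar R) : (forall x, 0 <= f x)%E ->
    (\esum_(x in [set: T]) f (h x) = \esum_(x in [set: T]) f x)%E.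
  by move=> f0; exact: (esum_reindex hK h'K f0).
congr (fine (_ - _)).
  rewrite -(e (EFin \o a)^\+%E); last by move=> x; apply: funepos_ge0.
  by apply: eq_esum => x _; rewrite !funeposE.
rewrite -(e (EFin \o a)^\-%E); last by move=> x; apply: funeneg_ge0.
by apply: eq_esum => x _; rewrite !funenegE.
Qed.


End RealSums.

Section RealInnerProduct.
Local Open Scope complex_scope.
Local Open Scope ring_scope.
Variables (R : realType) (T : choiceType).
Implicit Types (phi psi chi : T -> R[i]).

(** A real scalar product is enough: a spectral measure is the real part of a
    quadratic form, and a symmetric form is determined by its quadratic form. *)
Definition ip phi psi : R := complex.Re (inner phi psi).
Definition sqn phi := ip phi phi.
(** The one operation through which linearity is expressed, in the shape used by
    [op_linear]. *)
Definition comb (a : R) phi psi : T -> R[i] := fun x => a%:C * phi x + psi x.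

Lemma Re_mul_conj (z w : R[i]) :
  complex.Re (z * (w^*)%C) = complex.Re z * complex.Re w + complex.Im z * complex.Im w.
Proof. by case: z w => [a b] [c d] /=; rewrite mulrN opprK. Qed.

Lemma Re_norm2 (z : R[i]) : complex.Re (`|z| ^+ 2) = complex.Re z ^+ 2 + complex.Im z ^+ 2.
Proof. by rewrite -add_Re2_Im2. Qed.

Lemma ipE phi psi : ip phi psi =
  rsum (fun x => complex.Re (phi x) * complex.Re (psi x) +
                 complex.Im (phi x) * complex.Im (psi x)).
Proof. by rewrite /ip /inner /=; congr rsum; apply/funext => x; rewrite Re_mul_conj. Qed.

Lemma l2P phi : l2 phi <->
  rsummable (fun x => complex.Re (phi x) ^+ 2 + complex.Im (phi x) ^+ 2).
Proof.
rewrite /l2 /mkset; under eq_esum do rewrite Re_norm2.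
have nn x : 0 <= complex.Re (phi x) ^+ 2 + complex.Im (phi x) ^+ 2.
  by rewrite addr_ge0 ?sqr_ge0.
by split=> h; [exact: (rsummable_ge0 nn).2 h|exact: (rsummable_ge0 nn).1 h].
Qed.

Lemma rsummable_mono (a b : T -> R) : (forall x, `|a x| <= b x) -> rsummable b -> rsummable a.
Proof.
move=> ab sb; apply: (rsummable_le ab); apply: (rsummable_ge0 _).1 sb => x.
exact: le_trans (normr_ge0 _) (ab x).
Qed.

Lemma rsummable_ip phi psi : l2 phi -> l2 psi ->
  rsummable (fun x => complex.Re (phi x) * complex.Re (psi x) +
                      complex.Im (phi x) * complex.Im (psi x)).
Proof.
move=> /l2P sp /l2P sq; apply: rsummable_mono (rsummableD sp sq) => x.
move: (complex.Re (phi x)) (complex.Im (phi x)) (complex.Re (psi x)) (complex.Im (psi x)).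
move=> a b c e; rewrite ler_norml.
have := sqr_ge0 (a + c); have := sqr_ge0 (a - c).
have := sqr_ge0 (b + e); have := sqr_ge0 (b - e).
have := sqr_ge0 a; have := sqr_ge0 b; have := sqr_ge0 c; have := sqr_ge0 e.
move=> *; apply/andP; split; nra.
Qed.

Lemma l2_comb a phi psi : l2 phi -> l2 psi -> l2 (comb a phi psi).
Proof.
move=> /l2P sp /l2P sq; apply/l2P.
apply: rsummable_mono (rsummableD (rsummableZ (2 * a ^+ 2) sp) (rsummableZ 2 sq)) => x.
rewrite ger0_norm ?addr_ge0 ?sqr_ge0 // /comb.
case: (phi x) (psi x) => [b c] [e f] /=.
rewrite mul0r subr0 mul0r addr0.
have := sqr_ge0 (a * b - e); have := sqr_ge0 (a * c - f).
by move=> *; nra.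
Qed.

Lemma ip_combl a phi psi chi : l2 phi -> l2 psi -> l2 chi ->
  ip (comb a phi psi) chi = a * ip phi chi + ip psi chi.
Proof.
move=> lp lq lc; rewrite !ipE -rsumZ ?rsummable_ip // -rsumD ?rsummable_ip //; last first.
  exact/rsummableZ/rsummable_ip.
congr rsum; apply/funext => x; rewrite /comb.
by case: (phi x) (psi x) (chi x) => [b c] [e f] [g h] /=; ring.
Qed.

Lemma ip_sym phi psi : ip phi psi = ip psi phi.
Proof. by rewrite !ipE; congr rsum; apply/funext => x; rewrite mulrC [X in _ + X]mulrC. Qed.

Lemma ip_combr a phi psi chi : l2 phi -> l2 psi -> l2 chi ->
  ip chi (comb a phi psi) = a * ip chi phi + ip chi psi.
Proof. by move=> lp lq lc; rewrite ip_sym ip_combl // !(ip_sym chi). Qed.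

Lemma sqn_ge0 phi : l2 phi -> 0 <= sqn phi.
Proof.
move=> lp; rewrite /sqn ipE; apply: rsum_ge0; last exact: rsummable_ip.
by move=> x; rewrite -!expr2 addr_ge0 ?sqr_ge0.
Qed.

Lemma sqn_comb a phi psi : l2 phi -> l2 psi ->
  sqn (comb a phi psi) = a ^+ 2 * sqn phi + 2 * a * ip phi psi + sqn psi.
Proof.
move=> lp lq; have lc := l2_comb a lp lq.
rewrite /sqn ip_combl // !ip_combr // (ip_sym psi phi); ring.
Qed.

Lemma ip_cauchy_schwarz phi psi : l2 phi -> l2 psi ->
  ip phi psi ^+ 2 <= sqn phi * sqn psi.
Proof.
move=> lp lq.
have h t : 0 <= t ^+ 2 * sqn phi + 2 * t * ip phi psi + sqn psi.
  by rewrite -sqn_comb //; apply/sqn_ge0/l2_comb.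
have := sqn_ge0 lp; rewrite le_eqVlt => /predU1P[n0|n0].
  rewrite -n0 mul0r; have := h (- (sqn psi + 1) / (2 * ip phi psi)).
  have [->|i0] := eqVneq (ip phi psi) 0; first by rewrite expr0n.
  rewrite -n0 mulr0 add0r [X in 0 <= X + _ -> _](_ : _ = - (sqn psi + 1)); last by field.
  by lra.
have := h (- ip phi psi / sqn phi).
rewrite [X in 0 <= X -> _](_ : _ = (sqn phi * sqn psi - ip phi psi ^+ 2) / sqn phi); last first.
  by field; rewrite gt_eqF.
by rewrite pmulr_lge0 ?invr_gt0 // subr_ge0.
Qed.

Record sym_op (A : operator R T) : Prop := {
  so_l2 : forall phi, l2 phi -> l2 (A phi);
  so_comb : forall a phi psi, l2 phi -> l2 psi ->
    A (comb a phi psi) = comb a (A phi) (A psi);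
  so_sym : forall phi psi, l2 phi -> l2 psi -> ip (A phi) psi = ip phi (A psi) }.

(** A symmetric operator is bounded by its numerical radius: polarisation gives
    [2 ip (A phi) psi <= h (sqn phi + sqn psi)], and one takes [psi] equal to
    [A phi] divided by [h]. *)
Lemma sqn_sym_op_le (A : operator R T) (h : R) : sym_op A -> 0 < h ->
  (forall phi, l2 phi -> `|ip (A phi) phi| <= h * sqn phi) ->
  forall phi, l2 phi -> sqn (A phi) <= h ^+ 2 * sqn phi.
Proof.
move=> [Al2 Acomb Asym] h0 hA phi lp; have lA := Al2 _ lp.
(* this is [h^-1 * A phi], written as a combination *)
pose psi := comb (h^-1 - 1) (A phi) (A phi).
have lpsi : l2 psi by apply: l2_comb.
have lAA := Al2 _ lpsi.
have psiE chi : l2 chi -> ip psi chi = h^-1 * ip (A phi) chi.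
  by move=> lc; rewrite ip_combl //; ring.
have e1 : ip psi psi = h^-1 ^+ 2 * ip (A phi) (A phi).
  by rewrite psiE // ip_sym psiE //; ring.
clearbody psi.
have lp1 := l2_comb 1 lp lpsi; have lp2 := l2_comb (-1) lp lpsi.
have := hA _ lp1; have := hA _ lp2; rewrite !sqn_comb // !Acomb //.
rewrite !ip_combl ?ip_combr //; try exact: l2_comb.
rewrite (Asym psi phi) // (ip_sym (A phi) psi) (psiE (A phi)) // /sqn e1.
set q1 := ip (A phi) phi; set q2 := ip (A psi) psi; set q3 := ip (A phi) (A phi).
rewrite !ler_norml; set n1 := ip phi phi; set i1 := ip phi psi.
move=> /andP[h1 _] /andP[_ h2].
have {h1 h2} : 4 * (h^-1 * q3) <= 2 * h * n1 + 2 * h * (h^-1 ^+ 2 * q3) by lra.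
have -> : 2 * h * (h^-1 ^+ 2 * q3) = 2 * (h^-1 * q3) by field; rewrite gt_eqF.
move=> h3; have : h^-1 * q3 <= h * n1 by lra.
by rewrite -ler_pdivlMl ?invr_gt0 // invrK mulrA.
Qed.
End RealInnerProduct.

(** * Moments of a spectral measure *)

Section CompactSupport.
Variables (R : realType) (nu : {measure set R -> \bar R}) (I : set R).
Hypothesis mI : measurable I.
Hypothesis nu_fin : (nu [set: R] < +oo)%E.
Hypothesis nuI : nu (~` I) = 0%E.

Lemma supported_integrable (g : R -> R) (K : R) : measurable_fun [set: R] g ->
  (forall x, I x -> `|g x| <= K) ->
  nu.-integrable [set: R] (EFin \o g).
Proof.
move=> mg gK.
apply/(negligible_integrable (N := ~` I)) => //; first exact: measurableC.
  exact/measurable_EFinP.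
rewrite setTD setCK.
apply: measurable_bounded_integrable => //.
- by apply: le_lt_trans nu_fin; apply: le_measure; rewrite ?inE.
- exact: measurable_funTS.
- exists K; split; first exact: num_real.
  by move=> M KM x Ix; apply: le_trans (gK x Ix) (ltW KM).
Qed.

Lemma supported_Rintegral_le (g : R -> R) (K : R) : measurable_fun [set: R] g ->
  (forall x, I x -> `|g x| <= K) ->
  `|\int[nu]_x g x| <= K * fine (nu [set: R]).
Proof.
move=> mg gK; have ig := supported_integrable mg gK.
have nuIE : nu I = nu [set: R].
  have mC := measurableC mI.
  rewrite -(setUv I); transitivity (nu I + nu (~` I))%E; first by rewrite nuI adde0.
  by rewrite -measureU // setICr.
have fI : nu I \is a fin_num by rewrite nuIE ge0_fin_numE.
have -> : \int[nu]_x g x = \int[nu]_(x in I) g x.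
  congr fine; rewrite (negligible_integral (N := ~` I)) //; last exact: measurableC.
  by rewrite setTD setCK.
have igI : nu.-integrable I (EFin \o g) by apply: integrableS ig.
apply: le_trans (le_normr_Rintegral mI igI) _.
rewrite -nuIE -Rintegral_cst //; apply: le_Rintegral => //.
  exact: integrable_norm.
apply: measurable_bounded_integrable => //; first by rewrite nuIE.
exists `|K|; split; first exact: num_real.
by move=> M KM x Ix; exact: ltW.
Qed.

(** Riemann sums: [g] is uniformly close to a step function on the support. *)
Lemma supported_Rintegral_step n (B : 'I_n -> set R) (c : 'I_n -> R) (g : R -> R) (e : R) :
  measurable_fun [set: R] g -> (forall i, measurable (B i)) ->
  (forall i j x, B i x -> B j x -> i = j) ->
  (forall x, I x -> exists i, B i x) ->
  (forall i x, I x -> B i x -> `|g x - c i| <= e) ->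
  `|\int[nu]_x g x - \sum_(i < n) c i * fine (nu (B i))| <= e * fine (nu [set: R]).
Proof.
move=> mg mB dB cB gc.
pose st x := \sum_(i < n) c i * \1_(B i) x.
have mst : measurable_fun [set: R] st.
  by apply: measurable_sum => i; apply: measurable_funM.
have stE x i : B i x -> st x = c i.
  move=> Bx; rewrite /st (bigD1 i) //= indicE mem_set // mulr1 big1 ?addr0 // => j ji.
  rewrite indicE memNset ?mulr0 // => Bj; move: ji; rewrite (dB _ _ _ Bx Bj) eqxx //.
have bst x : `|st x| <= \sum_(i < n) `|c i|.
  apply: le_trans (ler_norm_sum _ _ _) _; apply: ler_sum => i _.
  rewrite normrM indicE; case: (_ \in _); rewrite ?normr1 ?normr0 ?mulr1 ?mulr0 //.
have ist : nu.-integrable [set: R] (EFin \o st).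
  by apply: supported_integrable => //.
have bg x : I x -> `|g x| <= e + \sum_(i < n) `|c i|.
  move=> Ix; have [i Bi] := cB x Ix.
  rewrite -(subrK (st x) (g x)); apply: le_trans (ler_normD _ _) _; apply: lerD => //.
  by rewrite (stE _ _ Bi); exact: gc.
have ig : nu.-integrable [set: R] (EFin \o g) by apply: supported_integrable bg.
have i1 i : nu.-integrable [set: R] (EFin \o \1_(B i)).
  apply: (supported_integrable (K := 1)); first exact: measurable_indic.
  by move=> x _; rewrite indicE; case: (_ \in _); rewrite ?normr1 ?normr0.
have -> : \sum_(i < n) c i * fine (nu (B i)) = \int[nu]_x st x.
  rewrite /Rintegral; under eq_integral do rewrite -sumEFin.
  rewrite integral_sum //; last first.
    move=> i; under eq_fun do rewrite EFinM.
    by apply: integrableZl => //; exact: i1.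
  rewrite -sum_fine => [|i _]; last first.
    apply: integrable_fin_num => //; under eq_fun do rewrite EFinM.
    by apply: integrableZl => //; exact: i1.
  apply: eq_bigr => i _; under eq_integral do rewrite EFinM.
  rewrite integralZl //; last exact: i1.
  rewrite integral_indic // setIT fineM // ge0_fin_numE //.
  by apply: le_lt_trans nu_fin; apply: le_measure; rewrite ?inE.
rewrite -(RintegralB measurableT ig ist); apply: supported_Rintegral_le.
  exact: measurable_funB.
by move=> x Ix; have [i Bi] := cB x Ix; rewrite (stE _ _ Bi); exact: gc.
Qed.

End CompactSupport.

Section LinearCombinations.
Local Open Scope complex_scope.
Local Open Scope ring_scope.
Variables (R : realType) (T : choiceType).
Implicit Types (phi psi : T -> R[i]).

Lemma l2_zero : l2 (fun=> 0 : R[i]) (T := T).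
Proof.
apply/l2P; rewrite /rsummable /summable; under eq_esum do rewrite /= expr0n addr0 normr0.
by rewrite esum1.
Qed.

Lemma ip_zero psi : ip (fun=> 0) psi = 0.
Proof.
rewrite ipE; under eq_fun do
  rewrite -[complex.Re 0]/(0 : R) -[complex.Im 0]/(0 : R) !mul0r addr0.
rewrite rsum_ge0E // ?esum1 // /rsummable /summable.
by under eq_esum do rewrite /= normr0; rewrite esum1.
Qed.

Definition lincomb (I : Type) (s : seq I) (c : I -> R) (F : I -> T -> R[i]) : T -> R[i] :=
  fun x => \sum_(i <- s) (c i)%:C * F i x.

Lemma lincomb_cons I (i : I) s c F :
  lincomb (i :: s) c F = comb (c i) (F i) (lincomb s c F).
Proof. by apply/funext => x; rewrite /lincomb big_cons. Qed.

Lemma l2_lincomb I s c (F : I -> T -> R[i]) : (forall i, l2 (F i)) -> l2 (lincomb s c F).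
Proof.
move=> lF; elim: s => [|i s IH]; last by rewrite lincomb_cons; exact: l2_comb.
rewrite (_ : lincomb _ _ _ = fun=> 0); first exact: l2_zero.
by apply/funext => x; rewrite /lincomb big_nil.
Qed.

Lemma ip_lincombl I s c (F : I -> T -> R[i]) psi : (forall i, l2 (F i)) -> l2 psi ->
  ip (lincomb s c F) psi = \sum_(i <- s) c i * ip (F i) psi.
Proof.
move=> lF lp; elim: s => [|i s IH].
  rewrite big_nil (_ : lincomb _ _ _ = fun=> 0) ?ip_zero //.
  by apply/funext => x; rewrite /lincomb big_nil.
by rewrite lincomb_cons ip_combl ?big_cons ?IH //; exact: l2_lincomb.
Qed.

End LinearCombinations.

Section SpectralMoments.
Local Open Scope complex_scope.
Local Open Scope ring_scope.
Variables (R : realType) (T : choiceType) (A : operator R T) (E : set R -> operator R T).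
Hypothesis hA : sym_op A.
Hypothesis hE : spectral_resolution A E.
Implicit Types (phi psi : T -> R[i]) (B : set R).

Lemma proj_sym_op B : measurable B -> sym_op (E B).
Proof.
move=> mB; have [El2 Elin _ Esa] := sr_proj hE mB; split=> //.
  by move=> a phi psi lp lq; exact: Elin.
by move=> phi psi lp lq; rewrite /ip Esa.
Qed.

Lemma proj_l2 B phi : measurable B -> l2 phi -> l2 (E B phi).
Proof. by move=> mB; exact: so_l2 (proj_sym_op mB) _. Qed.

Lemma measurable_segment11 : measurable (`[-1, 1]%classic : set R).
Proof. exact: measurable_itv. Qed.

(** The total mass is already carried by [[-1, 1]]. *)
Lemma spectral_measure_support phi (mu : {measure set R -> \bar R}) : l2 phi ->
  is_spectral_measure E phi mu ->
  mu [set: R] = (sqn phi)%:E /\ mu (~` `[-1, 1]%classic) = 0%E.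
Proof.
move=> lp hmu; have mI := measurable_segment11.
have muT : mu [set: R] = (sqn phi)%:E by rewrite hmu // (sr_setT hE).
split=> //.
pose J : set R := `[-1, 1]%classic; rewrite -/J.
have muI : mu J = (sqn phi)%:E by rewrite hmu // (sr_supp hE).
have mJ := measurableC mI.
have : (mu J + mu (~` J) = mu [set: R])%E.
  by rewrite -(setUv J) -measureU // setICr.
rewrite muI muT; case: (mu (~` J)) => [r| |] //= [] /eqP.
by rewrite -subr_eq0 addrAC subrr add0r => /eqP ->.
Qed.

Section Partition.
Variable n : nat.
Hypothesis n0 : (0 < n)%N.
(* [n.+1] intervals of length [h]; the last one is there for the end point [1] *)
Let h : R := 2 / n%:R.
Let c (i : 'I_n.+1) : R := -1 + i%:R * h.
Let B (i : 'I_n.+1) : set R := `[-1 + i%:R * h, -1 + i.+1%:R * h[%classic.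

Lemma mesh_gt0 : 0 < h. Proof. by rewrite divr_gt0 ?ltr0n. Qed.

Lemma mesh_le1 i : `|c i| <= 1.
Proof.
have i2 : i%:R * h <= 2.
  rewrite /h mulrCA -[leRHS]mulr1 ler_pM2l // ler_pdivrMr ?ltr0n // mul1r ler_nat.
  by rewrite -ltnS.
have := mulr_ge0 (ler0n R i) (ltW mesh_gt0).
by rewrite ler_norml /c => i0; apply/andP; split; lra.
Qed.

Lemma mesh_measurable i : measurable (B i). Proof. exact: measurable_itv. Qed.

Lemma mesh_disjoint i j x : B i x -> B j x -> i = j.
Proof.
rewrite /B /= !in_itv /= => /andP[i1 i2] /andP[j1 j2].
have lt1 (a b : 'I_n.+1) : -1 + a%:R * h <= x -> x < -1 + b.+1%:R * h -> (a <= b)%N.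
  move=> l1 l2; have := le_lt_trans l1 l2.
  by rewrite ltrD2l ltr_pM2r ?mesh_gt0 // ltr_nat ltnS.
by apply/val_inj/eqP; rewrite eqn_leq (lt1 _ _ i1 j2) (lt1 _ _ j1 i2).
Qed.

(** The index is the integral part of [(x + 1) / h]. *)
Lemma mesh_cover x : `[-1, 1]%classic x -> exists i, B i x.
Proof.
rewrite /= in_itv /= => /andP[x1 x2].
have y0 : 0 <= (x + 1) / h by rewrite divr_ge0 ?(ltW mesh_gt0) //; lra.
have /andP[t1 t2] := truncn_itv y0.
have tn : (Num.truncn ((x + 1) / h) < n.+1)%N.
  rewrite ltnS -(ler_nat R); apply: le_trans t1 _.
  rewrite ler_pdivrMr ?mesh_gt0 // /h mulrCA mulfV ?mulr1 ?pnatr_eq0 -?lt0n //; lra.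
exists (Ordinal tn); rewrite /B /= in_itv /=.
rewrite ler_pdivlMr ?mesh_gt0 // in t1; rewrite ltr_pdivrMr ?mesh_gt0 // in t2.
by apply/andP; split; lra.
Qed.

Lemma mesh_close i x : B i x -> `|x - c i| <= h.
Proof.
rewrite /B /= in_itv /= -natr1 mulrDl mul1r => /andP[x1 x2].
by rewrite /c ler_norml; have := mesh_gt0; move=> h0; apply/andP; split; lra.
Qed.

Let S : operator R T := fun phi => lincomb (index_enum 'I_n.+1) c (fun i => E (B i) phi).

Lemma step_sym_op : sym_op S.
Proof.
have Bs i := proj_sym_op (mesh_measurable i).
split=> [phi lp|a phi psi lp lq|phi psi lp lq].
- by apply: l2_lincomb => i; exact: so_l2 (Bs i) _ lp.
- apply/funext => x; rewrite /S /lincomb /comb mulr_sumr -big_split /=.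
  apply: eq_bigr => i _; rewrite -/(comb a phi psi) (so_comb (Bs i)) // /comb; ring.
- rewrite ip_sym [RHS]ip_sym ip_sym [RHS]ip_sym.
  rewrite ip_lincombl //; last by move=> i; exact: so_l2 (Bs i) _ lp.
  rewrite [RHS]ip_sym ip_lincombl //; last by move=> i; exact: so_l2 (Bs i) _ lq.
  by apply: eq_bigr => i _; rewrite (so_sym (Bs i)) // ip_sym.
Qed.

Lemma ip_step phi psi : l2 phi -> l2 psi ->
  ip (S phi) psi = \sum_i c i * ip (E (B i) phi) psi.
Proof.
by move=> lp lq; rewrite ip_lincombl // => i; apply: proj_l2 => //; exact: mesh_measurable.
Qed.

(** Both forms are integrals against the spectral measure of [phi], of the identity
    and of a step function that differs from it by at most the mesh. *)
Lemma step_close phi : l2 phi -> `|ip (A phi) phi - ip (S phi) phi| <= h * sqn phi.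
Proof.
move=> lp; have [nu hnu Anu] := sr_integral hE lp.
have [nuT nuI] := spectral_measure_support lp hnu.
have nufin : (nu [set: R] < +oo)%E by rewrite nuT ltry.
have mid : measurable_fun [set: R] (@id R) by exact: measurable_id.
have := supported_Rintegral_step measurable_segment11 nufin nuI mid
  mesh_measurable mesh_disjoint mesh_cover (fun i x _ => @mesh_close i x).
rewrite nuT /= [X in _ - X](_ : _ = ip (S phi) phi); last first.
  rewrite ip_step //; apply: eq_bigr => i _.
  by rewrite (hnu _ (mesh_measurable i)).
by rewrite /ip Anu.
Qed.

Let D : operator R T := fun phi => comb (-1) (S phi) (A phi).

Lemma diff_sym_op : sym_op D.
Proof.
have Ss := step_sym_op.
split=> [phi lp|a phi psi lp lq|phi psi lp lq].
- by apply: l2_comb; [exact: so_l2 Ss _ _|exact: so_l2 hA _ _].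
- rewrite /D (so_comb Ss) // (so_comb hA) //; apply/funext => x; rewrite /comb; ring.
- have [lSp lSq] := (so_l2 Ss lp, so_l2 Ss lq).
  have [lAp lAq] := (so_l2 hA lp, so_l2 hA lq).
  by rewrite ip_combl // ip_combr // (so_sym Ss) // (so_sym hA).
Qed.

Lemma sqn_diff phi : l2 phi -> sqn (D phi) <= h ^+ 2 * sqn phi.
Proof.
apply: sqn_sym_op_le mesh_gt0 _ phi; first exact: diff_sym_op.
move=> phi lp; rewrite ip_combl //; first by rewrite mulN1r addrC; exact: step_close.
  exact: so_l2 step_sym_op _ lp.
exact: so_l2 hA _ lp.
Qed.

Lemma spectral_op_form_le phi : l2 phi -> `|ip (A phi) phi| <= sqn phi.
Proof.
move=> lp; have [nu hnu Anu] := sr_integral hE lp.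
have [nuT nuI] := spectral_measure_support lp hnu.
have nufin : (nu [set: R] < +oo)%E by rewrite nuT ltry.
rewrite /ip Anu /=.
have mid : measurable_fun [set: R] (@id R) by exact: measurable_id.
have := @supported_Rintegral_le _ nu _ measurable_segment11 nufin nuI id 1 mid.
rewrite nuT /= mul1r; apply => x; rewrite in_itv /= => /andP[x1 x2].
by rewrite ler_norml x1 x2.
Qed.

Lemma spectral_op_contraction phi : l2 phi -> sqn (A phi) <= sqn phi.
Proof.
move=> lp; rewrite -[leRHS]mul1r -[X in X * _](expr1n _ 2).
apply: sqn_sym_op_le => //.
by move=> psi lq; rewrite mul1r; exact: spectral_op_form_le.
Qed.

Lemma sqn_step phi : (2 <= n)%N -> l2 phi -> sqn (S phi) <= 4 * sqn phi.
Proof.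
move=> n2 lp; rewrite (_ : 4 = 2 ^+ 2); last by rewrite expr2; lra.
apply: sqn_sym_op_le => //; first exact: step_sym_op.
move=> psi lq; have h1 : h <= 1 by rewrite ler_pdivrMr ?ltr0n // mul1r ler_nat.
have := step_close lq; have := spectral_op_form_le lq.
have := sqn_ge0 lq => s0.
have : h * sqn psi <= sqn psi by rewrite -[leRHS]mul1r ler_wpM2r.
rewrite !ler_norml => hs /andP[a1 a2] /andP[b1 b2].
by apply/andP; split; lra.
Qed.

(** The projections of disjoint intervals are orthogonal, so the powers of the step
    operator have the powers of its values as coefficients. *)
Lemma step_moment k phi : l2 phi ->
  ip (iter k.+1 S phi) phi = \sum_i c i ^+ k.+1 * ip (E (B i) phi) phi.
Proof.
move=> lp; have Ss := step_sym_op.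
have lS j : l2 (iter j S phi) by elim: j => //= j IH; exact: so_l2 Ss _ IH.
have lE i : l2 (E (B i) phi) by apply: proj_l2 => //; exact: mesh_measurable.
(* the projection of the empty set kills every vector, by Cauchy-Schwarz *)
have E0 psi : l2 psi -> ip psi (E set0 phi) = 0.
  move=> lq; have l0 : l2 (E set0 phi) by apply: proj_l2.
  have [nu hnu _] := sr_integral hE lp.
  have s0 : sqn (E set0 phi) = 0.
    rewrite /sqn (so_sym (proj_sym_op measurable0)) // -(sr_setI hE) // setI0 ip_sym.
    by apply: EFin_inj; rewrite -(hnu _ measurable0) measure0.
  have := ip_cauchy_schwarz lq l0; rewrite s0 mulr0 => i0.
  by apply/eqP; rewrite -sqrf_eq0 eq_le i0 sqr_ge0.
have key j i : ip (iter j S phi) (E (B i) phi) = c i ^+ j * ip (E (B i) phi) phi.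
  elim: j => [|j IH]; first by rewrite expr0 mul1r ip_sym.
  rewrite iterS ip_step // (bigD1 i) //= big1 ?addr0 => [|l li].
    rewrite (so_sym (proj_sym_op (mesh_measurable i))) // (op_idem (sr_proj hE _)) //.
      by rewrite IH exprS mulrA.
    exact: mesh_measurable.
  rewrite (so_sym (proj_sym_op (mesh_measurable l))) // -(sr_setI hE) //;
    try exact: mesh_measurable.
  rewrite (_ : B l `&` B i = set0) ?E0 ?mulr0 // -subset0.
  by move=> x [Bl Bi]; move: li; rewrite (mesh_disjoint Bl Bi) eqxx.
rewrite iterS ip_step //; apply: eq_bigr => i _.
by rewrite (so_sym (proj_sym_op (mesh_measurable i))) // key exprS mulrA.
Qed.

(** One replaces the operator by the step operator one factor at a time; each
    exchange costs the mesh times the norms of the other factors. *)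
Lemma iter_step_close k phi : (2 <= n)%N -> l2 phi ->
  `|ip (iter k A phi) phi - ip (iter k S phi) phi| <= k%:R * (h * 2 ^+ k * sqn phi).
Proof.
move=> n2 lp; have Ss := step_sym_op; have s0 := sqn_ge0 lp.
have lS j : l2 (iter j S phi) by elim: j => //= j IH; exact: so_l2 Ss _ IH.
have lA j : l2 (iter j A phi) by elim: j => //= j IH; exact: so_l2 hA _ IH.
have nS j : sqn (iter j S phi) <= 4 ^+ j * sqn phi.
  elim: j => [|j IH]; first by rewrite expr0 mul1r.
  rewrite iterS exprS -mulrA; apply: le_trans (sqn_step n2 (lS j)) _.
  by rewrite ler_pM2l.
have nA j : sqn (iter j A phi) <= sqn phi.
  by elim: j => // j IH; rewrite iterS; exact: le_trans (spectral_op_contraction (lA j)) IH.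
(* [a 0 k] and [a k 0] are the two sides; [step] moves one factor across *)
pose a i j := ip (iter i S phi) (iter j A phi).
have step i j : `|a i j.+1 - a i.+1 j| <= h * 2 ^+ i * sqn phi.
  have -> : a i j.+1 - a i.+1 j = ip (D (iter i S phi)) (iter j A phi).
    rewrite ip_combl //; [|exact: so_l2 Ss _ (lS i)|exact: so_l2 hA _ (lS i)].
    by rewrite mulN1r addrC (so_sym hA).
  rewrite -(@ler_pXn2r _ 2) ?nnegrE ?normr_ge0 //; last first.
    by rewrite !mulr_ge0 ?exprn_ge0 ?(ltW mesh_gt0).
  rewrite real_normK ?num_real //.
  apply: le_trans (ip_cauchy_schwarz (so_l2 diff_sym_op (lS i)) (lA j)) _.
  have -> : (h * 2 ^+ i * sqn phi) ^+ 2 = (h ^+ 2 * (4 ^+ i * sqn phi)) * sqn phi.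
    rewrite !exprMn -exprM mulnC exprM (_ : 2 ^+ 2 = 4); last by rewrite expr2; lra.
    by ring.
  apply: ler_pM => //; rewrite ?sqn_ge0 //; first exact: so_l2 diff_sym_op _ (lS i).
  apply: le_trans (sqn_diff (lS i)) _; rewrite ler_pM2l ?exprn_gt0 ?mesh_gt0 //.
have main i j : `|a i j - a (i + j)%N 0%N| <= j%:R * (h * 2 ^+ (i + j) * sqn phi).
  elim: j i => [|j IH] i; first by rewrite addn0 subrr normr0 mul0r.
  have -> : a i j.+1 - a (i + j.+1)%N 0%N =
      (a i j.+1 - a i.+1 j) + (a i.+1 j - a (i.+1 + j)%N 0%N).
    by rewrite addnS addSn; ring.
  apply: le_trans (ler_normD _ _) _; rewrite -natr1 mulrDl addrC mul1r.
  apply: lerD; first by rewrite -addSnnS; exact: IH.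
  apply: le_trans (step i j) _; rewrite ler_wpM2r // ler_pM2l ?mesh_gt0 //.
  by rewrite ler_weXn2l ?leq_addr //; lra.
by have := main 0%N k; rewrite add0n /a /= ip_sym.
Qed.

End Partition.

(** The powers of the operator and of the identity function are approximated by the
    same Riemann sums. *)
Theorem spectral_moment phi (mu : {measure set R -> \bar R}) k : l2 phi ->
  is_spectral_measure E phi mu ->
  \int[mu]_x x ^+ k = ip (iter k A phi) phi.
Proof.
move=> lp hmu; have [muT muI] := spectral_measure_support lp hmu.
have mufin : (mu [set: R] < +oo)%E by rewrite muT ltry.
case: k => [|k].
  under eq_Rintegral do rewrite expr0.
  by rewrite Rintegral_cst // mul1r muT.
have s0 := sqn_ge0 lp.
apply/eqP; rewrite -subr_eq0 -normr_le0; apply/ler_addgt0Pr => e e0; rewrite add0r.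
(* [K / n] is the sum of the errors of [supported_Rintegral_step] and [iter_step_close] *)
pose K : R := 2 * (k.+1%:R * (1 + 2 ^+ k.+1) * sqn phi).
have K0 : 0 <= K by rewrite !mulr_ge0 // addr_ge0 // exprn_ge0.
pose n := (Num.truncn (K / e)).+2.
have nK : K / n%:R <= e.
  rewrite ler_pdivrMr ?ltr0n // mulrC -ler_pdivrMr //.
  by apply: ltW; apply: lt_le_trans (truncnS_gt _) _; rewrite ler_nat.
apply: le_trans nK.
have n0 : (0 < n)%N by [].
have close i (x : R) : `[-1, 1]%classic x -> `[-1 + i%:R * (2 / n%:R), -1 + i.+1%:R * (2 / n%:R)[%classic x ->
   (i < n.+1)%N ->
   `|x ^+ k.+1 - (-1 + i%:R * (2 / n%:R)) ^+ k.+1| <= k.+1%:R * (2 / n%:R).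
  rewrite /= in_itv /= => /andP[x1 x2] Bx iN.
  have := mesh_close n0 (i := Ordinal iN) Bx; have := mesh_le1 n0 (Ordinal iN).
  move=> /=; set y := -1 + _ => y1 xy.
  have xn : `|x| <= 1 by rewrite ler_norml x1 x2.
  rewrite subrXX normrM mulrC; apply: ler_pM => //.
  apply: le_trans (ler_norm_sum _ _ _) _.
  rewrite -[X in _ <= X%:R]card_ord -sumr_const; apply: ler_sum => j _.
  by rewrite normrM !normrX mulr_ile1 ?exprn_ge0 ?exprn_ile1.
have mX : measurable_fun [set: R] (fun x : R => x ^+ k.+1) by exact: exprn_measurable.
have := supported_Rintegral_step measurable_segment11 mufin muI (g := fun x => x ^+ k.+1)
  (c := fun i : 'I_n.+1 => (-1 + i%:R * (2 / n%:R)) ^+ k.+1)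
  mX (@mesh_measurable n) (@mesh_disjoint n n0) (@mesh_cover n n0)
  (fun i x Ix Bx => close i x Ix Bx (ltn_ord i)).
have -> : \sum_(i < n.+1) (-1 + i%:R * (2 / n%:R)) ^+ k.+1 *
    fine (mu `[-1 + i%:R * (2 / n%:R), -1 + i.+1%:R * (2 / n%:R)[%classic) =
    \sum_(i < n.+1) (-1 + i%:R * (2 / n%:R)) ^+ k.+1 *
    ip (E `[-1 + i%:R * (2 / n%:R), -1 + i.+1%:R * (2 / n%:R)[%classic phi) phi.
  by apply: eq_bigr => i _; rewrite (hmu _ (mesh_measurable i)).
rewrite -(step_moment n0 k lp).
have := iter_step_close n0 k.+1 isT lp; rewrite muT /=.
set z := ip (iter k.+1 A phi) phi; set y := ip _ _; set x := \int[mu]_x _.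
move=> h1 h2; rewrite -(subrK y x) -addrA; apply: le_trans (ler_normD _ _) _.
rewrite [X in _ + X]distrC.
have -> : K / n%:R = k.+1%:R * (2 / n%:R) * sqn phi + k.+1%:R * (2 / n%:R * 2 ^+ k.+1 * sqn phi).
  by rewrite /K; ring.
exact: lerD.
Qed.

End SpectralMoments.

(** * Moments of the Markov operator count closed words *)

Section WordSums.
Variables (A : finType) (V : nmodType).

(** The sum of [F] over the words of length [k], in a form suited to induction on
    [k]. *)
Fixpoint wsum k (F : seq A -> V) : V :=
  if k is k'.+1 then \sum_a wsum k' (fun u => F (a :: u)) else F [::].

Lemma eq_wsum k F F' : (forall u, size u = k -> F u = F' u) -> wsum k F = wsum k F'.
Proof.
elim: k F F' => [|k IH] F F' e /=; first exact: e.
by apply: eq_bigr => a _; apply: IH => u su; apply: e; rewrite /= su.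
Qed.

Lemma wsum_sum k (I : Type) (s : seq I) (F : I -> seq A -> V) :
  wsum k (fun u => \sum_(i <- s) F i u) = \sum_(i <- s) wsum k (F i).
Proof.
elim: k F => [//|k IH] F /=; rewrite exchange_big /=.
by apply: eq_bigr => a _; rewrite IH.
Qed.

Lemma wsumSr k F : wsum k.+1 F = \sum_a wsum k (fun u => F (rcons u a)).
Proof.
elim: k F => [//|k IH] F; rewrite -[LHS]/(\sum_a wsum k.+1 (fun u => F (a :: u))).
by under eq_bigr do rewrite IH; rewrite exchange_big.
Qed.

End WordSums.

Lemma wsum_morph (A : finType) (U V : nmodType) (f : {additive U -> V}) k
  (F : seq A -> U) : f (wsum k F) = wsum k (fun u => f (F u)).
Proof.
elim: k F => [//|k IH] F /=; rewrite raddf_sum; exact: eq_bigr.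
Qed.

Lemma wsumB (A : finType) (V : zmodType) k (F F' : seq A -> V) :
  wsum k F - wsum k F' = wsum k (fun u => F u - F' u).
Proof.
elim: k F F' => [//|k IH] F F' /=; rewrite -sumrB; apply: eq_bigr => a _; exact: IH.
Qed.

Lemma wsum_mulrl (A : finType) (C : pzRingType) c k (F : seq A -> C) :
  c * wsum k F = wsum k (fun u => c * F u).
Proof.
elim: k F => [//|k IH] F /=; rewrite mulr_sumr; exact: eq_bigr.
Qed.

Section DeltaFunctions.
Local Open Scope complex_scope.
Local Open Scope ring_scope.
Variables (R : realType) (T : choiceType).

Lemma esum_indicator (g : T) : (\esum_(x in [set: T]) ((x == g)%:R : R)%:E = 1)%E.
Proof.
rewrite -[RHS](@esum_set1 R T g (fun=> 1%E)) // [RHS]esum_mkcond.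
apply: eq_esum => x _; have [->|xg] := eqVneq x g; first by rewrite mem_set.
by rewrite memNset // => /eqP; rewrite (negPf xg).
Qed.

Lemma rsummable_indicator (g : T) : rsummable (fun x : T => (x == g)%:R : R).
Proof. by apply/rsummable_ge0 => [x|]; rewrite ?ler0n // esum_indicator ltry. Qed.

Lemma delta_l2 (g : T) : l2 (delta R g).
Proof.
apply/l2P; apply: rsummable_mono (rsummable_indicator g) => x; rewrite /delta.
by case: eqP => _ /=; rewrite ?expr1n expr0n addr0 ?normr1 ?normr0.
Qed.

Lemma ip_delta (phi : T -> R[i]) (g : T) : ip phi (delta R g) = complex.Re (phi g).
Proof.
rewrite ipE [X in rsum X](_ : _ = (fun x => complex.Re (phi g) * (x == g)%:R)).
  rewrite rsumZ; last exact: rsummable_indicator.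
  by rewrite rsum_ge0E // ?esum_indicator ?mulr1 //; exact: rsummable_indicator.
by apply/funext => x; rewrite /delta; case: eqP => [->|_] /=; rewrite ?mulr1 !mulr0 addr0.
Qed.

End DeltaFunctions.

Section Markov.
Local Open Scope complex_scope.
Local Open Scope ring_scope.
Variables (R : realType) (d m r2 t : nat) (q : 'I_t -> nat).
Hypothesis hq : forall j, (3 <= q j)%N.
Let L := lamp m r2 q.
Let A : finType := (letter d + lamp_letter m r2 t)%type.
Let lam := @lamp_of_letter m r2 t q.
Let G := wreath L (free_group d).
Let S := wr_gens (fg_gens d) (lamp_gens m r2 q).
Let gen : A -> G := wr_letter lam.

(** A letter of the lamp group is recognised by its unique nonzero coordinate and
    the value there; together with [letter_exp] this gives injectivity at once. *)
Definition letter_coord (b : lamp_letter m r2 t) : lamp_coord m r2 t :=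
  match b with
  | inl (inl (j, _)) => inl (inl j) | inl (inr r) => inl (inr r) | inr (j, _) => inr j
  end.

Definition letter_exp (b : lamp_letter m r2 t) : int :=
  match b with
  | inl (inl (j, s)) => if s then -1 else 1 | inl (inr r) => 1
  | inr (j, s) => if s then ((q j).-1)%:Z else 1
  end.

Lemma Zp_opp1 j : nat_of_ord (- 1 : 'Z_(q j)) = (q j).-1.
Proof.
rewrite /= modn_small // [(1 %% _)%N]modn_small // subn1 Zq_cast // modn_small //.
Qed.

Lemma lamp_exp_letter b l :
  lamp_exp (lam b) l = if l == letter_coord b then letter_exp b else 0.
Proof.
case: b l => [[[j s]|r]|[j s]] [[j'|r']|j'].
all: rewrite /lam /lamp_of_letter /letter_coord /letter_exp; try case: s.
all: rewrite /= ?mxE ?ffunE ?mxE ?ffunE ?eqxx ?oppr0 //.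
- by rewrite -[inl _ == _]/(j' == j); case: (j' == j).
- by rewrite -[inl _ == _]/(j' == j); case: (j' == j).
- by rewrite -[inl _ == _]/(r' == r); case: (r' == r).
- rewrite -[inr _ == _]/(j' == j); case: (j' =P j) => [->|_]; first by rewrite Zp_opp1.
  by rewrite mulr0n oppr0.
- by rewrite -[inr _ == _]/(j' == j); case: (j' =P j).
Qed.

(** The hypothesis on [q] is what separates a generator of finite order from its
    inverse. *)
Lemma lamp_of_letter_inj : injective lam.
Proof.
move=> b b' e.
have h l : (if l == letter_coord b then letter_exp b else 0) =
           (if l == letter_coord b' then letter_exp b' else 0).
  by rewrite -!lamp_exp_letter e.
have n0 c : letter_exp c != 0.
  case: c => [[[j s]|r]|[j s]] //=; case: s => //.
  by have := hq j; case: (q j) => [|[|n]].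
have ec : letter_coord b = letter_coord b'.
  have := h (letter_coord b); rewrite eqxx; case: eqP => // _ e0.
  by have := n0 b; rewrite e0 eqxx.
have ee : letter_exp b = letter_exp b'.
  by have := h (letter_coord b); rewrite eqxx -ec eqxx.
case: b b' ec ee {e h} => [[[j s]|r]|[j s]] [[[j' s']|r']|[j' s']] //=.
- by move=> [<-]; case: s; case: s'.
- by move=> [<-].
- move=> [<-]; have := hq j; case: (q j) => [|[|[|n]]] // _.
  by case: s; case: s'.
Qed.

Lemma val_fg_letter (l : letter d) : val (fg_letter l) = [:: l].
Proof. by case: l => i []. Qed.

Lemma wr_letter_inj : injective gen.
Proof.
have lamp1 b : (wr_lamp (free_group d) (lam b)).1 1%g = lam b.
  by rewrite fsfunE inE eqxx.
move=> [l|b] [l'|b'] //= e.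
- have /(congr1 val) : fg_letter l = fg_letter l' by exact: (congr1 snd e).
  by rewrite !val_fg_letter => -[->].
- have /(congr1 val) : fg_letter l = 1%g by exact: (congr1 snd e).
  by rewrite val_fg_letter.
- have /(congr1 val) : 1%g = fg_letter l' by exact: (congr1 snd e).
  by rewrite val_fg_letter.
- have : (wr_lamp (free_group d) (lam b)).1 1%g = (wr_lamp (free_group d) (lam b')).1 1%g.
    exact: (congr1 (fun g : G => g.1 1%g) e).
  by rewrite !lamp1 => /lamp_of_letter_inj ->.
Qed.

Lemma mem_fg_gens g : (g \in fg_gens d) = (g \in [seq fg_letter l | l : letter d]).
Proof.
apply/idP/mapP => [|[[i s] _ ->]].
  rewrite inE => /orP[] /imfsetP[i _ ->].
    by exists (i, false); rewrite ?mem_enum.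
  by exists (i, true); rewrite ?mem_enum.
rewrite inE /fg_letter /=; case: s; apply/orP; [right|left].
  by apply/imfsetP; exists i.
by apply/imfsetP; exists i.
Qed.

Lemma mem_lamp_gens x : (x \in lamp_gens m r2 q) = (x \in [seq lam b | b : lamp_letter m r2 t]).
Proof.
have sgn2 (r : 'I_r2) : (- (0, delta_mx 0 r, 0) : L) = (0, delta_mx 0 r, 0).
  congr (_, _, _); rewrite ?oppr0 //.
  by apply/rowP => i; rewrite !mxE; apply/val_inj; case: (_ && _).
have gP y : reflect (exists b, y = lam b /\
    match b with inl (inl (_, s)) => ~~ s | inl (inr _) => true | inr (_, s) => ~~ s end)
    (y \in lamp_gen m r2 q).
  rewrite /lamp_gen !mem_cat; apply: (iffP idP).
    case/or3P => /mapP[i _ ->].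
    - by exists (inl (inl (i, false))).
    - by exists (inl (inr i)).
    - by exists (inr (i, false)).
  case=> -[[[j s]|r]|[j s]] [-> hs]; rewrite /lam /=; apply/or3P.
  - by apply: Or31; rewrite (negPf hs); apply: map_f; rewrite mem_enum.
  - by apply: Or32; apply: map_f; rewrite mem_enum.
  - by apply: Or33; rewrite (negPf hs); apply: map_f; rewrite mem_enum.
apply/idP/mapP => [|[b _ ->]].
  rewrite inE => /orP[] /imfsetP[y /= /gP[b [-> hb]] ->].
    by exists b; rewrite ?mem_enum.
  case: b hb => [[[j s]|r]|[j s]] hb.
  - by exists (inl (inl (j, true))); rewrite ?mem_enum // /lam /= (negPf hb).
  - by exists (inl (inr r)); rewrite ?mem_enum // /lam /= sgn2.
  - by exists (inr (j, true)); rewrite ?mem_enum // /lam /= (negPf hb).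
rewrite inE; apply/orP.
case: b => [[[j [|]]|r]|[j [|]]].
- right; apply/imfsetP; exists (lam (inl (inl (j, false)))) => //=.
  by apply/gP; exists (inl (inl (j, false))).
- by left; apply/imfsetP; exists (lam (inl (inl (j, false)))) => //=;
    apply/gP; exists (inl (inl (j, false))).
- by left; apply/imfsetP; exists (lam (inl (inr r))) => //=;
    apply/gP; exists (inl (inr r)).
- right; apply/imfsetP; exists (lam (inr (j, false))) => //=.
  by apply/gP; exists (inr (j, false)).
- by left; apply/imfsetP; exists (lam (inr (j, false))) => //=;
    apply/gP; exists (inr (j, false)).
Qed.

(** The generators of the group are listed without repetition by the letters, so
    sums over [S] become sums over words. *)
Lemma perm_gens : perm_eq S [seq gen a | a : A].
Proof.
apply: uniq_perm; first exact: fset_uniq.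
  by rewrite map_inj_uniq ?enum_uniq //; exact: wr_letter_inj.
move=> g; apply/idP/mapP => [|[a _ ->]].
  rewrite inE => /orP[] /imfsetP[x /=].
    by rewrite mem_fg_gens => /mapP[l _ ->] ->; exists (inl l); rewrite ?mem_enum.
  by rewrite mem_lamp_gens => /mapP[b _ ->] ->; exists (inr b); rewrite ?mem_enum.
rewrite inE; case: a => [l|b]; apply/orP; [left|right]; apply/imfsetP => /=.
  by exists (fg_letter l) => //; rewrite mem_fg_gens map_f ?mem_enum.
by exists (lam b) => //; rewrite mem_lamp_gens map_f ?mem_enum.
Qed.

Lemma card_gens : #|` S| = #|A|.
Proof. by have /perm_size := perm_gens; rewrite size_map -cardE. Qed.

Lemma sum_gens (V : nmodType) (F : G -> V) : \sum_(s <- S) F s = \sum_(a : A) F (gen a).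
Proof. by rewrite (perm_big _ perm_gens) big_map big_enum. Qed.

Implicit Types phi psi : G -> R[i].

Let mk : operator R G := markov_operator (R := R) S.

Lemma markovE phi h : mk phi h = (#|A|%:R)^-1 * \sum_a phi (gen a * h)%g.
Proof. by rewrite /mk /markov_operator card_gens sum_gens. Qed.

Definition letter_inv (a : A) : A :=
  match a with
  | inl l => inl (linv l)
  | inr (inl (inl (j, s))) => inr (inl (inl (j, ~~ s)))
  | inr (inl (inr r)) => inr (inl (inr r))
  | inr (inr (j, s)) => inr (inr (j, ~~ s))
  end.

Lemma letter_invK : involutive letter_inv.
Proof. by case=> [l|[[[j s]|r]|[j s]]] //=; rewrite ?linvK ?negbK. Qed.

Lemma wr_baseV (g : free_group d) : wr_base L g^-1%g = ((wr_base L g)^-1)%g.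
Proof.
apply: (mulgI (wr_base L g)); rewrite mulgV; congr pair; last by rewrite /= mulgV.
by apply/fsfunP => x; rewrite fsf_mulE !fsf_oneE addr0.
Qed.

Lemma wr_lampV (l : L) : wr_lamp (free_group d) (- l) = ((wr_lamp (free_group d) l)^-1)%g.
Proof.
apply: (mulgI (wr_lamp (free_group d) l)); rewrite mulgV; congr pair; last by rewrite /= mulg1.
apply/fsfunP => x; rewrite fsf_mulE fsf_oneE invg1 mul1g !fsfunE.
by case: ifP => _; rewrite ?addr0 ?subrr.
Qed.

Lemma gen_letter_inv a : gen (letter_inv a) = ((gen a)^-1)%g.
Proof.
case: a => [[i s]|b] /=.
  by rewrite -wr_baseV /fg_letter /=; case: s; rewrite ?invgK.
have -> : (wr_lamp (free_group d) (lam b))^-1%g = wr_lamp (free_group d) (- lam b).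
  by rewrite wr_lampV.
case: b => [[[j s]|r]|[j s]]; rewrite /gen /= /lam /=.
- by case: s; rewrite /= ?opprK.
- congr (wr_lamp _ _); congr (_, _, _); rewrite ?oppr0 //.
  by apply/rowP => i; rewrite !mxE; apply/val_inj; case: (_ && _).
- by case: s; rewrite /= ?opprK.
Qed.

Lemma l2_translate (g : G) phi : l2 phi -> l2 (fun h => phi (g * h)%g).
Proof.
move=> /l2P lp; apply/l2P.
exact: (rsummable_reindex (mulKg g) (mulKVg g) lp).
Qed.

Lemma ip_translate (g : G) phi psi :
  ip (fun h => phi (g * h)%g) psi = ip phi (fun h => psi (g^-1 * h)%g).
Proof.
rewrite !ipE -[RHS](rsum_reindex _ (mulKg g) (mulKVg g)).
by congr rsum; apply/funext => h; rewrite mulKg.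
Qed.

Lemma markov_lincomb phi :
  mk phi = lincomb (index_enum A) (fun=> (#|A|%:R)^-1) (fun a h => phi (gen a * h)%g).
Proof.
apply/funext => h; rewrite markovE /lincomb mulr_sumr; apply: eq_bigr => a _.
by rewrite fmorphV rmorph_nat.
Qed.

Lemma markov_sym_op : sym_op mk.
Proof.
split=> [phi lp|a phi psi lp lq|phi psi lp lq].
- by rewrite markov_lincomb; apply: l2_lincomb => a; exact: l2_translate.
- apply/funext => h; rewrite /comb !markovE mulrCA -mulrDr; congr (_ * _).
  by rewrite mulr_sumr -big_split.
- rewrite ip_sym [RHS]ip_sym !markov_lincomb ip_sym [RHS]ip_sym.
  rewrite ip_lincombl //; last by move=> a; exact: l2_translate.
  rewrite [RHS]ip_sym ip_lincombl //; last by move=> a; exact: l2_translate.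
  rewrite (reindex_inj (inv_inj letter_invK)) /=; apply: eq_bigr => a _.
  rewrite [in RHS]ip_sym -[gen a]invgK -gen_letter_inv -ip_translate //.
Qed.

Lemma wr_word_rcons (u : seq A) a : wr_word lam (rcons u a) = (wr_word lam u * gen a)%g.
Proof. by elim: u => [|b u IH] /=; rewrite ?mulg1 ?mul1g // IH mulgA. Qed.

(** The operator multiplies its argument on the left, hence builds words from the
    right: this is why the last letter is split off. *)
Lemma iter_markov k h : iter k mk (delta R (1%g : G)) h =
  (#|A|%:R)^-1 ^+ k * wsum k (fun u : seq A => (wr_word lam u * h == 1)%g%:R).
Proof.
elim: k h => [|k IH] h; first by rewrite expr0 mul1r /= /delta mul1g.
rewrite iterS markovE wsumSr exprS -mulrA; congr (_ * _).
rewrite [RHS]mulr_sumr; apply: eq_bigr => a _; rewrite IH.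
apply: (f_equal (fun z => _ * z)); by apply: eq_wsum => u _; rewrite wr_word_rcons mulgA.
Qed.

Lemma Re_wsum_nat k (P : seq A -> bool) :
  complex.Re ((#|A|%:R)^-1 ^+ k * wsum k (fun u => (P u)%:R : R[i])) =
  (#|A|%:R)^-1 ^+ k * wsum k (fun u => (P u)%:R : R).
Proof.
have -> : (#|A|%:R)^-1 ^+ k * wsum k (fun u => (P u)%:R : R[i]) =
    ((#|A|%:R)^-1 ^+ k * wsum k (fun u => (P u)%:R : R))%:C.
  rewrite rmorphM rmorphXn fmorphV rmorph_nat; congr (_ * _).
  rewrite (wsum_morph (real_complex R)); apply: eq_wsum => u _.
  by case: (P u).
by [].
Qed.

Theorem markov_moment (E : set R -> operator R G) (mu : {measure set R -> \bar R}) k :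
  spectral_resolution mk E -> is_spectral_measure E (delta R (1%g : G)) mu ->
  \int[mu]_x x ^+ k =
  (#|A|%:R)^-1 ^+ k * wsum k (fun u : seq A => (wr_word lam u == 1)%g%:R).
Proof.
move=> hE hmu; rewrite (spectral_moment markov_sym_op hE _ (delta_l2 _ _) hmu).
rewrite ip_delta iter_markov Re_wsum_nat.
by apply: (f_equal (fun z => _ * z)); apply: eq_wsum => u _; rewrite mulg1.
Qed.

End Markov.

(** * Eigenvalues of Hermitian matrices *)

Section CharPoly.
Variable F : fieldType.

Lemma perm_eq_prod_XsubC (s s' : seq F) :
  \prod_(z <- s) ('X - z%:P) = \prod_(z <- s') ('X - z%:P) -> perm_eq s s'.
Proof.
elim: s s' => [|a s IH] s'.
  rewrite big_nil => /(congr1 (fun p : {poly F} => size p)).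
  by rewrite size_poly1 size_prod_XsubC; case: s'.
move=> e; have as' : a \in s' by rewrite -root_prod_XsubC -e root_prod_XsubC mem_head.
have ps := perm_to_rem as'; rewrite perm_sym; apply: (perm_trans ps).
rewrite perm_cons perm_sym; apply: IH.
move: e; rewrite big_cons (perm_big _ ps) /= big_cons.
by apply: mulfI; rewrite polyXsubC_eq0.
Qed.

Lemma char_poly_conj n (P D : 'M[F]_n) : P \in unitmx ->
  char_poly (invmx P *m D *m P) = char_poly D.
Proof.
move=> uP; rewrite /char_poly.
have -> : char_poly_mx (invmx P *m D *m P) =
   map_mx polyC (invmx P) *m char_poly_mx D *m map_mx polyC P.
  rewrite /char_poly_mx !map_mxM mulmxBr mulmxBl; congr (_ - _).
  by rewrite -mulmxA -scalar_mxC mulmxA -map_mxM mulVmx // map_mx1 mul1mx.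
rewrite !det_mulmx mulrAC -det_mulmx -map_mxM mulVmx // map_mx1 det1 mul1r //.
Qed.

Lemma expr_conj_diag n (P : 'M[F]_n) (v : 'rV[F]_n) k : P \in unitmx ->
  (invmx P *m diag_mx v *m P) ^+ k = invmx P *m diag_mx (\row_i v 0 i ^+ k) *m P.
Proof.
move=> uP; elim: k => [|k IH].
  rewrite expr0 (_ : diag_mx _ = 1%:M) ?mulmx1 ?mulVmx //.
  by apply/matrixP => i j; rewrite !mxE expr0.
rewrite exprS IH -[LHS]/(_ *m _) -!mulmxA mulKVmx // [X in _ *m X = _]mulmxA.
congr (_ *m (_ *m _)); rewrite mulmx_diag; congr diag_mx.
by apply/rowP => i; rewrite !mxE exprS.
Qed.

End CharPoly.

Section HermitianEigenvalues.
Local Open Scope complex_scope.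
Local Open Scope ring_scope.
Variable R : realType.

(** Spectral theorem; the eigenvalues are read off from the characteristic
    polynomial of the diagonal form. *)
Lemma hermitian_eigenvalues N (A : 'M[R[i]]_N) : A \is hermsymmx ->
  exists2 v : 'I_N -> R, perm_eq (eigenvalues A) [seq (v i)%:C | i : 'I_N] &
    forall k, \tr (A ^+ k) = (\sum_i v i ^+ k)%:C.
Proof.
move=> hA; have uP := spectral_unit A.
have /orthomx_spectralP eA := hermitian_normalmx hA.
have /mxOverP dr := hermitian_spectral_diag_real hA.
set P := spectralmx A in uP eA; set D := spectral_diag A in eA dr.
have Dv i : D 0 i = (complex.Re (D 0 i))%:C by rewrite RRe_real.
exists (fun i => complex.Re (D 0 i)) => [|k]; last first.
  rewrite {1}eA expr_conj_diag // -mulmxA mxtrace_mulC -mulmxA mulmxV // mulmx1.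
  rewrite mxtrace_diag rmorph_sum /=; apply: eq_bigr => i _.
  by rewrite mxE {1}Dv -rmorphXn.
apply: perm_eq_prod_XsubC; rewrite /eigenvalues.
case: closed_field_poly_normal => s /= es.
move: es; rewrite (monicP (char_poly_monic A)) scale1r => <-.
rewrite {1}eA char_poly_conj // char_poly_trig; last first.
  by rewrite diag_mx_is_trig.
rewrite big_map big_enum /=; apply: eq_bigr => i _.
by rewrite mxE eqxx mulr1n {1}Dv.
Qed.

Lemma esd_integral N (A : 'M[R[i]]_N) (v : 'I_N -> R) (f : R -> R) :
  perm_eq (eigenvalues A) [seq (v i)%:C | i : 'I_N] -> measurable_fun [set: R] f ->
  \int[esd A]_x f x = N%:R^-1 * \sum_i f (v i).
Proof.
move=> pe mf.
have pos g : measurable_fun [set: R] g -> (forall x, 0 <= g x)%E ->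
   (\int[esd A]_x g x = (N%:R^-1)%:E * \sum_i g (v i))%E.
  move=> mg g0; rewrite /esd ge0_integral_mscale // ge0_integral_measure_sum //.
  congr (_ * _)%E; under eq_bigr do rewrite integral_dirac // diracT mul1e.
  rewrite -(big_mkord xpredT (fun k => g (complex.Re (nth 0 (eigenvalues A) k)))).
  have sz : size (eigenvalues A) = N.
    by rewrite (perm_size pe) size_map -cardE card_ord.
  rewrite -{1}sz -(big_nth 0 xpredT (fun z => g (complex.Re z))) /=.
  by rewrite (perm_big _ pe) /= big_map big_enum.
rewrite /Rintegral integralE.
have mE : measurable_fun [set: R] (EFin \o f) by apply/measurable_EFinP.
rewrite !pos //; try exact: funepos_ge0; try exact: funeneg_ge0;
  try exact: measurable_funepos; try exact: measurable_funeneg.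
have fin1 (g : R -> R) : (\sum_i (g (v i))%:E = (\sum_i g (v i))%:E)%E by rewrite sumEFin.
have -> : (\sum_i (EFin \o f)^\+ (v i) = (\sum_i Num.max (f (v i)) 0)%:E)%E.
  by rewrite -sumEFin; apply: eq_bigr => i _; rewrite funeposE EFin_max.
have -> : (\sum_i (EFin \o f)^\- (v i) = (\sum_i Num.max (- f (v i)) 0)%:E)%E.
  by rewrite -sumEFin; apply: eq_bigr => i _; rewrite funenegE EFin_max.
rewrite -!EFinM -EFinB /= -mulrBr -sumrB; congr (_ * _); apply: eq_bigr => i _.
by rewrite /Num.max; case: ltrP => ?; case: ltrP => ?; lra.
Qed.

(** An eigenvalue outside [[-1, 1]] would make the even traces grow geometrically. *)
Lemma even_traces_bound N (v : 'I_N -> R) :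
  (forall k, \sum_i v i ^+ (2 * k) <= N%:R) -> forall i, `|v i| <= 1.
Proof.
move=> h i; rewrite leNgt; apply/negP => v1.
have e0 : 0 < v i ^+ 2 - 1.
  rewrite subr_gt0 -[v i ^+ 2]ger0_norm ?sqr_ge0 // normrX.
  by rewrite -[1](expr1n _ 2) ltrXn2r ?normr_ge0.
set e := v i ^+ 2 - 1 in e0.
(* Bernoulli inequality *)
have bern k : 1 + k%:R * e <= v i ^+ (2 * k).
  elim: k => [|k IH]; first by rewrite mul0r addr0 muln0 expr0.
  rewrite mulnS exprD (_ : v i ^+ 2 = 1 + e); last by rewrite /e; ring.
  apply: (@le_trans _ _ ((1 + e) * (1 + k%:R * e))); last first.
    by rewrite ler_wpM2l // addr_ge0 // ltW.
  rewrite -natr1; have : 0 <= e * (k%:R * e) by rewrite !mulr_ge0 // ltW.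
  by lra.
pose k := (Num.truncn (N%:R / e)).+1.
have : N%:R < k%:R * e by rewrite -ltr_pdivrMr // truncnS_gt.
have := h k; rewrite (bigD1 i) //=.
have : 0 <= \sum_(j < N | j != i) v j ^+ (2 * k).
  by apply: sumr_ge0 => j _; rewrite exprM exprn_ge0 // sqr_ge0.
have := bern k; lra.
Qed.

End HermitianEigenvalues.

(** * The random matrix as an average of letter matrices *)

Section LetterMatrices.
Local Open Scope complex_scope.
Local Open Scope sesquilinear_scope.
Local Open Scope ring_scope.
Variables (R : realType) (d m r2 t : nat) (q : 'I_t -> nat) (N : nat).
Let A : finType := (letter d + lamp_letter m r2 t)%type.
Let C := R[i].
Variables (V : 'I_d -> 'S_N) (Z : 'I_N -> lamp_coord m r2 t -> C).
Let z x := letter_value (Z x).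

Definition letter_mx (a : A) : 'M[C]_N :=
  \matrix_(i, j) (weight z i a * (move V i a == j)%:R).

(** The convex combination of the letter matrices, with arbitrary character values;
    the random matrix is an instance ([random_matrixE]). *)
Definition step_mx : 'M[C]_N := (#|A|%:R)^-1 *: \sum_a letter_mx a.

Lemma step_mx_expr k i j : (step_mx ^+ k) i j =
  (#|A|%:R)^-1 ^+ k * wsum k (fun u : seq A => phase V z i u * (endpoint V i u == j)%:R).
Proof.
elim: k i => [|k IH] i; first by rewrite expr0 !mxE /= mul1r mul1r.
rewrite exprS -[_ * _ ^+ _]/(step_mx *m _) mxE.
transitivity ((#|A|%:R)^-1 * \sum_a weight z i a * (step_mx ^+ k) (move V i a) j).
  under eq_bigr do rewrite mxE summxE -mulrA mulr_suml.
  rewrite -mulr_sumr exchange_big /=; congr (_ * _); apply: eq_bigr => a _.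
  rewrite (bigD1 (move V i a)) //= big1 ?addr0 ?mxE ?eqxx ?mulr1 // => l nl.
  by rewrite mxE eq_sym (negPf nl) mulr0 mul0r.
rewrite exprS -mulrA; apply: (f_equal (fun y => _ * y)).
rewrite -[wsum k.+1 _]/(\sum_a wsum k (fun u => phase V z i (a :: u) *
   (endpoint V i (a :: u) == j)%:R)) [RHS]mulr_sumr; apply: eq_bigr => a _; rewrite IH.
rewrite mulrCA; apply: (f_equal (fun y => _ * y)); rewrite wsum_mulrl.
by apply: eq_wsum => u _; rewrite mulrA.
Qed.

Lemma step_mx_trace k :
  \tr (step_mx ^+ k) = (#|A|%:R)^-1 ^+ k * wsum k (word_trace V Z).
Proof.
rewrite /mxtrace; under eq_bigr do rewrite step_mx_expr.
rewrite -mulr_sumr; apply: (f_equal (fun y => _ * y)).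
rewrite -(wsum_sum k (index_enum 'I_N)
  (fun i u => phase V z i u * (endpoint V i u == i)%:R)).
apply: eq_wsum => u _; rewrite /word_trace [RHS]big_mkcond /=.
by apply: eq_bigr => i _; case: ifP; rewrite ?mulr1 ?mulr0.
Qed.

Hypothesis Zreal : forall x r, (Z x (inl (inr r)))^* = Z x (inl (inr r)).

Lemma letter_mx_inv a : (letter_mx a) ^t* = letter_mx (letter_inv a).
Proof.
apply/matrixP => i j; rewrite !mxE rmorphM rmorph_nat.
case: a => [l|b] /=.
  rewrite rmorph1 !mul1r lperm_linv; congr ((_ : bool)%:R).
  by apply/idP/idP => /eqP <-; rewrite ?permK ?permKV.
have [->|nij] := eqVneq i j.
  rewrite !mulr1.
  case: b => [[[k s]|r]|[k s]] /=; rewrite ?eqxx ?mulr1 /z /= ?Zreal //; case: s;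
   by rewrite /= ?conjCK.
by rewrite !mulr0; case: b => [[[k s]|r]|[k s]] /=; rewrite ?(negPf nij) mulr0.
Qed.

Lemma step_mx_hermitian : step_mx \is hermsymmx.
Proof.
rewrite qualifE /= expr0 scale1r; apply/eqP; rewrite /step_mx.
rewrite linearZ /= map_mxZ fmorphV rmorph_nat; congr (_ *: _).
rewrite [LHS](reindex_inj (inv_inj (@letter_invK d m r2 t))) /=.
rewrite raddf_sum raddf_sum /=; apply: eq_bigr => a _.
by rewrite -letter_mx_inv.
Qed.

Lemma step_mx_eigenvalues : exists2 v : 'I_N -> R,
  perm_eq (eigenvalues step_mx) [seq (v i)%:C | i : 'I_N] &
  forall k, ((\sum_i v i ^+ k)%:C = (#|A|%:R)^-1 ^+ k * wsum k (word_trace V Z)).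
Proof.
have [v pv tv] := hermitian_eigenvalues step_mx_hermitian.
by exists v => // k; rewrite -tv step_mx_trace.
Qed.

Lemma norm_wsum (F : seq A -> C) (K : R) k : (forall u, `|F u| <= K%:C) ->
  `|(#|A|%:R)^-1 ^+ k * wsum k F| <= K%:C.
Proof.
move=> FK; have K0 : 0 <= K%:C := le_trans (normr_ge0 _) (FK [::]).
elim: k F FK => [|k IH] F FK; first by rewrite expr0 mul1r; exact: FK.
rewrite exprSr -mulrA -[wsum k.+1 F]/(\sum_a wsum k (fun u => F (a :: u))).
rewrite mulrCA mulr_sumr normrM normfV normr_nat.
have [A0|A0] := posnP #|A|; first by rewrite A0 invr0 mul0r.
rewrite ler_pdivrMl ?ltr0n //; apply: le_trans (ler_norm_sum _ _ _) _.
have -> : #|A|%:R * K%:C = \sum_(a : A) K%:C by rewrite sumr_const mulr_natl.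
by apply: ler_sum => a _; exact: IH.
Qed.

Lemma norm_word_trace u : (forall x l, `|Z x l| = 1) -> `|word_trace V Z u| <= N%:R.
Proof.
move=> Z1; apply: le_trans (ler_norm_sum _ _ _) _.
rewrite (eq_bigr (fun=> 1)); first by rewrite sumr_const ler_nat -[leqRHS]card_ord max_card.
move=> x _; apply: norm_phase => y [[[j s]|r]|[j s]] /=; rewrite ?Z1 //.
all: by case: s; rewrite ?norm_conjC Z1.
Qed.

(** The normalised traces of all powers are averages of traces of words, each at
    most [N] in modulus. *)
Lemma step_mx_eigenvalues_le1 v : (forall x l, `|Z x l| = 1) ->
  (forall k, ((\sum_i v i ^+ k)%:C = (#|A|%:R)^-1 ^+ k * wsum k (word_trace V Z))) ->
  forall i : 'I_N, `|v i| <= 1.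
Proof.
move=> Z1 hv; apply: even_traces_bound => k.
rewrite -lecR hv; apply: le_trans (real_ler_norm _) _.
  by rewrite -hv complex_real.
apply: norm_wsum => u.
by rewrite rmorph_nat; exact: norm_word_trace.
Qed.

End LetterMatrices.

Section RandomMatrix.
Local Open Scope complex_scope.
Local Open Scope ring_scope.
Variables (R : realType) (disp : measure_display) (Om : measurableType disp).
Variables (P : probability Om R) (d m r2 t : nat) (q : 'I_t -> nat) (N : nat).
Variable W : random_model P d m r2 q N.
Let A : finType := (letter d + lamp_letter m r2 t)%type.

Definition model_perm w (i : 'I_d) : 'S_N := rm_V W i w.

Definition model_value w (x : 'I_N) (l : lamp_coord m r2 t) : R[i] :=
  match l with
  | inl (inl j) => rm_Dm W j x w
  | inl (inr r) => (rm_Ds W r x w)%:C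
  | inr j => rm_Dt W j x w
  end.

Lemma model_value_real w x r :
  (model_value w x (inl (inr r)))^* = model_value w x (inl (inr r)).
Proof. exact: conjc_real. Qed.

Lemma card_letters : #|A| = (2 * d + 2 * m + 2 * t + r2)%N.
Proof. by rewrite !card_sum !card_prod card_bool !card_ord; lia. Qed.

Lemma random_matrixE w : random_matrix W w = step_mx (model_perm w) (model_value w).
Proof.
rewrite /random_matrix /step_mx card_letters; congr (_ *: _).
apply/matrixP => i j; rewrite !mxE !summxE !big_sumType /=.
have pairE (n : nat) (f : 'I_n * bool -> R[i]) :
   \sum_p f p = \sum_(k < n) (f (k, false) + f (k, true)).
  rewrite (eq_bigr (fun p => f (p.1, p.2))) => [|[]//].
  rewrite -(pair_bigA _ (fun k b => f (k, b))) /=; apply: eq_bigr => k _.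
  by rewrite big_bool addrC.
rewrite !pairE !addrA [RHS]addrAC; congr (_ + _ + _ + _);
  apply: eq_bigr => k _; rewrite !mxE /=.
- rewrite !mul1r rmorph_nat; congr (_ + (_ : bool)%:R).
  by rewrite /lperm /=; apply/idP/idP => /eqP <-; rewrite ?permK ?permKV.
- rewrite [j == i]eq_sym; have [->|_] := eqVneq i j; first by rewrite !mulr1n !mulr1.
  by rewrite !mulr0n !mulr0 rmorph0.
- rewrite [j == i]eq_sym; have [->|_] := eqVneq i j; first by rewrite !mulr1n !mulr1.
  by rewrite !mulr0n !mulr0 rmorph0.
- by rewrite [RHS]mulr_natr.
Qed.

Definition cmeasurable (f : Om -> R[i]) :=
  measurable_fun [set: Om] (fun w => complex.Re (f w)) /\
  measurable_fun [set: Om] (fun w => complex.Im (f w)).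

Lemma cmeasurable_cst c : cmeasurable (fun=> c).
Proof. by split; exact: measurable_cst. Qed.

Lemma cmeasurableD f g : cmeasurable f -> cmeasurable g -> cmeasurable (fun w => f w + g w).
Proof.
move=> [f1 f2] [g1 g2]; split.
  by under eq_fun do rewrite raddfD; exact: measurable_funD.
by under eq_fun do rewrite raddfD; exact: measurable_funD.
Qed.

Lemma cmeasurableM f g : cmeasurable f -> cmeasurable g -> cmeasurable (fun w => f w * g w).
Proof.
have eR (a b : R[i]) : complex.Re (a * b) =
    complex.Re a * complex.Re b - complex.Im a * complex.Im b by case: a b => [? ?] [? ?].
have eI (a b : R[i]) : complex.Im (a * b) =
    complex.Re a * complex.Im b + complex.Im a * complex.Re b by case: a b => [? ?] [? ?].
move=> [f1 f2] [g1 g2]; split.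
  by under eq_fun do rewrite eR; apply: measurable_funB; exact: measurable_funM.
by under eq_fun do rewrite eI; apply: measurable_funD; exact: measurable_funM.
Qed.

Lemma cmeasurable_conj f : cmeasurable f -> cmeasurable (fun w => (f w)^*).
Proof.
have eR (a : R[i]) : complex.Re (a^*) = complex.Re a by case: a.
have eI (a : R[i]) : complex.Im (a^*) = - complex.Im a by case: a.
move=> [f1 f2]; split; first by under eq_fun do rewrite eR.
under eq_fun do rewrite eI; exact: measurable_funN.
Qed.

Lemma cmeasurable_sum (I : Type) (s : seq I) (f : I -> Om -> R[i]) :
  (forall i, cmeasurable (f i)) -> cmeasurable (fun w => \sum_(i <- s) f i w).
Proof.
move=> mf; elim: s => [|i s IH].
  by under eq_fun do rewrite big_nil; exact: cmeasurable_cst.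
by under eq_fun do rewrite big_cons; exact: cmeasurableD.
Qed.

Lemma cmeasurable_bool (B : Om -> bool) : measurable [set w | B w] ->
  cmeasurable (fun w => (B w)%:R).
Proof.
move=> mB; have -> : (fun w => (B w)%:R : R[i]) = (fun w => (\1_[set w | B w] w)%:C).
  apply/funext => w; rewrite indicE; case Bw: (B w); first by rewrite mem_set.
  by rewrite memNset //= Bw.
by split; [exact: measurable_indic|exact: measurable_cst].
Qed.

Lemma cmeasurable_coords (f : Om -> R[i]) :
  measurable_fun [set: Om] (@coords R \o f) -> cmeasurable f.
Proof.
move=> mf; split.
  exact: (measurableT_comp measurable_fst mf).
exact: (measurableT_comp measurable_snd mf).
Qed.

Lemma measurable_model_perm i (B : set 'S_N) : measurable (rm_V W i @^-1` B).
Proof.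
rewrite (_ : _ @^-1` B = \bigcup_(s in B) (rm_V W i @^-1` [set s])).
  apply: fin_bigcup_measurable => [|s _]; first exact: finite_finset.
  by case: (rm_V_law W i s).
by apply/seteqP; split => [w Bw|w [s Bs /= ws]]; [exists (rm_V W i w)|rewrite /= ws].
Qed.

Lemma cmeasurable_letter_mx a i j :
  cmeasurable (fun w => letter_mx (model_perm w) (model_value w) a i j).
Proof.
under eq_fun do rewrite mxE; apply: cmeasurableM.
  case: a => [l|b] /=; first exact: cmeasurable_cst.
  case: b => [[[k s]|r]|[k s]] /=.
  - case: s; [apply: cmeasurable_conj|]; apply: cmeasurable_coords;
    by case: (rm_Dm_law W k i).
  - split; last exact: measurable_cst.
    by case: (rm_Ds_law W r i).
  - case: s; [apply: cmeasurable_conj|]; apply: cmeasurable_coords;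
    by case: (rm_Dt_law W k i).
case: a => [[k s]|b] /=; last exact: cmeasurable_cst.
apply: cmeasurable_bool.
pose B := [set V : 'S_N | is_true ((if s then V^-1 else V)%g i == j)].
by rewrite (_ : mkset _ = rm_V W k @^-1` B) //; exact: measurable_model_perm.
Qed.

Lemma cmeasurable_step_mx k i j :
  cmeasurable (fun w => (step_mx (model_perm w) (model_value w) ^+ k) i j).
Proof.
elim: k i j => [|k IH] i j.
  under eq_fun do rewrite expr0; exact: cmeasurable_cst.
under eq_fun do rewrite exprS -[_ * _ ^+ _]/(_ *m _) mxE.
apply: cmeasurable_sum => l; apply: cmeasurableM; last exact: IH.
under eq_fun do rewrite mxE summxE; apply: cmeasurableM; first exact: cmeasurable_cst.
by apply: cmeasurable_sum => a; exact: cmeasurable_letter_mx.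
Qed.

(** The entries are polynomials in the entries of the model. *)
Lemma measurable_trace k : measurable_fun [set: Om]
  (fun w => complex.Re (\tr (random_matrix W w ^+ k))).
Proof.
suff [] : cmeasurable (fun w => \tr (random_matrix W w ^+ k)) by [].
under eq_fun do rewrite random_matrixE /mxtrace.
by apply: cmeasurable_sum => i; exact: cmeasurable_step_mx.
Qed.

End RandomMatrix.

(** * Arcs of the unit circle *)

Section Arcs.
Local Open Scope complex_scope.
Local Open Scope ring_scope.
Variables (R : realType) (n : nat).
Hypothesis n_ge3 : (3 <= n)%N.
Let a (k : nat) : R := 2 * pi * k%:R / n%:R.
Let delta : R := 2 * pi / n%:R.

(** The half-open arc from angle [2 pi k / n] to [2 pi (k + 1) / n], cut out by two
    half-planes so that measurability is immediate; for [n >= 3] the angle is less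
    than [pi] and two half-planes suffice. *)
Definition circle_arc (k : nat) : set (R * R) :=
  [set p | [/\ p.1 ^+ 2 + p.2 ^+ 2 = 1, 0 <= p.2 * cos (a k) - p.1 * sin (a k)
             & 0 < p.1 * sin (a k.+1) - p.2 * cos (a k.+1)]].

Lemma arc_number_gt0 : 0 < n%:R :> R. Proof. by rewrite ltr0n; apply: leq_trans n_ge3. Qed.

Lemma arc_length_gt0 : 0 < delta. Proof. by rewrite divr_gt0 ?twopi_gt0 ?arc_number_gt0. Qed.

Lemma arc_length_lt_pi : delta < pi.
Proof.
rewrite ltr_pdivrMr ?arc_number_gt0 // mulrC ltr_pM2l ?pi_gt0 // ltr_nat //.
Qed.

Lemma circle_arc_end k : a k.+1 = a k + delta.
Proof. by rewrite /a /delta -natr1; ring. Qed.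

Lemma mem_circle_arc k x : 0 <= x < delta -> circle_arc k (coords (expi (a k + x))).
Proof.
move=> /andP[x0 xd]; split=> /=.
- exact: cos2Dsin2.
- rewrite (_ : _ - _ = sin x); first by apply: sin_ge0_pi; have := arc_length_lt_pi; lra.
  by rewrite -sinB; congr sin; ring.
- rewrite (_ : _ - _ = sin (delta - x)).
    by apply: sin_gt0_pi; have := arc_length_lt_pi; lra.
  by rewrite circle_arc_end [X in X - _]mulrC [X in _ - X]mulrC -sinB; congr sin; ring.
Qed.

(** The position on the arc is the arc cosine of the scalar product with the
    starting point. *)
Lemma circle_arcP k p : circle_arc k p -> exists2 x, 0 <= x < delta & p = coords (expi (a k + x)).
Proof.
case: p => u v [/= uv h1 h2].
(* the coordinates of the point in the frame turned by [a k] *)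
pose c := u * cos (a k) + v * sin (a k); pose s := v * cos (a k) - u * sin (a k).
have cs := cos2Dsin2 (a k).
have cs1 : c ^+ 2 + s ^+ 2 = 1.
  by rewrite -[RHS]mulr1 -{1}uv -cs /c /s; ring.
have c1 : -1 <= c <= 1.
  by rewrite -ler_norml -(@ler_pXn2r _ 2) ?nnegrE // real_normK ?num_real // expr1n -cs1 lerDl sqr_ge0.
have cosx : cos (acos c) = c by apply: acosK; rewrite in_itv.
have sinx : sin (acos c) = s.
  rewrite sin_acos // (_ : 1 - c ^+ 2 = s ^+ 2); last by rewrite -cs1; ring.
  by rewrite sqrtr_sqr ger0_norm.
have x0 := acos_ge0 c1; have xpi := acos_lepi c1.
have eu : u = cos (a k + acos c).
  rewrite cosD cosx sinx /c /s -[LHS]mulr1 -cs; ring.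
have ev : v = sin (a k + acos c).
  rewrite sinD cosx sinx /c /s -[LHS]mulr1 -cs; ring.
exists (acos c); last by rewrite /coords /= -eu -ev.
rewrite x0 /= ltNge; apply/negP => dx.
have : 0 <= sin (acos c - delta).
  by apply: sin_ge0_pi; have := arc_length_gt0; lra.
rewrite (_ : acos c - delta = (a k + acos c) - a k.+1); last by rewrite circle_arc_end; ring.
rewrite sinB -eu -ev; lra.
Qed.

Lemma circle_arc_disjoint k l p : (k < n)%N -> (l < n)%N -> circle_arc k p -> circle_arc l p -> k = l.
Proof.
move=> kn ln /circle_arcP[x /andP[x0 xd] ->] /circle_arcP[y /andP[y0 yd]] e.
have inj u v : u < v -> v < u + 2 * pi -> coords (expi u) = coords (expi v :> R[i]) -> False.
  move=> uv vu [ec es].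
  have h : 0 < v - u < 2 * pi by apply/andP; split; lra.
  have := expi_neq1 h; rewrite expiD.
  have -> : expi v = expi u :> R[i] by rewrite /expi ec es.
  by rewrite -expiD subrr expi0 eqxx.
have arange j z : (j < n)%N -> 0 <= z -> z < delta -> 0 <= a j + z < 2 * pi.
  move=> jn z0 zd; have a0 : 0 <= a j by rewrite divr_ge0 // mulr_ge0 // ltW // twopi_gt0.
  rewrite addr_ge0 //=; apply: (@lt_le_trans _ _ (a j.+1)); first by rewrite circle_arc_end ltrD2l.
  rewrite /a ler_pdivrMr ?arc_number_gt0 // ler_pM2l ?twopi_gt0 // ler_nat //.
have /andP[p0 p1] := arange _ _ kn x0 xd; have /andP[q0 q1] := arange _ _ ln y0 yd.
have exy : a k + x = a l + y.
  case: (ltgtP (a k + x) (a l + y)) => // h.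
    by case: (inj _ _ h) => //; lra.
  by case: (inj _ _ h) => //; lra.
have lt1 i j u v : a i + u = a j + v -> 0 <= u -> v < delta -> (i <= j)%N.
  move=> e1 u0 vd; rewrite -ltnS -(ltr_nat R).
  have : a i < a j.+1 by rewrite circle_arc_end; lra.
  by rewrite ltr_pM2r ?invr_gt0 ?arc_number_gt0 // ltr_pM2l ?twopi_gt0.
by apply/eqP; rewrite eqn_leq (lt1 _ _ _ _ exy x0 yd) (lt1 _ _ _ _ (esym exy) y0 xd).
Qed.

Lemma measurable_circle_arc k : measurable (circle_arc k).
Proof.
have m1 : measurable_fun [set: R * R] (fun p : R * R => p.1) by exact: measurable_fst.
have m2 : measurable_fun [set: R * R] (fun p : R * R => p.2) by exact: measurable_snd.
have mf : measurable_fun [set: R * R] (fun p : R * R => p.1 ^+ 2 + p.2 ^+ 2).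
  by apply: measurable_funD; apply: measurable_funX.
have mg : measurable_fun [set: R * R] (fun p : R * R => p.2 * cos (a k) - p.1 * sin (a k)).
  by apply: measurable_funB; apply: measurable_funM.
have mh : measurable_fun [set: R * R]
    (fun p : R * R => p.1 * sin (a k.+1) - p.2 * cos (a k.+1)).
  by apply: measurable_funB; apply: measurable_funM.
rewrite (_ : circle_arc k = (fun p => p.1 ^+ 2 + p.2 ^+ 2) @^-1` [set 1] `&`
   ((fun p => p.2 * cos (a k) - p.1 * sin (a k)) @^-1` `[0, +oo[ `&`
    (fun p => p.1 * sin (a k.+1) - p.2 * cos (a k.+1)) @^-1` `]0, +oo[)).
  apply: measurableI; last apply: measurableI.
  - by rewrite -[X in measurable X]setTI; apply: mf.
  - by rewrite -[X in measurable X]setTI; apply: mg.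
  - by rewrite -[X in measurable X]setTI; apply: mh.
apply/seteqP; split => [p [h1 h2 h3]|p [h1 []]] /=.
  by rewrite !in_itv /= h2 h3.
by rewrite !in_itv /= !andbT => h2 h3.
Qed.

(** A lower bound is all that is needed: see [good_event]. *)
Lemma uniform_circle_arc dO (Om : measurableType dO) (P : probability Om R)
    (Z : Om -> R[i]) k : (k < n)%N -> uniform_circle P Z ->
  ((n%:R^-1)%:E <= P ((@coords R \o Z) @^-1` circle_arc k))%E.
Proof.
move=> kn [_ ->]; last exact: measurable_circle_arc.
have mE : measurable [set x | circle_arc k (coords (expi x))].
  have mce : measurable_fun [set: R] (fun x : R => coords (expi x)).
    apply/measurable_fun_pairP; split.
      exact: continuous_measurable_fun (@continuous_cos R).
    exact: continuous_measurable_fun (@continuous_sin R).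
  rewrite -[X in measurable X]setTI; apply: mce => //; exact: measurable_circle_arc.
have mI : measurable (`[a k, a k.+1[%classic : set R) by exact: measurable_itv.
apply: (@le_trans _ _ (uniform_prob (twopi_gt0 R) `[a k, a k.+1[%classic)); last first.
  apply: le_measure; rewrite ?inE //.
  move=> x /=; rewrite in_itv /= circle_arc_end => /andP[x1 x2].
  rewrite (_ : x = a k + (x - a k)); last by ring.
  by apply: mem_circle_arc; apply/andP; split; lra.
have a0 : 0 <= a k by rewrite divr_ge0 // mulr_ge0 // ltW // twopi_gt0.
have a2 : a k.+1 <= 2 * pi.
  by rewrite /a ler_pdivrMr ?arc_number_gt0 // ler_pM2l ?twopi_gt0 // ler_nat.
rewrite /uniform_prob (eq_integral (fun=> ((2 * pi)^-1)%:E)); last first.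
  move=> x; rewrite inE /= in_itv /= => /andP[x1 x2].
  by rewrite /uniform_pdf subr0 (le_trans a0 x1) (le_trans (ltW x2) a2).
rewrite integral_cst //= lebesgue_measure_itv /= lte_fin.
rewrite circle_arc_end ltrDl arc_length_gt0 -EFinD -EFinM lee_fin addrAC subrr add0r /delta.
by rewrite mulrA mulVf ?mul1r // gt_eqF // twopi_gt0.
Qed.

End Arcs.

Section ArcDiameter.
Local Open Scope complex_scope.
Local Open Scope ring_scope.

(** Only the continuity of the cosine at [0] is used, through
    [|expi x - 1|^2 = 2 - 2 cos x]. *)
Lemma circle_arc_small (R : realType) (e : R) : 0 < e ->
  exists n0, forall n k (z : R[i]), (n0 <= n)%N -> circle_arc n k (coords z) ->
    `|z - zeta R n ^+ k| <= e%:C.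
Proof.
move=> e0.
have : \forall x \near (0 : R), `|cos 0 - cos x| < e ^+ 2 / 2.
  have := @continuous_cos R 0; move/cvgrPdist_lt; apply.
  by rewrite divr_gt0 // exprn_gt0.
move=> /nbhs_ballP [r /= r0 hr].
exists (maxn 3 (Num.truncn (2 * pi / r)).+1) => n k z; rewrite geq_max => /andP[n_ge3 nr].
move=> /(circle_arcP n_ge3)[x /andP[x0 xd] ez].
have {ez} -> : z = expi (2 * pi * k%:R / n%:R + x).
  by move: ez; case: z => u v [-> ->].
have -> : zeta R n ^+ k = expi (2 * pi * k%:R / n%:R).
  by rewrite zetaX; congr expi; ring.
rewrite expiD -[X in _ - X]mulr1 -mulrBr normrM norm_expi mul1r.
rewrite -(@ler_pXn2r _ 2) ?nnegrE ?normr_ge0 ?ler0c ?(ltW e0) //.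
have -> : `|expi x - 1| ^+ 2 = (2 - 2 * cos x)%:C.
  rewrite -add_Re2_Im2 /=; congr (_%:C); rewrite oppr0 addr0.
  have := cos2Dsin2 x; move: (cos x) (sin x) => c s h.
  by rewrite (_ : 2 - _ = 1 + 1 - 2 * c); [rewrite -{2}h; ring|ring].
rewrite -rmorphXn lecR.
have xr : ball (0 : R) r x.
  rewrite /ball /= sub0r normrN ger0_norm //; apply: lt_trans xd _.
  rewrite ltr_pdivrMr ?ltr0n ?(leq_trans _ n_ge3) // [X in _ < X]mulrC -ltr_pdivrMr //.
  by apply: lt_le_trans (truncnS_gt _) _; rewrite ler_nat.
have := hr _ xr; rewrite /= cos0 => h.
have := ler_norm (1 - cos x); lra.
Qed.

End ArcDiameter.

(** * Concentration of the traces of words *)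

Section GoodEvent.
Local Open Scope complex_scope.
Local Open Scope ring_scope.
Variables (R : realType) (disp : measure_display) (Om : measurableType disp).
Variables (P : probability Om R) (d m r2 t : nat) (q : 'I_t -> nat).
Hypothesis hq : forall j, (3 <= q j)%N.
Variables (N M : nat).
Hypothesis M3 : (3 <= M)%N.
Variable W : random_model P d m r2 q N.
Let I : finType := model_index d m r2 t N.
Let Dt : finType := ({ffun 'I_d -> 'S_N} * lamp_data m r2 q N M)%type.

(** The constraint on the variable of index [i] that makes the discrete data of the
    sample equal to [x]. *)
Definition data_cell (x : Dt) (i : I) : set Om :=
  match i with
  | inl (inl (inl i)) => rm_V W i @^-1` [set x.1 i]
  | inl (inl (inr (j, a))) => (@coords R \o rm_Dm W j a) @^-1` circle_arc M (x.2 (a, inl (inl j)))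
  | inl (inr (r, a)) => rm_Ds W r a @^-1` [set (-1) ^+ x.2 (a, inl (inr r))]
  | inr (j, a) => rm_Dt W j a @^-1` [set zeta R (q j) ^+ x.2 (a, inr j)]
  end.

Definition cell_card (i : I) : nat :=
  match i with
  | inl (inl (inl i)) => N`!
  | inl (inl (inr (j, a))) => M
  | inl (inr (r, a)) => 2
  | inr (j, a) => q j
  end.

Definition data_event (x : Dt) : set Om := \bigcap_(i in [set` [set: I]%SET]) data_cell x i.

Lemma cell_card_prod : (\prod_i cell_card i = #|Dt|)%N.
Proof.
rewrite card_prod card_ffun card_Sn card_ord.
have -> : #|{: lamp_data m r2 q N M}| = (\prod_(p : 'I_N * lamp_coord m r2 t) lamp_mod q M p.2)%N.
  rewrite card_dep_ffun foldrE big_map big_enum /=.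
  by apply: eq_bigr => p _; rewrite card_ord.
rewrite !big_sumType /= prod_nat_const card_ord -!mulnA; congr (_ * _)%N.
rewrite -(pair_bigA _ (fun _ l => lamp_mod q M l)) /= exchange_big /= !big_sumType /= -!mulnA.
have pairE n (F : 'I_n -> nat) (G : 'I_n * 'I_N -> nat) : (forall p, G p = F p.1) ->
    (\prod_p G p = \prod_(j < n) \prod_(a < N) F j)%N.
  move=> e; rewrite (eq_bigr (fun p => F p.1)) => [|p _]; last exact: e.
  by rewrite -(pair_bigA _ (fun j _ => F j)).
by congr (_ * (_ * _))%N; apply: pairE => -[].
Qed.

Lemma card_data_gt0 : (0 < #|Dt|)%N.
Proof.
rewrite -cell_card_prod; apply: prodn_gt0 => -[[[i|[j a]]|[r a]]|[j a]] //=.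
- exact: fact_gt0.
- exact: leq_trans M3.
- exact: leq_trans (hq j).
Qed.

Lemma data_cell_sigma x i : model_sigma (rm_V W) (rm_Dm W) (rm_Ds W) (rm_Dt W) i (data_cell x i).
Proof.
case: i => [[[i|[j a]]|[r a]]|[j a]] /=.
- by exists [set x.1 i].
- by exists (circle_arc M (x.2 (a, inl (inl j)))); [exact: measurable_circle_arc|].
- by exists [set ((-1) ^+ x.2 (a, inl (inr r)) : R)]; [exact: measurable_set1|].
- exists [set coords (zeta R (q j) ^+ x.2 (a, inr j))].
    set c := coords _; rewrite /= (_ : [set c] = [set c.1] `*` [set c.2]).
      by apply: measurableX; exact: measurable_set1.
    by case: c => u v; apply/seteqP; split => [[u' v'] [-> ->]|[u' v'] /= [-> ->]].
  by apply/seteqP; split => w /= => [|->] //; case: (rm_Dt W j a w) => u v;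
    case: (_ ^+ _) => u' v' [-> ->].
Qed.

Lemma data_cell_measurable x i : measurable (data_cell x i).
Proof.
case: i => [[[i|[j a]]|[r a]]|[j a]] /=.
- exact: measurable_model_perm.
- have [mZ _] := rm_Dm_law W j a; rewrite -[X in measurable X]setTI.
  by apply: mZ => //; exact: measurable_circle_arc.
- have [mZ _] := rm_Ds_law W r a; rewrite -[X in measurable X]setTI.
  exact: mZ.
- have [mZ _] := rm_Dt_law W j a.
  have [B mB /= <-] := data_cell_sigma x (inr (j, a)); rewrite -[X in measurable X]setTI.
  exact: mZ.
Qed.

Lemma data_event_measurable x : measurable (data_event x).
Proof.
apply: fin_bigcap_measurable => [|i _]; first exact: finite_finset.
exact: data_cell_measurable.
Qed.

Lemma data_cell_prob x i : (((cell_card i)%:R^-1 : R)%:E <= P (data_cell x i))%E.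
Proof.
case: i => [[[i|[j a]]|[r a]]|[j a]] /=.
- by have [_ ->] := rm_V_law W i (x.1 i).
- exact: (uniform_circle_arc M3 (ltn_ord _) (rm_Dm_law W j a)).
- have [_ ->] := rm_Ds_law W r a; first by rewrite lexx.
  have := ltn_ord (x.2 (a, inl (inr r))); rewrite /=.
  by case: (nat_of_ord _) => [|[|]] //= _; [left|right]; rewrite ?expr0 ?expr1.
- have [_ h] := rm_Dt_law W j a.
  have [k0|k0] := posnP (x.2 (a, inr j)); last first.
    by rewrite zetaX h // k0 /=; apply: ltnW; exact: (ltn_ord (x.2 (a, inr j))).
  rewrite k0 expr0 -(@zetaXn R (q j)) ?zetaX ?h ?leqnn ?andbT //;
    exact: leq_trans (hq j).
Qed.

(** By independence; the numbers of cells multiply to the number of data. *)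
Lemma data_event_prob x : (((#|Dt|%:R)^-1 : R)%:E <= P (data_event x))%E.
Proof.
have indep : mutually_independent P (model_sigma (rm_V W) (rm_Dm W) (rm_Ds W) (rm_Dt W)).
  exact: rm_indep.
rewrite (indep [set: I]%SET (data_cell x) (fun i _ => data_cell_sigma x i)).
have -> : (#|Dt|%:R)^-1 = \prod_(i in [set: I]%SET) (cell_card i)%:R^-1 :> R.
  by rewrite -cell_card_prod natr_prod -prodfV; apply: eq_bigl => i; rewrite inE.
pose K (a : R) (b : \bar R) := 0 <= a /\ (a%:E <= b)%E.
suff [] : K (\prod_(i in [set: I]%SET) (cell_card i)%:R^-1)
   (\prod_(i in [set: I]%SET) P (data_cell x i))%E by [].
apply: big_ind2 => [|a b c e [a0 ab] [c0 ce]|i _]; split => //.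
- by rewrite mulr_ge0.
- by rewrite EFinM; apply: lee_pmul; rewrite ?lee_fin.
- exact: data_cell_prob.
Qed.

Lemma data_event_disjoint x y w : data_event x w -> data_event y w -> x = y.
Proof.
move=> ex ey.
have cx i : data_cell x i w by apply: ex; rewrite /= inE.
have cy i : data_cell y i w by apply: ey; rewrite /= inE.
have zinj n (k l : 'I_n) : zeta R n ^+ k = zeta R n ^+ l -> k = l.
  wlog kl : k l / (k <= l)%N.
    by move=> h e; case: (leqP k l) => [/h|/ltnW/h h']; [exact|symmetry; exact: h'].
  move=> e; apply/val_inj/eqP; rewrite eqn_leq kl /= leqNgt; apply/negP => lk.
  have : zeta R n ^+ (l - k) != 1.
    by apply: zetaX_neq1; rewrite subn_gt0 lk (leq_ltn_trans (leq_subr _ _)).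
  have n0 : zeta R n ^+ k != 0 by rewrite expf_neq0 // zeta_neq0.
  by rewrite -(inj_eq (mulfI n0)) -exprD subnKC // -e mulr1 eqxx.
case: x y cx cy {ex ey} => [V k] [V' k'] cx cy; congr pair.
  apply/ffunP => i; have := cx (inl (inl (inl i))); have := cy (inl (inl (inl i))).
  by rewrite /= => -> ->.
apply/ffunP => -[a [[j|r]|j]].
- apply/val_inj; apply: (circle_arc_disjoint M3 (ltn_ord _) (ltn_ord _)).
    exact: (cx (inl (inl (inr (j, a))))).
  exact: (cy (inl (inl (inr (j, a))))).
- have := cx (inl (inr (r, a))); have := cy (inl (inr (r, a))); rewrite /= => ->.
  move=> e; apply: zinj; rewrite /= zeta2.
  have := congr1 (fun z : R => z%:C) e.
  by rewrite !rmorphXn rmorphN1 => ->.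
- have := cx (inr (j, a)); have := cy (inr (j, a)); rewrite /= => -> e.
  exact/zinj/esym.
Qed.

(** The events of the data are disjoint and each has probability at least the
    inverse of their number.  So a property of most data holds off a set whose
    probability is at most the proportion of exceptions; the values outside all
    cells, allowed with probability zero, belong to this set. *)
Lemma good_event (good : pred Dt) : exists B : set Om,
  [/\ measurable B, (P B <= (#|[pred x | ~~ good x]|%:R / #|Dt|%:R)%:E)%E
    & forall w, ~ B w -> exists2 x, good x & data_event x w].
Proof.
pose F x := if good x then data_event x else set0.
have mF x : measurable (F x) by rewrite /F; case: ifP => _ //; exact: data_event_measurable.
have mU : measurable (\bigcup_(x in [set: Dt]) F x).
  by apply: fin_bigcup_measurable => //; exact: finite_finset.
exists (~` \bigcup_(x in [set: Dt]) F x); split; first exact: measurableC.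
  rewrite probability_setC // measure_fin_bigcup //; last 2 first.
  - exact: finite_finset.
  - apply/trivIsetP => x y _ _ /eqP xy; rewrite /F.
    case: ifP => _; last by rewrite set0I.
    case: ifP => _; last by rewrite setI0.
    apply/seteqP; split => // w [ex ey]; exact: xy (data_event_disjoint ex ey).
  have le : (((#|[pred x | good x]|%:R / #|Dt|%:R) : R)%:E <= \sum_(x \in [set: Dt]) P (F x))%E.
    rewrite (_ : [set: Dt] = [set` index_enum Dt]); last first.
      by apply/seteqP; split => // x _; rewrite /= mem_index_enum.
    rewrite -fsbig_seq ?index_enum_uniq // -sum1_card natr_sum mulr_suml big_mkcond /= -sumEFin.
    apply: lee_sum => x _; rewrite inE /F; case: ifP => _; last by rewrite measure0.
    by rewrite mul1r; exact: data_event_prob.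
  have -> : (#|[pred x | ~~ good x]|%:R / #|Dt|%:R : R) = 1 - #|[pred x | good x]|%:R / #|Dt|%:R.
    have T0 : (#|Dt|%:R : R) != 0 by rewrite pnatr_eq0 -lt0n card_data_gt0.
    rewrite -(cardC [pred x | good x]) natrD in T0 *.
    have -> : #|[predC [pred x | good x]]| = #|[pred x | ~~ good x]| by apply: eq_card.
    by field.
  by rewrite EFinB; apply: leeB.
move=> w nB; have [x _ Fx] : (\bigcup_(x in [set: Dt]) F x) w by apply: contrapT.
by move: Fx; rewrite /F; case: ifP => // gx ex; exists x.
Qed.

Lemma data_event_cell x w i : data_event x w -> data_cell x i w.
Proof. by move=> ex; apply: ex; rewrite /= inE. Qed.

Lemma data_event_perm x w : data_event x w -> model_perm W w = x.1 :> ('I_d -> 'S_N).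
Proof.
by move=> ex; apply/funext => i; exact: (@data_event_cell x w (inl (inl (inl i))) ex).
Qed.

(** Inside an event the sample satisfies the relations of the dual exactly, not only
    up to the size of the arcs. *)
Lemma data_event_dual x w c : data_event x w -> dual q (model_value W w c).
Proof.
move=> ex.
have hr r : rm_Ds W r c w = (-1) ^+ x.2 (c, inl (inr r)).
  exact: (@data_event_cell x w (inl (inr (r, c))) ex).
have ht j : rm_Dt W j c w = zeta R (q j) ^+ x.2 (c, inr j).
  exact: (@data_event_cell x w (inr (j, c)) ex).
have hm j := @data_event_cell x w (inl (inl (inr (j, c)))) ex.
split=> [[[j|r]|j]|r|j] /=.
- have [y _ e] := circle_arcP M3 (hm j).
  have -> : rm_Dm W j c w = expi (2 * pi * (x.2 (c, inl (inl j)))%:R / M%:R + y).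
    by move: e; rewrite /=; case: (rm_Dm W j c w) => u v [-> ->].
  exact: norm_expi.
- by rewrite hr rmorphXn rmorphN1 normrX normrN1 expr1n.
- by rewrite ht normrX norm_zeta expr1n.
- by rewrite hr -rmorphXn -exprM mulnC exprM sqrrN expr1n expr1n.
- by rewrite ht -exprM mulnC exprM zetaXn ?expr1n // (leq_trans _ (hq j)).
Qed.

Lemma data_event_close x w (e : R[i]) : 0 <= e ->
  (forall k z, circle_arc M k (coords z) -> `|z - zeta R M ^+ k| <= e) ->
  data_event x w -> forall c l, `|model_value W w c l - data_value R x.2 c l| <= e.
Proof.
move=> e0 he ex c [[j|r]|j] /=; rewrite /data_value /=.
- apply: he; exact: (@data_event_cell x w (inl (inl (inr (j, c)))) ex).
- have -> : rm_Ds W r c w = (-1) ^+ x.2 (c, inl (inr r)).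
    exact: (@data_event_cell x w (inl (inr (r, c))) ex).
  by rewrite zeta2 rmorphXn rmorphN1 subrr normr0.
- have -> : rm_Dt W j c w = zeta R (q j) ^+ x.2 (c, inr j).
    exact: (@data_event_cell x w (inr (j, c)) ex).
  by rewrite subrr normr0.
Qed.

End GoodEvent.

Section Perturbation.
Local Open Scope complex_scope.
Local Open Scope ring_scope.
Variables (R : realType) (d m r2 t N : nat) (V : 'I_d -> 'S_N).
Variables (Z Z' : 'I_N -> lamp_coord m r2 t -> R[i]) (e : R[i]).
Hypothesis Z1 : forall x l, `|Z x l| = 1.
Hypothesis Z'1 : forall x l, `|Z' x l| = 1.
Hypothesis ZZ' : forall x l, `|Z x l - Z' x l| <= e.

Lemma letter_value1 (Y : 'I_N -> lamp_coord m r2 t -> R[i]) x b :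
  (forall x l, `|Y x l| = 1) -> `|letter_value (Y x) b| = 1.
Proof. by move=> Y1; case: b => [[[j []]|r]|[j []]] /=; rewrite ?norm_conjC Y1. Qed.

(** Telescoping products of numbers of modulus one. *)
Lemma phase_close x u : 0 <= e ->
  `|phase V (fun x => letter_value (Z x)) x u -
    phase V (fun x => letter_value (Z' x)) x u| <= (size u)%:R * e.
Proof.
move=> e0; elim: u x => [|a u IH] x /=; first by rewrite subrr normr0 mul0r.
set w := weight _ _ _; set w' := weight _ _ _; set p := phase _ _ _ _; set p' := phase _ _ _ _.
have we : `|w - w'| <= e.
  rewrite /w /w'; case: a {w w' p p' IH} => [l|b] /=; first by rewrite subrr normr0.
  by case: b => [[[j []]|r]|[j []]] /=; rewrite -?rmorphB ?norm_conjC; exact: ZZ'.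
have w1 : `|w| = 1.
  by rewrite /w; case: a {w w' p p' IH we} => [l|b] /=; rewrite ?normr1 ?letter_value1.
have p1 : `|p'| = 1.
  by apply: norm_phase => y b; exact: letter_value1.
have -> : w * p - w' * p' = w * (p - p') + (w - w') * p' by ring.
apply: le_trans (ler_normD _ _) _; rewrite !normrM w1 p1 mul1r mulr1.
by rewrite -natr1 mulrDl mul1r; apply: lerD => //; exact: IH.
Qed.

Lemma word_trace_close u : 0 <= e ->
  `|word_trace V Z u - word_trace V Z' u| <= N%:R * ((size u)%:R * e).
Proof.
move=> e0; rewrite /word_trace -sumrB; apply: le_trans (ler_norm_sum _ _ _) _.
have -> : N%:R * ((size u)%:R * e) = \sum_(x < N) (size u)%:R * e.
  by rewrite sumr_const card_ord mulr_natl.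
rewrite big_mkcond; apply: ler_sum => x _; case: ifP => _; first exact: phase_close.
by rewrite mulr_ge0.
Qed.

End Perturbation.

Section WordTraceConcentration.
Local Open Scope complex_scope.
Local Open Scope ring_scope.
Variables (R : realType) (d m r2 t : nat) (q : 'I_t -> nat).
Hypothesis hq : forall j, (3 <= q j)%N.
Let A := (letter d + lamp_letter m r2 t)%type.
Let lam := @lamp_of_letter m r2 t q.

(** Chebyshev inequality in the discrete model, with half of [eta] left for the
    error of discretisation. *)
Lemma word_trace_concentration (u : seq A) (eta delta : R) :
  wr_word lam u != 1%g -> 0 < eta -> 0 < delta ->
  exists N0, forall N disp (Om : measurableType disp) (P : probability Om R)
    (W : random_model P d m r2 q N), (N0 <= N)%N ->
  exists B : set Om, [/\ measurable B, (P B <= delta%:E)%E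
    & forall w, ~ B w ->
      `|word_trace (model_perm W w) (model_value W w) u| <= (eta * N%:R)%:C].
Proof.
move=> u1 eta0 delta0.
have [K0 [C0 [M0 moment]]] := @word_trace_second_moment R d m r2 t q hq u u1.
(* the size of the arcs: a word of length [l] amplifies it at most [l] times *)
pose eps := eta / 2 / (size u).+1%:R.
have eps0 : 0 < eps by rewrite !divr_gt0.
have [n0 close] := circle_arc_small eps0.
pose M := maxn 3 (maxn M0 n0).
have M3 : (3 <= M)%N by rewrite leq_maxl.
have MM0 : (M0 <= M)%N by rewrite /M leq_max leq_max leqnn orbT.
have Mn0 : (n0 <= M)%N by rewrite /M !leq_max leqnn !orbT.
(* as soon as [N - K0 > c] the Chebyshev bound is below [delta] *)
pose c : R := 4 * C0%:R / eta ^+ 2 / delta.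
exists (K0 + (Num.truncn c).+1)%N => N disp Om P W NN0.
have NK : c < (N - K0)%:R.
  by apply: lt_le_trans (truncnS_gt _) _; rewrite ler_nat leq_subRL // (leq_trans _ NN0) // leq_addr.
have c0 : 0 <= c by rewrite !mulr_ge0 ?invr_ge0 ?exprn_ge0 // ltW.
have NK0 : (0 : R) < (N - K0)%:R by exact: le_lt_trans c0 NK.
have N0' : (0 : R) < N%:R.
  by apply: lt_le_trans NK0 _; rewrite ler_nat leq_subr.
pose a : R := eta / 2 * N%:R.
have a0 : 0 < a by rewrite mulr_gt0 ?divr_gt0.
pose Dt : finType := ({ffun 'I_d -> 'S_N} * lamp_data m r2 q N M)%type.
pose wt (x : Dt) : R[i] := word_trace x.1 (data_value R x.2) u.
pose good (x : Dt) := `|wt x| <= a%:C.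
have [B [mB PB Bgood]] := @good_event R disp Om P d m r2 t q hq N M M3 W good.
exists B; split=> //; last first.
  move=> w /Bgood[x gx ex]; rewrite (data_event_perm ex).
  have close' k (z : R[i]) : circle_arc M k (coords z) -> `|z - zeta R M ^+ k| <= eps%:C.
    exact: close.
  have e0 : 0 <= eps%:C :> R[i] by rewrite ler0c ltW.
  have v1 y l : `|model_value W w y l| = 1 by exact: (dual_norm (data_event_dual hq M3 y ex)).
  have v1' y l : `|data_value R x.2 y l| = 1.
    exact: (dual_norm (data_value_dual R hq x.2 y)).
  have := @word_trace_close R d m r2 t N x.1 _ _ _ v1 v1' (data_event_close e0 close' ex) u e0.
  move=> cl; rewrite -(subrK (wt x) (word_trace _ _ _)).
  apply: le_trans (ler_normD _ _) _.
  have -> : (eta * N%:R)%:C = (N%:R * (eta / 2))%:C + a%:C :> R[i].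
    by rewrite -rmorphD; congr (_%:C); rewrite /a; field.
  apply: lerD gx; apply: le_trans cl _.
  rewrite -!(rmorph_nat (real_complex R)) -!rmorphM lecR ler_pM2l //.
  rewrite /eps mulrCA ler_piMr ?divr_ge0 ?(ltW eta0) //.
  by rewrite ler_pdivrMr // mul1r ler_nat.
apply: le_trans PB _; rewrite lee_fin.
have T0 : (0 : R) < #|Dt|%:R by rewrite ltr0n; exact: card_data_gt0.
have main : (N - K0)%:R * (#|[pred x | ~~ good x]|%:R * a ^+ 2) <= C0%:R * N%:R ^+ 2 * #|Dt|%:R :> R.
  rewrite -lecR; apply: (@le_trans _ _ ((N - K0)%:R *
     (\sum_(V : {ffun 'I_d -> 'S_N}) \sum_(k : lamp_data m r2 q N M)
      `|word_trace V (data_value R k) u| ^+ 2))).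
    rewrite rmorphM rmorph_nat; apply: ler_wpM2l => //.
    rewrite pair_bigA /= (bigID good) /= rmorphM rmorph_nat mulr_natl -sumr_const.
    rewrite -[leLHS]add0r; apply: lerD; first by apply: sumr_ge0 => x _; rewrite exprn_ge0.
    rewrite [leLHS](eq_bigl (fun x => ~~ good x)) //; apply: ler_sum => x nx.
    rewrite rmorphXn lerXn2r ?nnegrE ?normr_ge0 ?ler0c ?(ltW a0) //.
    move: nx; rewrite /good -real_ltNge ?normr_real ?complex_real //.
    exact: ltW.
  apply: le_trans (moment N M MM0) _; rewrite -card_prod.
  by rewrite -natrX -!natrM rmorph_nat.
rewrite ler_pdivrMr //.
set b := #|[pred x | ~~ good x]|%:R in main *.
have b0 : 0 <= b by rewrite ler0n.
have : c * (b * a ^+ 2) <= C0%:R * N%:R ^+ 2 * #|Dt|%:R.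
  by apply: le_trans main; rewrite ler_wpM2r ?(ltW NK) // mulr_ge0 // exprn_ge0 // ltW.
have [C00|C00] := eqVneq C0 0%N.
  move: main; rewrite C00 !mul0r => main _.
  have -> : b = 0.
    apply/eqP; rewrite eq_le b0 andbT -(@pmulr_rle0 _ (a ^+ 2)) ?exprn_gt0 // mulrC.
    by rewrite -(@pmulr_rle0 _ (N - K0)%:R).
  by rewrite mulr_ge0 // ltW.
have C0p : (0 : R) < C0%:R by rewrite ltr0n lt0n.
have -> : c * (b * a ^+ 2) = (C0%:R * N%:R ^+ 2) * (b / delta).
  by rewrite /c /a; field; rewrite !gt_eqF.
rewrite ler_pM2l ?mulr_gt0 ?exprn_gt0 // ler_pdivrMr // mulrC //.
Qed.

End WordTraceConcentration.

(** * The Weierstrass approximation theorem *)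

Section Weierstrass.
Variable R : realType.
Implicit Types (f g phi psi : nat -> R) (y c : R).

(** The Bernstein operator: [(bern n phi).[y]] is the expectation of [phi] at a
    binomial variable of parameters [n] and [y].  The recursion conditions on the
    first trial, which avoids binomial coefficients. *)
Fixpoint bern (n : nat) phi : {poly R} :=
  if n is n'.+1 then 'X * bern n' (phi \o succn) + (1 - 'X) * bern n' phi
  else (phi 0%N)%:P.

Lemma bernS n phi y :
  (bern n.+1 phi).[y] = y * (bern n (phi \o succn)).[y] + (1 - y) * (bern n phi).[y].
Proof. by rewrite /= !hornerE. Qed.

Lemma bern_ge0 n phi y : 0 <= y <= 1 -> (forall k, (k <= n)%N -> 0 <= phi k) ->
  0 <= (bern n phi).[y].
Proof.
move=> /andP[y0 y1]; elim: n phi => [|n IH] phi p0; first by rewrite hornerC p0.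
rewrite bernS addr_ge0 // mulr_ge0 ?subr_ge0 // IH // => k kn; apply: p0 => //.
exact: leqW.
Qed.

Lemma bern_lin n a phi psi y :
  (bern n (fun k => a * phi k + psi k)).[y] = a * (bern n phi).[y] + (bern n psi).[y].
Proof.
elim: n phi psi => [|n IH] phi psi; first by rewrite !hornerC.
rewrite !bernS -[X in bern n X](_ : (fun k => a * (phi \o succn) k + (psi \o succn) k) = _) //.
by rewrite !IH; ring.
Qed.

Lemma bern_cst n a y : (bern n (fun=> a)).[y] = a.
Proof.
elim: n => [|n IH]; first by rewrite hornerC.
by rewrite bernS -[X in bern n X]/(fun=> a) IH; ring.
Qed.

(** The variance of the binomial law, around an arbitrary point [c] to let the
    induction go through. *)
Lemma bern_sqr n c y : (bern n (fun k => (k%:R - c) ^+ 2)).[y] =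
  n%:R * y * (1 - y) + (n%:R * y - c) ^+ 2.
Proof.
elim: n c => [|n IH] c; first by rewrite hornerC; ring.
rewrite bernS IH -[X in bern n X](_ : (fun k => (k%:R - (c - 1)) ^+ 2) = _); last first.
  by apply/funext => k /=; rewrite -natr1; ring.
by rewrite IH -natr1; ring.
Qed.

Lemma bern_le n phi psi y : 0 <= y <= 1 -> (forall k, (k <= n)%N -> phi k <= psi k) ->
  (bern n phi).[y] <= (bern n psi).[y].
Proof.
move=> y01 pp; rewrite -subr_ge0.
have -> : (bern n psi).[y] - (bern n phi).[y] = (bern n (fun k => -1 * phi k + psi k)).[y].
  by rewrite bern_lin; ring.
by apply: bern_ge0 => // k kn; rewrite mulN1r addrC subr_ge0 pp.
Qed.

(** Compactness in the form of near coverings, with the radius tending to [0] as the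
    auxiliary parameter. *)
Lemma segment_unif_continuous (f : R -> R) a b e : continuous f -> 0 < e ->
  exists2 r, 0 < r & forall x y, a <= x <= b -> `|x - y| < r -> `|f x - f y| < e.
Proof.
move=> cf e0.
have := @segment_compact R a b => /compact_near_coveringP.
move=> /(_ _ (0 : R)^'+ (fun r x => forall y, `|x - y| < r -> `|f x - f y| < e)) nc.
have H : forall x, `[a, b]%classic x ->
   \forall x' \near x & r \near (0 : R)^'+, forall y, `|x' - y| < r -> `|f x' - f y| < e.
  move=> x _; have /cvgrPdist_lt/(_ (e / 2)) := cf x.
  rewrite divr_gt0 // => /(_ isT) /nbhs_ballP[s /= s0 hs].
  exists (ball x (s / 2), [set r | r < s / 2]).
    split => /=; first by apply: nbhsx_ballx; rewrite divr_gt0.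
    by apply: nbhs_right_lt; rewrite divr_gt0.
  move=> [x' r] /= [xx' rs] y xy.
  have {}xx' : `|x - x'| < s / 2 by [].
  have b1 : `|x - x'| < s by lra.
  have b2 : `|x - y| < s.
    have -> : x - y = (x - x') + (x' - y) by ring.
    by apply: le_lt_trans (ler_normD _ _) _; lra.
  have := hs _ b1; have := hs _ b2; rewrite /= => h2 h1.
  have -> : f x' - f y = - (f x - f x') + (f x - f y) by ring.
  by apply: le_lt_trans (ler_normD _ _) _; rewrite normrN; lra.
have {}nc := nc _ H.
have : \forall r \near (0 : R)^'+, 0 < r /\
   (`[a, b]%classic `<=` [set x | forall y, `|x - y| < r -> `|f x - f y| < e]).
  by near=> r; split; [near: r; exact: nbhs_right_gt|near: r; exact: nc].
move=> /filter_ex[r [r0 hr]]; exists r => // x y xab.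
by apply: hr; rewrite /= in_itv.
Unshelve. all: by end_near.
Qed.

(** Bernstein: transported to [[0, 1]], the deviation is at most [e / 2] near [y]
    and at most [2 K] elsewhere, where the square of the distance pays for it. *)
Theorem weierstrass (f : R -> R) (K a e : R) : continuous f -> (forall x, `|f x| <= K) ->
  0 < a -> 0 < e ->
  exists p : {poly R}, forall x, `|x| <= a -> `|p.[x] - f x| <= e.
Proof.
move=> cf fK a0 e0.
have [r r0 hr] := segment_unif_continuous (- a) a cf (divr_gt0 e0 (ltr0n _ 2)).
pose s := r / (2 * a); have s0 : 0 < s by rewrite divr_gt0 // mulr_gt0.
have K0 : 0 <= K := le_trans (normr_ge0 _) (fK 0).
pose g y := f (a * (2 * y - 1)).
have gK y : `|g y| <= K by exact: fK.
have gs x y : 0 <= x <= 1 -> `|x - y| < s -> `|g x - g y| < e / 2.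
  move=> /andP[x0 x1] xy; apply: hr.
    by apply/andP; split; nra.
  rewrite (_ : _ - _ = (2 * a) * (x - y)); last by ring.
  rewrite normrM ger0_norm ?mulr_ge0 ?(ltW a0) // mulrC -ltr_pdivlMr //.
  by rewrite mulr_gt0.
pose L := 2 * K / s ^+ 2.
have L0 : 0 <= L by rewrite divr_ge0 ?exprn_ge0 ?(ltW s0) // mulr_ge0.
pose n := (Num.truncn (2 * L / e)).+1.
have n0 : (0 : R) < n%:R by rewrite ltr0n.
have Ln : L / n%:R <= e / 2.
  have h : 2 * L <= n%:R * e by rewrite -ler_pdivrMr //; apply: ltW; exact: truncnS_gt.
  by rewrite ler_pdivrMr //; lra.
pose q := bern n (fun k => g (k%:R / n%:R)).
have qg y : 0 <= y <= 1 -> `|q.[y] - g y| <= e.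
  move=> y01; have /andP[y0 y1] := y01.
  have dev k : (k <= n)%N -> `|g (k%:R / n%:R) - g y| <=
      (L / n%:R ^+ 2) * (k%:R - n%:R * y) ^+ 2 + e / 2.
    move=> kn.
    have kn01 : 0 <= (k%:R / n%:R : R) <= 1.
      by rewrite divr_ge0 ?ler0n //= ler_pdivrMr // mul1r ler_nat.
    have sq0 : 0 <= (L / n%:R ^+ 2) * (k%:R - n%:R * y) ^+ 2.
      by rewrite mulr_ge0 ?sqr_ge0 // divr_ge0 // exprn_ge0 // ltW.
    have [near|far] := ltP `|k%:R / n%:R - y| s.
      apply: le_trans (ltW (gs _ _ kn01 near)) _; lra.
    apply: (@le_trans _ _ (2 * K)).
      apply: le_trans (ler_normB _ _) _; have := gK (k%:R / n%:R); have := gK y; lra.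
    have -> : (L / n%:R ^+ 2) * (k%:R - n%:R * y) ^+ 2 =
        2 * K * ((k%:R / n%:R - y) ^+ 2 / s ^+ 2).
      by rewrite /L; field; rewrite !gt_eqF.
    have : 1 <= (k%:R / n%:R - y) ^+ 2 / s ^+ 2.
      rewrite ler_pdivlMr ?exprn_gt0 // mul1r -[leRHS]real_normK ?num_real //.
      by rewrite lerXn2r ?nnegrE // ltW.
    by move=> h; rewrite -[leLHS]mulr1; have : 2 * K * 1 <= 2 * K * ((k%:R / n%:R - y) ^+ 2 / s ^+ 2);
      [rewrite ler_wpM2l // mulr_ge0 | lra].
  have bound : (bern n (fun k => (L / n%:R ^+ 2) * (k%:R - n%:R * y) ^+ 2 + e / 2)).[y] <= e.
    rewrite bern_lin bern_sqr bern_cst subrr expr0n addr0.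
    have -> : L / n%:R ^+ 2 * (n%:R * y * (1 - y)) = L / n%:R * (y * (1 - y)).
      by field; rewrite gt_eqF.
    have yy : y * (1 - y) <= 1 by nra.
    have : L / n%:R * (y * (1 - y)) <= L / n%:R * 1.
      by rewrite ler_wpM2l // divr_ge0 // ltW.
    lra.
  have qE : q.[y] - g y = (bern n (fun k => 1 * g (k%:R / n%:R) + (- g y))).[y].
    by rewrite bern_lin bern_cst mul1r.
  rewrite qE ler_norml; apply/andP; split.
    rewrite -qE lerNl opprB addrC -mulN1r.
    have -> : -1 * q.[y] + g y = (bern n (fun k => -1 * g (k%:R / n%:R) + g y)).[y].
      by rewrite bern_lin bern_cst.
    apply: le_trans bound; apply: bern_le => // k kn; rewrite mulN1r addrC.
    by apply: le_trans (ler_norm _) _; rewrite distrC; exact: dev.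
  apply: le_trans bound; apply: bern_le => // k kn; rewrite mul1r.
  exact: le_trans (ler_norm _) (dev k kn).
clearbody q; exists (q \Po ((2 * a)^-1 *: ('X + a%:P))) => x xa.
have a2 : 2 * a != 0 by rewrite mulf_neq0 // gt_eqF.
have -> : f x = g ((2 * a)^-1 * (x + a)) by rewrite /g; congr f; field; rewrite gt_eqF.
rewrite horner_comp hornerZ hornerD hornerX hornerC; apply: qg.
move: xa; rewrite ler_norml => /andP[x1 x2].
by rewrite mulrC divr_ge0 ?ler_pdivrMr ?mulr_ge0 ?mulr_gt0 ?(ltW a0) //=; lra.
Qed.

End Weierstrass.

(** * Convergence in probability of the empirical measures *)

Lemma supported_Rintegral_poly (R : realType) (nu : {measure set R -> \bar R}) (I : set R)
    (K : R) (p : {poly R}) : measurable I -> (nu [set: R] < +oo)%E -> nu (~` I) = 0%E ->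
  (forall x, I x -> `|x| <= K) ->
  \int[nu]_x p.[x] = \sum_(k < size p) p`_k * \int[nu]_x x ^+ k.
Proof.
move=> mI nufin nuI IK.
have K0 x : I x -> 0 <= K by move=> /IK; exact: le_trans (normr_ge0 _).
have iX k : nu.-integrable [set: R] (EFin \o (fun x : R => x ^+ k)).
  apply: (supported_integrable mI nufin nuI (K := K ^+ k)); first exact: exprn_measurable.
  move=> x Ix; rewrite normrX.
  by rewrite lerXn2r ?nnegrE ?(K0 _ Ix) //; exact: IK.
rewrite /Rintegral; under eq_integral do rewrite horner_coef -sumEFin.
rewrite integral_sum //; last first.
  by move=> k; under eq_fun do rewrite EFinM; apply: integrableZl => //; exact: iX.
rewrite -sum_fine => [|k _]; last first.
  apply: integrable_fin_num => //; under eq_fun do rewrite EFinM.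
  by apply: integrableZl => //; exact: iX.
apply: eq_bigr => k _; under eq_integral do rewrite EFinM.
rewrite integralZl //; last exact: iX.
by rewrite fineM //; apply: integrable_fin_num => //; exact: iX.
Qed.

Lemma measurable_horner (R : realType) (p : {poly R}) :
  measurable_fun [set: R] (fun x => p.[x]).
Proof.
apply: continuous_measurable_fun => x; exact: continuous_horner.
Qed.

Section EmpiricalMeasure.
Local Open Scope complex_scope.
Local Open Scope ring_scope.
Variables (R : realType) (disp : measure_display) (Om : measurableType disp).
Variables (P : probability Om R) (d m r2 t : nat) (q : 'I_t -> nat) (N : nat).
Variable W : random_model P d m r2 q N.
Let A : finType := (letter d + lamp_letter m r2 t)%type.

Lemma random_matrix_eigenvalues w : exists v : 'I_N -> R, [/\
  forall f : R -> R, measurable_fun [set: R] f ->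
    \int[esd (random_matrix W w)]_x f x = N%:R^-1 * \sum_i f (v i),
  forall k, \sum_i v i ^+ k = complex.Re (\tr (random_matrix W w ^+ k)) &
  (forall c, dual q (model_value W w c)) -> forall i, `|v i| <= 1].
Proof.
rewrite random_matrixE.
have [v pv tv] := step_mx_eigenvalues (model_perm W w) (model_value_real W w).
exists v; split=> [f mf|k|dv].
- exact: esd_integral.
- by rewrite step_mx_trace -tv.
- apply: step_mx_eigenvalues_le1 tv => x l; exact: (dual_norm (dv x)).
Qed.

Lemma esd_horner w (p : {poly R}) :
  \int[esd (random_matrix W w)]_x p.[x] =
  \sum_(k < size p) p`_k * (N%:R^-1 * complex.Re (\tr (random_matrix W w ^+ k))).
Proof.
have [v [iv tv _]] := random_matrix_eigenvalues w.
rewrite iv; last exact: measurable_horner.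
under eq_bigr do rewrite horner_coef.
rewrite exchange_big mulr_sumr /=; apply: eq_bigr => k _.
by rewrite -mulr_sumr tv mulrCA.
Qed.

Lemma esd_close (f g : R -> R) (e : R) (v : 'I_N -> R) : 0 <= e ->
  (forall i, `|f (v i) - g (v i)| <= e) ->
  `|N%:R^-1 * \sum_i f (v i) - N%:R^-1 * \sum_i g (v i)| <= e.
Proof.
move=> e0 fg; rewrite -mulrBr -sumrB normrM ger0_norm ?invr_ge0 //.
apply: (@le_trans _ _ (N%:R^-1 * \sum_(i < N) e)).
  rewrite ler_wpM2l ?invr_ge0 //; apply: le_trans (ler_norm_sum _ _ _) _.
  exact: ler_sum.
rewrite sumr_const card_ord -[e *+ N]mulr_natl mulrA.
have [->|N0] := posnP N; first by rewrite mulr0 mul0r.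
by rewrite mulVf ?mul1r // pnatr_eq0 -lt0n.
Qed.

(** A pointwise limit of traces of polynomials of the matrix: the [n]-th polynomial
    is close to [f] on [[-n.+1, n.+1]], which eventually contains the spectrum.
    No bound on the spectrum holds for every sample, hence the growing segments. *)
Lemma measurable_esd_integral (f : R -> R) (K : R) : continuous f ->
  (forall x, `|f x| <= K) ->
  measurable_fun [set: Om] (fun w => \int[esd (random_matrix W w)]_x f x).
Proof.
move=> cf fK.
have hp (n : nat) : exists p : {poly R}, forall x, `|x| <= n.+1%:R ->
    `|p.[x] - f x| <= n.+1%:R^-1.
  by apply: weierstrass cf fK _ _; rewrite ?invr_gt0 ltr0n.
pose p n := sval (cid (hp n)).
have pP n x : `|x| <= n.+1%:R -> `|(p n).[x] - f x| <= n.+1%:R^-1.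
  exact: (svalP (cid (hp n))).
apply: (measurable_fun_cvg (h := fun n w => \int[esd (random_matrix W w)]_x (p n).[x])).
  move=> n; under eq_fun do rewrite esd_horner.
  apply: measurable_sum => k; apply: measurable_funM => //.
  by apply: measurable_funM => //; exact: measurable_trace.
move=> w _; have [v [iv _ _]] := random_matrix_eigenvalues w.
have mf : measurable_fun [set: R] f by exact: continuous_measurable_fun.
apply/cvgrPdist_le => e e0.
pose b := \sum_i `|v i|.
have b0 : 0 <= b by apply: sumr_ge0.
(* [b] bounds the eigenvalues of the sample [w] *)
exists (maxn (Num.truncn e^-1) (Num.truncn b)) => // n /=; rewrite geq_max => /andP[ne nb].
rewrite distrC iv ?iv //; last exact: measurable_horner.
apply: esd_close => [|i]; first exact: ltW.
apply: (@le_trans _ _ n.+1%:R^-1).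
  apply: pP; apply: (@le_trans _ _ b).
    by rewrite /b (bigD1 i) //= lerDl sumr_ge0.
  by apply: le_trans (ltW (truncnS_gt b)) _; rewrite ler_nat.
rewrite invf_ple ?posrE ?ltr0n //.
by apply: le_trans (ltW (truncnS_gt e^-1)) _; rewrite ler_nat.
Qed.

End EmpiricalMeasure.

Section WithHighProbability.
Variables (R : realType) (disp : nat -> measure_display).
Variables (Om : forall N : nat, measurableType (disp N)).
Variables (P : forall N : nat, probability (Om N) R).

(** [Q] holds with probability tending to one.  Stated with exceptional measurable
    sets, so that [Q] need not be an event. *)
Definition whp (Q : forall N, Om N -> Prop) : Prop :=
  forall delta : R, 0 < delta -> exists N0, forall N, (N0 <= N)%N ->
    exists B : set (Om N), [/\ measurable B, (P N B <= delta%:E)%E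
      & forall w, ~ B w -> Q N w].

Lemma whp_eventually (Q : forall N, Om N -> Prop) N0 :
  (forall N w, (N0 <= N)%N -> Q N w) -> whp Q.
Proof.
move=> hQ delta d0; exists N0 => N NN0; exists set0; split => //.
  by rewrite measure0 lee_fin ltW.
by move=> w _; exact: hQ.
Qed.

Lemma whp_and (Q1 Q2 : forall N, Om N -> Prop) : whp Q1 -> whp Q2 ->
  whp (fun N w => Q1 N w /\ Q2 N w).
Proof.
move=> h1 h2 delta d0; have d2 : 0 < delta / 2 by rewrite divr_gt0.
have [N1 {}h1] := h1 _ d2; have [N2 {}h2] := h2 _ d2.
exists (maxn N1 N2) => N; rewrite geq_max => /andP[/h1[B1 [m1 p1 b1]] /h2[B2 [m2 p2 b2]]].
exists (B1 `|` B2); split.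
- exact: measurableU.
- apply: le_trans (measureU2 _ m1 m2) _.
  have -> : delta%:E = ((delta / 2)%:E + (delta / 2)%:E)%E.
    by rewrite -EFinD; congr _%:E; field.
  exact: leeD.
- by move=> w /not_orP[/b1 ? /b2 ?].
Qed.

Lemma whp_imp (Q1 Q2 : forall N, Om N -> Prop) : (forall N w, Q1 N w -> Q2 N w) ->
  whp Q1 -> whp Q2.
Proof.
move=> h h1 delta d0; have [N0 {}h1] := h1 _ d0; exists N0 => N /h1[B [mB pB qB]].
by exists B; split => // w /qB; exact: h.
Qed.

Lemma whp_all (I : finType) (Q : I -> forall N, Om N -> Prop) : (forall i, whp (Q i)) ->
  whp (fun N w => forall i, Q i N w).
Proof.
move=> hQ.
suff : forall s : seq I, whp (fun N w => forall i, i \in s -> Q i N w).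
  move=> /(_ (enum I)); apply: whp_imp => N w h i; apply: h; exact: mem_enum.
elim=> [|i s IH]; first by apply: (whp_eventually (N0 := 0%N)).
apply: whp_imp (whp_and (hQ i) IH) => N w [qi qs] j.
by rewrite inE => /predU1P[->|/qs].
Qed.

Lemma whp_cvg0 (T : forall N, set (Om N)) : (forall N, measurable (T N)) ->
  whp (fun N w => ~ T N w) -> (fun N => P N (T N)) @ \oo --> 0%E.
Proof.
move=> mT hT; apply/fine_cvgP; split.
  by exists 0%N => // N _ /=; apply: fin_num_measure.
apply/cvgr0Pnorm_le => delta d0; have [N0 h] := hT _ d0; exists N0 => // N /= /h[B [mB pB qB]].
have fT : P N (T N) \is a fin_num by apply: fin_num_measure.
rewrite ger0_norm ?fine_ge0 // -lee_fin fineK //; apply: le_trans pB.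
apply: le_measure; rewrite ?inE // => w Tw; apply: contrapT => /qB; exact.
Qed.

End WithHighProbability.

Section MomentConvergence.
Local Open Scope complex_scope.
Local Open Scope ring_scope.
Variables (R : realType) (d m r2 t : nat) (q : 'I_t -> nat).
Hypothesis hq : forall j, (3 <= q j)%N.
Variables (disp : nat -> measure_display) (Om : forall N : nat, measurableType (disp N)).
Variables (P : forall N : nat, probability (Om N) R).
Variable W : forall N : nat, random_model (P N) d m r2 q N.
Let A : finType := (letter d + lamp_letter m r2 t)%type.
Let lam := @lamp_of_letter m r2 t q.

Definition dual_model N w := forall c, dual q (model_value (W N) w c).

Lemma whp_dual : whp P dual_model.
Proof.
move=> delta d0; exists 0%N => N _.
have [B [mB PB hB]] := good_event hq (leqnn 3) (W N) xpredT.
exists B; split=> //.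
  by apply: le_trans PB _; rewrite eq_card0 // mul0r lee_fin ltW.
by move=> w /hB[x _ ex] c; exact: (data_event_dual hq (leqnn 3) c ex).
Qed.

Lemma whp_word_trace (u : seq A) (eta : R) : 0 < eta ->
  whp P (fun N w => `|word_trace (model_perm (W N) w) (model_value (W N) w) u
      - N%:R * (wr_word lam u == 1%g)%:R| <= (eta * N%:R)%:C).
Proof.
move=> eta0; have [u1|u1] := eqVneq (wr_word lam u) 1%g.
  apply: whp_imp whp_dual => N w dw.
  rewrite (word_trace_eq1 hq) // mulr1 subrr normr0 ler0c mulr_ge0 // ltW //.
move=> delta d0; have [N0 h] := word_trace_concentration hq u1 eta0 d0.
exists N0 => N NN0; have [B [mB PB hB]] := h N _ _ (P N) (W N) NN0.
by exists B; split => // w /hB; rewrite mulr0 subr0.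
Qed.

(** The proportion of the words of length [k] that are trivial in the group. *)
Definition limit_moment k : R :=
  (#|A|%:R)^-1 ^+ k * wsum k (fun u : seq A => (wr_word lam u == 1)%g%:R).

Lemma whp_moment k (eta : R) : 0 < eta ->
  whp P (fun N w => `|N%:R^-1 * complex.Re (\tr (random_matrix (W N) w ^+ k))
     - limit_moment k| <= eta).
Proof.
move=> eta0.
have H := whp_all (fun u : k.-tuple A => @whp_word_trace u eta eta0).
have L : whp P (fun N (w : Om N) => (0 < N)%N) by apply: (@whp_eventually R disp Om P _ 1%N).
apply: whp_imp (whp_and H L) => N w [{}H N0].
have Np : (0 : R) < N%:R by rewrite ltr0n.
pose F u : R[i] := word_trace (model_perm (W N) w) (model_value (W N) w) u
      - N%:R * (wr_word lam u == 1%g)%:R.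
have tE : \tr (random_matrix (W N) w ^+ k) - (N%:R * limit_moment k)%:C =
   (#|A|%:R)^-1 ^+ k * wsum k (fun u => if size u == k then F u else 0).
  rewrite random_matrixE step_mx_trace /limit_moment mulrCA rmorphM.
  rewrite rmorphXn fmorphV rmorph_nat -mulrBr; apply: (f_equal (fun y => _ * y)).
  rewrite wsum_mulrl (wsum_morph (real_complex R)).
  rewrite wsumB; apply: eq_wsum => u su; rewrite su eqxx /F.
  rewrite -!natrM; congr (_ - _); exact: (rmorph_nat (real_complex R)).
have : `|\tr (random_matrix (W N) w ^+ k) - (N%:R * limit_moment k)%:C| <= (eta * N%:R)%:C.
  rewrite tE; apply: norm_wsum => u; case: eqP => [su|_].
    by have := H (Tuple (introT eqP su)).
  by rewrite normr0 ler0c mulr_ge0 // ltW.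
move=> h; have {h} : `|complex.Re (\tr (random_matrix (W N) w ^+ k)) - N%:R * limit_moment k| <= eta * N%:R.
  rewrite -lecR; apply: le_trans h; apply: le_trans (normc_ge_Re _).
  by rewrite raddfB.
rewrite -ler_pdivrMr // -[X in _ / X]ger0_norm ?ler0n // -normf_div.
by rewrite mulrBl mulrC [N%:R * _]mulrC mulfK // gt_eqF.
Qed.

End MomentConvergence.

Section Conclusion.
Variables (R : realType) (d m r2 t : nat) (q : 'I_t -> nat).
Hypothesis hq : forall j, (3 <= q j)%N.
Let G := wreath (lamp m r2 q) (free_group d).
Variable E : set R -> operator R G.
Hypothesis hE : spectral_resolution
  (markov_operator (R := R) (wr_gens (fg_gens d) (lamp_gens m r2 q))) E.
Variable mu : {measure set R -> \bar R}.
Hypothesis hmu : is_spectral_measure E (delta R (1%g : G)) mu.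
Variables (disp : nat -> measure_display) (Om : forall N : nat, measurableType (disp N)).
Variables (P : forall N : nat, probability (Om N) R).
Variable W : forall N : nat, random_model (P N) d m r2 q N.
Variables (f : R -> R) (K : R).
Hypothesis cf : continuous f.
Hypothesis fK : forall x, `|f x| <= K.

Lemma mu_mass : mu [set: R] = 1%E /\ mu (~` `[-1, 1]%classic) = 0%E.
Proof.
have [-> ->] := spectral_measure_support hE (delta_l2 R (1%g : G)) hmu.
by rewrite /sqn ip_delta /delta eqxx.
Qed.

Lemma limit_moment_mu k : \int[mu]_x x ^+ k = limit_moment R d m r2 q k.
Proof. exact: (markov_moment hq k hE hmu). Qed.

Lemma whp_esd_close (e : R) : 0 < e ->
  whp P (fun N w => `|\int[esd (random_matrix (W N) w)]_x f x - \int[mu]_x f x| < e).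
Proof.
move=> e0; pose eps := e / 4; have eps0 : 0 < eps by rewrite divr_gt0.
have [p pf] := weierstrass cf fK ltr01 eps0.
have [muT muI] := mu_mass.
have mufin : (mu [set: R] < +oo)%E by rewrite muT ltry.
have mI := @measurable_segment11 R.
have I1 (x : R) : `[-1, 1]%classic x -> `|x| <= 1.
  by rewrite /= in_itv /= ler_norml.
have mf : measurable_fun [set: R] f by exact: continuous_measurable_fun.
have mp := measurable_horner p.
have mu_pf : `|\int[mu]_x p.[x] - \int[mu]_x f x| <= eps.
  rewrite -RintegralB //; last 2 first.
  - apply: (supported_integrable mI mufin muI (K := K + eps)) => // x Ix.
    rewrite -(subrK (f x) p.[x]); apply: le_trans (ler_normD _ _) _.
    by rewrite addrC; apply: lerD => //; apply: pf; exact: I1.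
  - by apply: (supported_integrable mI mufin muI (K := K)).
  have := supported_Rintegral_le mI mufin muI (measurable_funB mp mf)
    (fun x Ix => pf x (I1 x Ix)).
  by rewrite muT mulr1.
pose S := \sum_(k < size p) `|p`_k| + 1.
have S0 : 0 < S by rewrite ltr_wpDl // sumr_ge0.
have eta0 : 0 < eps / S by rewrite divr_gt0.
have Hm := whp_all (fun k : 'I_(size p) => whp_moment hq W k eta0).
have Hd := whp_dual hq W.
apply: whp_imp (whp_and Hm Hd) => N w [{}Hm {}Hd].
have [v [iv _ v1]] := random_matrix_eigenvalues (W N) w.
have esd_pf : `|\int[esd (random_matrix (W N) w)]_x p.[x] -
    \int[esd (random_matrix (W N) w)]_x f x| <= eps.
  rewrite !iv //; apply: esd_close => [|i]; first exact: ltW.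
  by apply: pf; exact: v1.
have pp : `|\int[esd (random_matrix (W N) w)]_x p.[x] - \int[mu]_x p.[x]| <= eps.
  rewrite esd_horner (supported_Rintegral_poly p mI mufin muI I1) -sumrB.
  apply: le_trans (ler_norm_sum _ _ _) _.
  apply: (@le_trans _ _ (\sum_(k < size p) `|p`_k| * (eps / S))).
    apply: ler_sum => k _; by rewrite limit_moment_mu -mulrBr normrM ler_wpM2l.
  rewrite -mulr_suml mulrCA -[leRHS]mulr1 ler_pM2l // ler_pdivrMr // mul1r.
  by rewrite /S lerDl.
set a := \int[esd _]_x f x in esd_pf *; set b := \int[mu]_x f x in mu_pf *.
set a' := \int[esd _]_x p.[x] in esd_pf pp; set b' := \int[mu]_x p.[x] in mu_pf pp.
have -> : a - b = - (a' - a) + (a' - b') + (b' - b) by ring.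
apply: le_lt_trans (ler_normD _ _) _.
have := ler_normD (- (a' - a)) (a' - b'); rewrite normrN.
have : 4 * eps = e by rewrite /eps; field.
lra.
Qed.

End Conclusion.

Theorem theorem1p1 (R : realType) (d m r2 t : nat) (q : 'I_t -> nat)
    (hd : (1 <= d)%N) (hq : forall j, (3 <= q j)%N)
    (* the spectral resolution of the Markov operator *)
    (E : set R -> operator R (wreath (lamp m r2 q) (free_group d)))
    (hE : spectral_resolution
            (markov_operator (R := R) (wr_gens (fg_gens d) (lamp_gens m r2 q))) E)
    (* its spectral measure at the unit of G *)
    (mu : {measure set R -> \bar R})
    (hmu : is_spectral_measure E
             (delta R (1%g : wreath (lamp m r2 q) (free_group d))) mu)
    (* the random matrices, for each N on its own probability space *)
    (disp : nat -> measure_display)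
    (Om : forall N : nat, measurableType (disp N))
    (P : forall N : nat, probability (Om N) R)
    (W : forall N : nat, random_model (P N) d m r2 q N) :
  forall f : R -> R, continuous f -> (exists K, forall x, `|f x| <= K) ->
  forall e : R, 0 < e ->
    (fun N => P N [set w |
       e <= `| \int[esd (random_matrix (W N) w)]_x f x - \int[mu]_x f x |])
      @ \oo --> 0%E.
Proof.
move=> f cf [K fK] e e0.
apply: (whp_cvg0 (T := fun N => [set w |
  e <= `|\int[esd (random_matrix (W N) w)]_x f x - \int[mu]_x f x|])) => [N|].
  have mg : measurable_fun [set: Om N]
      (fun w => `|\int[esd (random_matrix (W N) w)]_x f x - \int[mu]_x f x|).
    apply: measurableT_comp => //; apply: measurable_funB => //.
    exact: measurable_esd_integral cf fK.
  have := mg measurableT `[e, +oo[%classic (measurable_itv _).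
  by rewrite setTI; congr measurable; apply/seteqP; split => w; rewrite /= in_itv /= andbT.
apply: whp_imp (whp_esd_close hq hE hmu W cf fK e0) => N w h /=.
by apply/negP; rewrite -ltNge.
Qed.
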